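(* Let $X_{n,k}$ be the number of subtrees of size $k$ in the random binary search tree $\mathcal{T}_n$, and let $\hat X_{n,k}$ be the number of subtrees of size $k$ in the random recursive tree $\Lambda_n$. Let $k=k_n$ be positive integers with $k_n=o(\sqrt n)$. Then, as $n\to\infty$, $$\frac{X_{n,k}-\mathbb{E}(X_{n,k})}{\sqrt{\mathrm{Var}(X_{n,k})}}\xrightarrow{d}\mathcal{N}(0,1)$$ and $$\frac{\hat X_{n,k}-\mathbb{E}(\hat X_{n,k})}{\sqrt{\mathrm{Var}(\hat X_{n,k})}}\xrightarrow{d}\mathcal{N}(0,1).$$
   Context: Random binary search tree $\mathcal{T}_n$: insert the keys of a uniformly random permutation of $\{1,\dots,n\}$ one by one; the first key is placed at the root, and each later key starts at the root and at each occupied node proceeds to the left child position if it is smaller than the key there and to the right child position if it is larger, until it reaches an empty position, where it is placed. Random recursive tree $\Lambda_n$: start with a root labelled $1$; for $i=2,\dots,n$, node $i$ is attached as a child of a uniformly random node among $1,\dots,i-1$ (independently of earlier choices). The size of a tree is its number of nodes. A subtree always means a fringe subtree: a node together with all its descendants. $\xrightarrow{d}$ denotes convergence in distribution. *)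

(* Defs.v *)
From HB Require Import structures.
From mathcomp Require Import all_boot all_order all_algebra all_fingroup.
From mathcomp Require Import all_classical all_reals all_analysis.
From mathcomp Require Import measurable_realfun.

Set Implicit Arguments.
Unset Strict Implicit.
Unset Printing Implicit Defensive.

Import Order.TTheory GRing.Theory Num.Theory.
Import numFieldNormedType.Exports.

Local Open Scope classical_set_scope.
Local Open Scope ring_scope.

Section finite_range.
Context d d' (Om : measurableType d) (T : measurableType d').

Lemma measurable_fun_finite_range (F : finType) (h : Om -> F) (phi : F -> T) :
  (forall a, measurable (h @^-1` [set a])) -> measurable_fun setT (phi \o h).
Proof.
move=> mh _ B mB; rewrite setTI.
rewrite (_ : _ @^-1` B = \bigcup_(a in phi @^-1` B) h @^-1` [set a]).
  by apply: fin_bigcup_measurable => // a _; exact: mh.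
by apply/seteqP; split=> [w /= Bw|w [a /= Ba /= ->]//]; exists (h w).
Qed.

End finite_range.

Section convergence_in_distribution.
Context (R : realType) (d : nat -> measure_display).
Context (Om : forall n, measurableType (d n)) (P : forall n, probability (Om n) R).

(* Each X n may live on its own probability space. The limit is required at the
   continuity points of the limit cdf, i.e. where mu has no atom. *)
Definition cvg_in_distribution (X : forall n, {RV (P n) >-> R})
    (mu : probability (measurableTypeR R) R) :=
  forall x : R, mu [set x] = 0%E ->
    (fun n => cdf (X n) x) @ \oo --> mu `]-oo, x]%classic.

End convergence_in_distribution.

Section standardization.
Context (R : realType) d (Om : measurableType d) (P : probability Om R).
Variable X : {RV P >-> R}.

(* Equal to 0 when the variance vanishes, since 0^-1 = 0. *)
Definition standardized (w : Om) : R :=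
  (X w - fine 'E_P[X]) / Num.sqrt (fine 'V_P[X]).

Let measurable_standardized : measurable_fun setT standardized.
Proof. by apply: measurable_funM => //; exact: measurable_funB. Qed.

HB.instance Definition _ :=
  isMeasurableFun.Build _ _ _ _ standardized measurable_standardized.

Definition standardized_RV : {RV P >-> R} := standardized.

End standardization.

Section independence.
Context (R : realType) d d' (Om : measurableType d) (T : measurableType d').
Context (P : probability Om R).

Definition mutually_independent (I : finType) (A : {set I})
    (X : I -> {RV P >-> T}) :=
  forall (J : {set I}) (B : I -> set T),
    J \subset A -> (forall i, measurable (B i)) ->
    P (\bigcap_(i in [set` J]) X i @^-1` B i) =
    (\prod_(i in J) P (X i @^-1` B i))%E.

End independence.

Inductive bintree := Leaf | Node of bintree & nat & bintree.

Fixpoint bt_size (t : bintree) : nat :=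
  if t is Node l _ r then (bt_size l + bt_size r).+1 else 0.

Fixpoint bst_insert (t : bintree) (x : nat) : bintree :=
  if t is Node l y r then
    if (x < y)%N then Node (bst_insert l x) y r else Node l y (bst_insert r x)
  else Node Leaf x Leaf.

Definition bst_of_seq (s : seq nat) : bintree := foldl bst_insert Leaf s.

(* A Leaf is an empty position, not a node, so it roots no fringe subtree. *)
Fixpoint bt_subtrees (k : nat) (t : bintree) : nat :=
  if t is Node l _ r then
    ((bt_size t == k) + bt_subtrees k l + bt_subtrees k r)%N
  else 0%N.

(* The keys are 1, ..., n; the i-th one inserted (from i = 0) is (s i).+1. *)
Definition bst_of_perm n (s : {perm 'I_n}) : bintree :=
  bst_of_seq [seq (s i).+1 | i <- enum 'I_n].

HB.instance Definition _ (T : finType) := isPointed.Build (perm_type T) 1%g.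

HB.instance Definition _ (T : finType) := @isMeasurable.Build
  default_measure_display (perm_type T) discrete_measurable discrete_measurable0
  discrete_measurableC discrete_measurableU.

Section random_bst.
Context (R : realType) d (Om : measurableType d) (P : probability Om R) (n : nat).

Definition is_uniform_perm (s : {RV P >-> {perm 'I_n}}) :=
  forall t : {perm 'I_n}, P (s @^-1` [set t]) = ((n`!)%:R^-1)%:E.

Variables (s : {RV P >-> {perm 'I_n}}) (k : nat).

Definition bst_count (w : Om) : R := (bt_subtrees k (bst_of_perm (s w)))%:R.

Let measurable_bst_count : measurable_fun setT bst_count.
Proof.
pose f (t : {perm 'I_n}) : R := (bt_subtrees k (bst_of_perm t))%:R.
have -> : bst_count = f \o s by [].
apply: measurable_fun_finite_range => a.
by exact: measurable_funPTI.
Qed.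

HB.instance Definition _ :=
  isMeasurableFun.Build _ _ _ _ bst_count measurable_bst_count.

Definition bst_count_RV : {RV P >-> R} := bst_count.

End random_bst.

(* The tree on the nodes 0, ..., n-1 with root 0 in which p u is the parent of
   u > 0; thus node i here is the node labelled i + 1 when labels start at 1. *)
Definition rt_edge n (p : 'I_n -> nat) : rel 'I_n :=
  [rel u v : 'I_n | (0 < u)%N && (p u == v)].

Definition rt_subtree n (p : 'I_n -> nat) (v : 'I_n) : {set 'I_n} :=
  [set u | connect (rt_edge p) u v]%SET.

Definition rt_subtrees n (k : nat) (p : 'I_n -> nat) : nat :=
  #|[set v | #|rt_subtree p v| == k]%SET|.

Section random_recursive_tree.
Context (R : realType) d (Om : measurableType d) (P : probability Om R) (n : nat).

(* The value p 0 is never used and is left unconstrained. *)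
Definition is_uniform_attachment (p : 'I_n -> {RV P >-> nat}) :=
  (forall (i : 'I_n) (j : nat), (j < i)%N ->
     P (p i @^-1` [set j]) = (i%:R^-1)%:E) /\
  mutually_independent [set i : 'I_n | (0 < i)%N]%SET p.

Variables (p : 'I_n -> {RV P >-> nat}) (k : nat).

Definition rrt_count (w : Om) : R := (rt_subtrees k (fun i => p i w))%:R.

Let measurable_rrt_count : measurable_fun setT rrt_count.
Proof.
pose h (w : Om) : {ffun 'I_n -> 'I_n.+1} := [ffun i => inord (minn (p i w) n)].
pose f (a : {ffun 'I_n -> 'I_n.+1}) : R :=
  (rt_subtrees k (fun i => val (a i)))%:R.
have -> : rrt_count = f \o h.
  apply/funext => w; rewrite /rrt_count /f /= /rt_subtrees; congr (_%:R).
  apply: eq_card => v; rewrite !inE; congr (_ == k); apply: eq_card => u.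
  rewrite !inE; apply: eq_connect => x y /=; congr (_ && _).
  rewrite ffunE inordK ?ltnS ?geq_minr// /minn; case: ltnP => // nlep.
  by rewrite !gtn_eqF// (leq_trans (ltn_ord y)).
apply: measurable_fun_finite_range => a.
rewrite (_ : _ @^-1` _ = \bigcap_(i in [set: 'I_n])
    p i @^-1` [set m | inord (minn m n) = a i]).
  apply: fin_bigcap_measurable => // i _.
  by exact: measurable_funPTI.
apply/seteqP; split=> w /=.
  by move=> <- i _ /=; rewrite ffunE.
by move=> H; apply/ffunP => i; rewrite ffunE; exact: H.
Qed.

HB.instance Definition _ :=
  isMeasurableFun.Build _ _ _ _ rrt_count measurable_rrt_count.

Definition rrt_count_RV : {RV P >-> R} := rrt_count.

End random_recursive_tree.

(* Main.v *)
(* Let F_n(z) = E z^X for the count X in a tree of size n. Splitting a binary search tree at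
   its root shows that y(x) = sum_n F_n(z) x^n solves the Riccati equation
   y' = y^2 + k (z - 1) x^(k-1), so y = - D'/D for a lacunary series D with D'' = - k (z - 1)
   x^(k-1) D. For recursive trees the last node is attached uniformly, so dismantling the tree
   node by node merges uniformly chosen parts of a composition of n; this yields the Bernoulli
   equation y' = y^2 + (z - 1) x^(k-1) y, and 1/y is again lacunary.
   For z = e^t the denominator almost vanishes at rho = exp (- (m t + v t^2 / 2)), the error
   being O(t^3 / k^2). Multiplying the denominator out of the recurrence turns this into a
   renewal inequality for the increments of F_n rho^n, whence
   F_n rho^n = 1 + O(|t| + n |t|^3 / k^2) uniformly in k. With t = s / sqrt (n v), where v has
   order at least 1 / k^2, the error tends to 0 exactly because k = o(sqrt n), and the
   normalized moment generating function tends to exp (s^2 / 2).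
   Convergence of moment generating functions gives convergence of expectations for all
   exponentials, then polynomials, then cosines by Taylor expansion, and then for
   (1 - u^N)^(2^N) with u a rescaled cosine, which approximates an indicator of a half-line on
   a large interval; this is convergence in distribution. First and second moments converge
   too, so standardizing by the exact mean and variance makes no difference. *)

From HB Require Import structures.
Require Import Defs.
From mathcomp Require Import all_boot all_order all_algebra all_fingroup.
From mathcomp Require Import all_classical all_reals all_analysis.
From mathcomp Require Import measurable_realfun ring lra zify.

Set Implicit Arguments.
Unset Strict Implicit.
Unset Printing Implicit Defensive.

Import Order.TTheory GRing.Theory Num.Theory.
Import numFieldNormedType.Exports.

Local Open Scope classical_set_scope.
Local Open Scope ring_scope.

(** * Convolutions and a renewal estimate *)

(** No exact root of the denominator D is ever located. The coefficients of D(rho x) / (1 - x) are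
    the partial sums of D(rho x); the zeroth is 1, and if the others have small l1 norm the quotient
    is invertible in the Banach algebra l1, which bounds all increments of F_n rho^n at once. An
    approximate root costs |D(rho)| in each of n partial sums: hence the error n |t|^3 / k^2. The
    error |t| comes from the coefficients, which are O(|t| / k) in degree about k, so that weighting
    them by the degree stays harmless. Uniformity in k holds because, once rescaled by powers of k,
    all parameters lie in fixed bounded ranges. For fixed n the series are cut to polynomials whose
    identities hold up to degree n, so no convergence question arises. Only real t occurs, so order
    arguments replace complex analysis; the price is the passage from moment generating functions to
    distribution functions by explicit approximation. For recursive trees F_n belongs to n + 1 nodes
    and omits the factor of the whole tree, which is 1 as soon as its size differs from k. *)

Lemma exchange_triangle (R : nmodType) n (f : nat -> nat -> R) :
  \sum_(i < n) \sum_(j < i.+1) f i j =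
  \sum_(j < n) \sum_(i < n | (j <= i)%N) f i j.
Proof.
transitivity (\sum_(i < n) \sum_(j < n | (j <= i)%N) f i j).
  by apply: eq_bigr => i _; rewrite (big_ord_widen n (fun j => f i j)).
exact: (exchange_big_dep xpredT).
Qed.

Lemma sum_ord_shift (R : nmodType) n j (e : nat -> R) : (j <= n)%N ->
  \sum_(i < n | (j <= i)%N) e (i - j)%N = \sum_(i < n - j) e i.
Proof.
move=> jn; rewrite -(big_mkord (fun i => (j <= i)%N) (fun i => e (i - j)%N)).
rewrite -(big_mkord xpredT e) (@big_cat_nat _ _ _ j)//=.
rewrite big_nat_cond big1 ?add0r; last by move=> i; lia.
rewrite -{1}[j]add0n big_addn big_nat_cond [RHS]big_nat_cond.
by apply: eq_big => i; rewrite ?addnK// leq_addl andbT.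
Qed.

(** Truncated form of the submultiplicativity of the l1 norm. *)
Lemma sum_convolution_le (R : numDomainType) n (g e : nat -> R) :
  (forall i, 0 <= g i) -> (forall i, 0 <= e i) ->
  \sum_(i < n) \sum_(j < i.+1) g j * e (i - j)%N <=
  (\sum_(i < n) g i) * (\sum_(i < n) e i).
Proof.
move=> g0 e0; rewrite (exchange_triangle _ (fun i j => g j * e (i - j)%N)).
rewrite mulr_suml ler_sum// => j _.
rewrite -mulr_sumr ler_wpM2l// sum_ord_shift 1?ltnW//.
rewrite -!(big_mkord xpredT e) (@big_cat_nat _ _ _ (n - j) 0 n)//= ?leq_subr//.
by rewrite ler_wpDr ?sumr_ge0.
Qed.

(** Coefficient form of (d / (1 - x)) e = d (e / (1 - x)). *)
Lemma summation_by_parts (R : pzRingType) m (d e : nat -> R) :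
  \sum_(j < m.+1) (\sum_(i < j.+1) d i) * e (m - j)%N =
  \sum_(i < m.+1) d i * \sum_(j < (m - i).+1) e j.
Proof.
under eq_bigr do rewrite mulr_suml.
rewrite (exchange_triangle _ (fun j i => d i * e (m - j)%N)).
apply: eq_bigr => i _; rewrite -mulr_sumr; congr (_ * _).
rewrite (big_ord_widen m.+1 e) ?ltnS ?leq_subr// [RHS](reindex_inj rev_ord_inj)/=.
by apply: eq_bigl => j; rewrite subSS ltnS leq_sub2lE// -ltnS.
Qed.

(** With [g] the partial sums of [d] and [e] the increments of [f], the relation D F = N becomes a
    convolution of [g] and [e]. As [g] starts with 1 and the rest has l1 norm at most [th], the l1
    norm [S] of the later increments satisfies S <= th' + th (1 + S), and these increments add up to
    [F n * rho ^+ n - 1]. *)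
Lemma renewal_estimate (R : realFieldType) (n : nat) (D F N : nat -> R)
    (rho th th' : R) :
  0 <= rho -> th < 1 -> D 0%N = 1 -> N 0%N = 1 ->
  (forall i, (i <= n)%N -> \sum_(j < i.+1) D j * F (i - j)%N = N i) ->
  \sum_(i < n) `|\sum_(j < i.+2) D j * rho ^+ j| <= th ->
  \sum_(i < n) `|N i.+1 * rho ^+ i.+1| <= th' ->
  `|F n * rho ^+ n - 1| <= (th + th') / (1 - th).
Proof.
move=> rho0 th1 D0 N0 DFN gth Nth.
pose f i := F i * rho ^+ i.
pose d i := D i * rho ^+ i.
pose g i := \sum_(j < i.+1) d j.
pose e i := if i is i'.+1 then f i - f i' else f 0%N.
have fE m : f m = \sum_(i < m.+1) e i.
  elim: m => [|m IH]; first by rewrite big_ord1.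
  by rewrite big_ord_recr/= -IH addrC subrK.
clearbody e.
have ge m : (m <= n)%N -> \sum_(j < m.+1) g j * e (m - j)%N = N m * rho ^+ m.
  move=> mn; rewrite summation_by_parts -DFN// mulr_suml.
  apply: eq_bigr => j _; rewrite -fE /f /d mulrACA -exprD subnKC//.
  by rewrite -ltnS.
have g0 : g 0%N = 1 by rewrite /g big_ord1 /d D0 mul1r expr0.
have e0 : e 0%N = 1 by have := ge 0%N isT; rewrite big_ord1 g0 mul1r N0 mul1r.
have ei i : (i < n)%N -> `|e i.+1| <= `|N i.+1 * rho ^+ i.+1| +
    \sum_(j < i.+1) `|g j.+1| * `|e (i - j)%N|.
  move=> lt_in; rewrite -ge// big_ord_recl/= subn0 g0 mul1r.
  under eq_bigr do rewrite /bump/= add1n subSS.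
  have -> : \sum_(j < i.+1) `|g j.+1| * `|e (i - j)%N| =
      \sum_(j < i.+1) `|g j.+1 * e (i - j)%N|.
    by apply: eq_bigr => j _; rewrite normrM.
  have h : `|\sum_(j < i.+1) g j.+1 * e (i - j)%N| <=
      \sum_(j < i.+1) `|g j.+1 * e (i - j)%N| by apply: ler_norm_sum.
  set x := \sum_(j < i.+1) g j.+1 * _ in h *.
  by have := ler_normB (e i.+1 + x) x; rewrite addrK; lra.
pose S := \sum_(i < n) `|e i.+1|.
have S0 : 0 <= S by rewrite sumr_ge0.
have Sle : S <= th' + th * (1 + S).
  have h1 : S <= \sum_(i < n) (`|N i.+1 * rho ^+ i.+1| +
      \sum_(j < i.+1) `|g j.+1| * `|e (i - j)%N|).
    by apply: ler_sum => i _; exact: ei.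
  apply: (le_trans h1); rewrite big_split/= lerD//.
  have h2 := sum_convolution_le n (fun j => normr_ge0 (g j.+1))
    (fun j => normr_ge0 (e j)).
  apply: (le_trans h2); rewrite ler_pM ?sumr_ge0//.
  rewrite {h1 h2 S0}/S; case: (n) => [|p]; first by rewrite !big_ord0 addr0.
  by rewrite big_ord_recl/= e0 normr1 lerD2l big_ord_recr/= lerDl.
have -> : F n * rho ^+ n - 1 = \sum_(i < n) e i.+1.
  by rewrite -/(f n) fE big_ord_recl/= e0 addrC addKr.
rewrite ler_pdivlMr ?subr_gt0//.
have H : `|\sum_(i < n) e i.+1| <= S := ler_norm_sum _ _ _.
have H2 : `|\sum_(i < n) e i.+1| * (1 - th) <= S * (1 - th).
  by rewrite ler_wpM2r// subr_ge0 ltW.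
by lra.
Qed.

(** * Lacunary denominators *)

Section power_series.
Variable R : realFieldType.
Implicit Types (p q : {poly R}) (F A B : nat -> R) (n k K M : nat).

Definition order_ge n p := forall i, (i < n)%N -> p`_i = 0.

Lemma order_geD n p q : order_ge n p -> order_ge n q -> order_ge n (p + q).
Proof. by move=> hp hq i ni; rewrite coefD hp// hq// addr0. Qed.

Lemma order_geM n p q : order_ge n q -> order_ge n (p * q).
Proof.
move=> hq i ni; rewrite coefM big1// => j _.
by rewrite hq ?mulr0// (leq_ltn_trans (leq_subr _ _)).
Qed.

(** Uniqueness for a linear differential equation: in characteristic 0 the coefficient of index i +
    1 is determined by the earlier ones. *)
Lemma order_ge_ode n p q r :
  p^`() = q * p + r -> order_ge n r -> p`_0 = 0 -> order_ge n.+1 p.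
Proof.
move=> pE r0 p0; elim/ltn_ind => -[//|i] IH lt_in.
have : p^`()`_i = 0.
  rewrite pE coefD r0// addr0 coefM big1// => j _.
  by rewrite IH ?mulr0//; have := leq_subr j i; lia.
by rewrite coef_deriv => /eqP; rewrite mulrn_eq0/= => /eqP.
Qed.

Definition trunc n F : {poly R} := \poly_(i < n) F i.

Lemma coef_truncM n F i p :
  (i < n)%N -> (p * trunc n F)`_i = \sum_(j < i.+1) p`_j * F (i - j)%N.
Proof.
move=> ni; rewrite coefM; apply: eq_bigr => j _.
by rewrite coef_poly (leq_ltn_trans (leq_subr _ _) ni).
Qed.

Lemma coef_truncMM n F i : (i < n)%N ->
  (trunc n F * trunc n F)`_i = \sum_(j < i.+1) F j * F (i - j)%N.
Proof.
move=> ni; rewrite coef_truncM//; apply: eq_bigr => j _.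
by rewrite coef_poly (leq_ltn_trans _ ni)// -ltnS.
Qed.

Definition lacunary A B K M : {poly R} :=
  \sum_(m < M.+1) (A m *: 'X^(m * K) - B m *: 'X^((m * K).+1)).

Lemma lacunaryS A B K M : lacunary A B K M.+1 = lacunary A B K M +
  (A M.+1 *: 'X^(M.+1 * K) - B M.+1 *: 'X^((M.+1 * K).+1)).
Proof. by rewrite /lacunary big_ord_recr. Qed.

(** The linear equation D' = -1 - e x^(k-1) D satisfied by D = 1/y. [A] gives the homogeneous
    solution exp(-e x^k / k), [- B] a particular one; each block cancels the defect of the previous
    one, so only the last defect survives. *)
Lemma rrt_series_ode A B (e : R) k M : (0 < k)%N -> A 0%N = 1 -> B 0%N = 1 ->
  (forall m, A m.+1 * (m.+1 * k)%:R = - e * A m) ->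
  (forall m, B m.+1 * (m.+1 * k).+1%:R = - e * B m) ->
  (lacunary A B k M)^`() + 1 + e%:P * 'X^(k.-1) * lacunary A B k M =
  e%:P * 'X^(k.-1) * (A M *: 'X^(M * k) - B M *: 'X^((M * k).+1)).
Proof.
case: k => // k _ A0 B0 AS BS /=; elim: M => [|M IH].
  rewrite /lacunary big_ord1 A0 B0 !scale1r expr0 expr1 derivB derivC derivX.
  by rewrite sub0r addNr add0r.
set t := A M.+1 *: _ - _ in IH *; rewrite lacunaryS -/t derivD mulrDr.
have -> : t^`() =
    - (e%:P * 'X^k * (A M *: 'X^(M * k.+1) - B M *: 'X^((M * k.+1).+1))).
  rewrite /t derivB !derivZ !derivXn -!(@scaler_nat R {poly R}) !scalerA AS BS /=.
  rewrite mulSn addSn /= -!mul_polyC !(exprS, exprD) !polyCM !polyCN; ring.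
by rewrite -IH; ring.
Qed.

(** Two solutions of D'' = -w x^(k-1) D, supported on exponents congruent to 0 and 1 modulo k + 1,
    combined so that D(0) = 1 and D'(0) = -1. *)
Lemma bst_series_ode A B (w : R) k M : (0 < k)%N -> A 0%N = 1 -> B 0%N = 1 ->
  (forall m, A m.+1 * ((m.+1 * k.+1)%:R * (m.+1 * k.+1).-1%:R) = - w * A m) ->
  (forall m, B m.+1 * ((m.+1 * k.+1).+1%:R * (m.+1 * k.+1)%:R) = - w * B m) ->
  (lacunary A B k.+1 M)^`()^`() + w%:P * 'X^(k.-1) * lacunary A B k.+1 M =
  w%:P * 'X^(k.-1) * (A M *: 'X^(M * k.+1) - B M *: 'X^((M * k.+1).+1)).
Proof.
case: k => // k _ A0 B0 AS BS /=; elim: M => [|M IH].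
  rewrite /lacunary big_ord1 A0 B0 !scale1r expr0 expr1 derivB derivC derivX.
  by rewrite sub0r derivN derivC oppr0 add0r.
set t := A M.+1 *: _ - _ in IH *; rewrite lacunaryS -/t (derivD _ t) (derivD _ t^`()) mulrDr.
have -> : t^`()^`() =
    - (w%:P * 'X^k * (A M *: 'X^(M * k.+2) - B M *: 'X^((M * k.+2).+1))).
  rewrite /t derivB !derivZ !derivXn !derivB !derivZ !derivMn !derivXn.
  have := AS M; have := BS M; rewrite mulSn !addSn /= => BS' AS'.
  rewrite -!mulrnA -!(@scaler_nat R {poly R}) !scalerA !natrM.
  rewrite [_%:R * _]mulrC AS' [X in _ - (B _ * X) *: _]mulrC BS'.
  by rewrite -!mul_polyC !(exprS, exprD) !polyCM !polyCN; ring.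
by rewrite -IH; ring.
Qed.

Lemma coef_XnM_trunc n k F (e : R) i : (i < n)%N ->
  (e%:P * 'X^k * trunc n F)`_i = e * (if (i < k)%N then 0 else F (i - k)%N).
Proof.
move=> ni; rewrite -mulrA coefCM coefXnM; case: ifP => // _.
by rewrite coef_poly (leq_ltn_trans (leq_subr _ _) ni).
Qed.

(** Cutting after [n] blocks is harmless up to degree n: the defect starts in degree n K >= n. *)
Lemma lacunary_tail_order A B K n p : (0 < K)%N ->
  order_ge n (p * (A n *: 'X^(n * K) - B n *: 'X^((n * K).+1))).
Proof.
move=> K0; apply: order_geM => j jn.
by rewrite coefB !coefZ !coefXn !ltn_eqF ?mulr0 ?subr0//; nia.
Qed.

Lemma coef0_lacunary A B K M : (0 < K)%N -> A 0%N = 1 -> (lacunary A B K M)`_0 = 1.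
Proof.
move=> K0 A0; rewrite /lacunary coef_sum big_ord_recl/= big1 => [|i _].
  by rewrite coefB !coefZ !coefXn/= !mulr0 subr0 mulr1 addr0.
by rewrite coefB !coefZ !coefXn !ltn_eqF ?mulr0 ?subr0// /bump/= add1n muln_gt0.
Qed.

Lemma coef1_lacunary A B K M : (1 < K)%N -> B 0%N = 1 -> (lacunary A B K M)`_1 = -1.
Proof.
move=> K1 B0; rewrite /lacunary coef_sum big_ord_recl/= big1 => [|i _].
  by rewrite coefB !coefZ !coefXn/= B0 mulr0 mulr1 sub0r addr0.
by rewrite coefB !coefZ !coefXn !ltn_eqF ?mulr0 ?subr0// /bump/= add1n; nia.
Qed.

(** [E1] and [E2] are the defects of the two differential equations. Since (D f - 1)' = f (D f - 1)
    + (f E2 + D E1) and the last bracket has order n, uniqueness gives D f = 1 up to degree n. *)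
Lemma rrt_denominator A B (e : R) k n F : (0 < k)%N ->
  A 0%N = 1 -> B 0%N = 1 ->
  (forall m, A m.+1 * (m.+1 * k)%:R = - e * A m) ->
  (forall m, B m.+1 * (m.+1 * k).+1%:R = - e * B m) ->
  F 0%N = 1 ->
  (forall m, F m.+1 * m.+1%:R = \sum_(j < m.+1) F j * F (m - j)%N +
     e * (if (m.+1 < k)%N then 0 else F (m.+1 - k)%N)) ->
  forall i, (i <= n)%N ->
    \sum_(j < i.+1) (lacunary A B k n)`_j * F (i - j)%N = (i == 0%N)%:R.
Proof.
move=> k0 A0 B0 AS BS F0 FS i le_in.
pose D := lacunary A B k n; pose f := trunc n.+1 F.
rewrite -(@coef_truncM n.+1)// -/D -/f.
pose E1 := f^`() - f * f - e%:P * 'X^(k.-1) * f.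
pose E2 := D^`() + 1 + e%:P * 'X^(k.-1) * D.
have E1n : order_ge n E1.
  move=> j jn; have j1 := ltnW jn.
  rewrite !coefB coef_truncMM// coef_XnM_trunc//.
  rewrite coef_deriv coef_poly ltnS jn -mulr_natr FS {FS}.
  case: k k0 {AS BS D E2 E1} => // k _ /=; rewrite ltnS subSS.
  by ring.
have E2n : order_ge n E2.
  by rewrite /E2 (rrt_series_ode _ k0)//; exact: lacunary_tail_order.
suff : order_ge n.+1 (D * f - 1).
  by move=> /(_ i le_in)/eqP; rewrite coefB coef1 subr_eq0 => /eqP.
apply: (@order_ge_ode _ _ f (f * E2 + D * E1)).
- by rewrite derivB derivM derivC /E1 /E2; ring.
- by apply: order_geD; exact: order_geM.
- rewrite coefB coef1 coef_truncM// big_ord1 coef0_lacunary// F0 mulr1.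
  by rewrite subrr.
Qed.

(** Here p = D f + D' satisfies p' = f p + (E2 + D E1), and p(0) = 0 because D(0) = 1 and D'(0) =
    -1. *)
Lemma bst_denominator A B (w : R) k n F : (0 < k)%N ->
  A 0%N = 1 -> B 0%N = 1 ->
  (forall m, A m.+1 * ((m.+1 * k.+1)%:R * (m.+1 * k.+1).-1%:R) = - w * A m) ->
  (forall m, B m.+1 * ((m.+1 * k.+1).+1%:R * (m.+1 * k.+1)%:R) = - w * B m) ->
  F 0%N = 1 ->
  (forall m, F m.+1 * m.+1%:R = \sum_(j < m.+1) F j * F (m - j)%N +
     w * (m.+1 == k)%:R) ->
  forall i, (i <= n)%N ->
    \sum_(j < i.+1) (lacunary A B k.+1 n)`_j * F (i - j)%N =
    - (lacunary A B k.+1 n)^`()`_i.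
Proof.
move=> k0 A0 B0 AS BS F0 FS i le_in.
pose D := lacunary A B k.+1 n; pose f := trunc n.+1 F.
rewrite -(@coef_truncM n.+1)// -/D -/f.
pose E1 := f^`() - f * f - w%:P * 'X^(k.-1).
pose E2 := D^`()^`() + w%:P * 'X^(k.-1) * D.
have E1n : order_ge n E1.
  move=> j jn; rewrite !coefB coef_truncMM 1?ltnW//.
  rewrite coef_deriv coef_poly ltnS jn -mulr_natr FS {FS} coefCM coefXn.
  case: k k0 {AS BS D E2 E1} => // k _ /=; rewrite eqSS.
  by ring.
have E2n : order_ge n E2.
  by rewrite /E2 (bst_series_ode _ k0)//; exact: lacunary_tail_order.
suff : order_ge n.+1 (D * f + D^`()).
  by move=> /(_ i le_in)/eqP; rewrite coefD addr_eq0 => /eqP.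
apply: (@order_ge_ode _ _ f (E2 + D * E1)).
- by rewrite derivD derivM /E1 /E2; ring.
- by apply: order_geD => //; exact: order_geM.
- rewrite coefD coef_truncM// big_ord1 coef0_lacunary// F0 mulr1.
  by rewrite coef_deriv coef1_lacunary// subrr.
Qed.

End power_series.

(** * Taylor remainders *)

Section exp_remainder.
Variable R : realType.
Implicit Types (x y r : R) (u : R ^nat).

Lemma expR_ge_sum n r : 0 <= r -> \sum_(i < n) r ^+ i / i`!%:R <= expR r.
Proof.
move=> r0; have := @nondecreasing_cvgn_le _ (series (exp_coeff r)) _ (is_cvg_series_exp_coeff r) n.
rewrite /series/= big_mkord; apply.
apply/nondecreasing_seqP => m.
by rewrite /series/= big_nat_recr//= lerDl exp_coeff_ge0.
Qed.

(** Since n! i! divides (n + i)!, each tail term is at most the first one times r^i / i!. *)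
Lemma exp_tail_le n m r : 0 <= r ->
  \sum_(i < m) r ^+ (n + i) / (n + i)`!%:R <= r ^+ n / n`!%:R * expR r.
Proof.
move=> r0.
apply: (@le_trans _ _ (r ^+ n / n`!%:R * \sum_(i < m) r ^+ i / i`!%:R)).
  rewrite mulr_sumr ler_sum// => i _; rewrite exprD mulrACA.
  rewrite ler_wpM2l ?mulr_ge0 ?exprn_ge0// -invfM lef_pV2 ?posrE ?mulr_gt0 ?ltr0n ?fact_gt0//.
  rewrite -natrM ler_nat -(@bin_fact (n + i) n) ?leq_addr// addKn.
  by rewrite leq_pmull// bin_gt0 leq_addr.
by rewrite ler_wpM2l ?expR_ge_sum// divr_ge0// exprn_ge0.
Qed.

(** Serves both exp and cos, whose terms are dominated by those of exp at [r]. *)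
Lemma series_remainder_le u r n : cvgn (series u) ->
  (forall i, `|u i| <= r ^+ i / i`!%:R) -> 0 <= r ->
  `|limn (series u) - \sum_(i < n) u i| <= r ^+ n / n`!%:R * expR r.
Proof.
move=> cu ur r0.
have cd : (fun m => `|series u m - \sum_(i < n) u i|) @ \oo -->
    `|limn (series u) - \sum_(i < n) u i|.
  by apply: cvg_norm; apply: cvgB => //; exact: cvg_cst.
rewrite -(cvg_lim _ cd)//; apply: limr_le; first by apply/cvg_ex; eexists; exact: cd.
near=> m.
have nm : (n <= m)%N by near: m; exact: nbhs_infty_ge.
have -> : series u m - \sum_(i < n) u i = \sum_(n <= i < m) u i.
  rewrite -(big_mkord xpredT u) /series/= (@big_cat_nat _ _ _ n 0 m)//=.
  by rewrite addrAC subrr add0r.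
rewrite -{1}[n]add0n big_addn big_mkord.
apply: le_trans (exp_tail_le n (m - n) r0).
apply: le_trans (ler_norm_sum _ _ _) _.
by apply: ler_sum => i _; rewrite addnC.
Unshelve. all: by end_near. Qed.

Lemma expR_remainder_le n x :
  `|expR x - \sum_(i < n) x ^+ i / i`!%:R| <= `|x| ^+ n / n`!%:R * expR `|x|.
Proof.
have h := @series_remainder_le (exp_coeff x) `|x| n (is_cvg_series_exp_coeff x).
apply: h => // i.
by rewrite normrM normrX normfV normr_nat.
Qed.

Lemma cos_remainder_le n x :
  `|cos x - \sum_(i < n) cos_coeff x i| <= `|x| ^+ n / n`!%:R * expR `|x|.
Proof.
rewrite cos.unlock.
have h := @series_remainder_le (cos_coeff x) `|x| n (@is_cvg_series_cos_coeff R x).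
apply: h => // i.
have -> : `|cos_coeff x i| = (~~ odd i)%:R * (`|x| ^+ i / i`!%:R).
  rewrite /cos_coeff 3!normrM normr_nat normfV normr_nat !normrX normrN1 expr1n.
  by rewrite mulr1 mulrA.
by rewrite ler_piMl ?divr_ge0 ?exprn_ge0//; case: odd.
Qed.

(** Multiplied by 2^n, the left side is a single term of the series of [expR (2 * r)]. A larger
    exponential weight thus buys a geometric factor in n, uniformly in r. *)
Lemma exp_coeff_le_half n r : 0 <= r ->
  r ^+ n / n`!%:R <= 2^-1 ^+ n * expR (2 * r).
Proof.
move=> r0; have := @expR_ge_sum n.+1 (2 * r) (mulr_ge0 (ler0n _ 2) r0).
rewrite big_ord_recr/= => h.
rewrite -ler_pdivrMl ?exprn_gt0 ?invr_gt0// -exprVn invrK mulrA -exprMn.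
apply: le_trans h; rewrite lerDr sumr_ge0// => i _.
by rewrite divr_ge0 ?exprn_ge0 ?mulr_ge0.
Qed.

Lemma expR_half_le2 x : `|x| <= 2^-1 -> expR x <= 2.
Proof.
move=> x2; have h := expR_ge1Dx (- x); have p := expR_gt0 (-x).
have e : expR x * expR (- x) = 1 by rewrite -expRD subrr expR0.
by have := expR_gt0 x; move: x2; rewrite ler_norml => /andP[? ?]; nra.
Qed.

(** Stated as an equation with a bounded factor [r], so that the remainder can be carried through
    ring identities. *)
Lemma expR_taylor2 x : `|x| <= 2^-1 ->
  exists2 r : R, `|r| <= 1 & expR x = 1 + x + x ^+ 2 * r.
Proof.
move=> x2; have [->|x0] := eqVneq x 0.
  by exists 0; rewrite ?normr0// expR0; ring.
exists ((expR x - (1 + x)) / x ^+ 2); last by field.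
have := expR_remainder_le 2 x; rewrite !big_ord_recr big_ord0/= => h.
rewrite normrM normfV normrX ler_pdivrMr ?exprn_gt0 ?normr_gt0// mul1r.
rewrite (_ : _ - _ = expR x - (0 + x ^+ 0 / 0`!%:R + x ^+ 1 / 1`!%:R)); last first.
  by rewrite expr0 expr1 fact0 invr1; ring.
apply: le_trans h _; have := @expR_half_le2 `|x|; rewrite normr_id => /(_ x2) h.
rewrite -mulrA ler_piMr ?exprn_ge0//.
by rewrite (_ : 2`! = 2%N)//; lra.
Qed.

Lemma expR_taylor3 x : `|x| <= 2^-1 ->
  exists2 r : R, `|r| <= 1 & expR x = 1 + x + x ^+ 2 / 2 + x ^+ 3 * r.
Proof.
move=> x2; have [->|x0] := eqVneq x 0.
  by exists 0; rewrite ?normr0// expR0; ring.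
exists ((expR x - (1 + x + x ^+ 2 / 2)) / x ^+ 3); last by field.
have := expR_remainder_le 3 x; rewrite !big_ord_recr big_ord0/= => h.
rewrite normrM normfV normrX ler_pdivrMr ?exprn_gt0 ?normr_gt0// mul1r.
rewrite (_ : _ - _ = expR x -
  (0 + x ^+ 0 / 0`!%:R + x ^+ 1 / 1`!%:R + x ^+ 2 / 2`!%:R)); last first.
  by rewrite expr0 expr1 fact0 invr1 (_ : 2`! = 2%N)//; ring.
apply: le_trans h _; have := @expR_half_le2 `|x|; rewrite normr_id => /(_ x2) h.
rewrite -mulrA ler_piMr ?exprn_ge0//.
by rewrite (_ : 3`! = 6%N)//; lra.
Qed.

End exp_remainder.

(** * The root of a lacunary denominator *)

(* f = a + b t + O(t^2), with one constant C bounding everything. *)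
Definition jet (R : numDomainType) (C t f a b : R) :=
  [/\ `|a| <= C, `|b| <= C & `|f - (a + b * t)| <= C * t ^+ 2].

Section jets.
Variables (R : realFieldType) (t : R).
Hypothesis t1 : `|t| <= 1.
Implicit Types (C f g a b w : R).

Lemma jet_cst C a : `|a| <= C -> jet C t a a 0.
Proof.
move=> aC; have C0 := le_trans (normr_ge0 a) aC.
by split; rewrite ?normr0// mul0r addr0 subrr normr0 mulr_ge0// sqr_ge0.
Qed.

Lemma jetD C C' f g a b a' b' : jet C t f a b -> jet C' t g a' b' ->
  jet (C + C') t (f + g) (a + a') (b + b').
Proof.
move=> [aC bC fC] [aC' bC' gC].
split; [exact: le_trans (ler_normD _ _) (lerD aC aC')
       |exact: le_trans (ler_normD _ _) (lerD bC bC')|].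
rewrite (_ : _ - _ = (f - (a + b * t)) + (g - (a' + b' * t))); last by ring.
by rewrite mulrDl (le_trans (ler_normD _ _))// lerD.
Qed.

Lemma jetM C C' f g a b a' b' : jet C t f a b -> jet C' t g a' b' ->
  jet (6 * (C * C')) t (f * g) (a * a') (a * b' + b * a').
Proof.
move=> [aC bC fC] [aC' bC' gC].
have C0 := le_trans (normr_ge0 a) aC; have C0' := le_trans (normr_ge0 a') aC'.
have CC0 : 0 <= C * C' by rewrite mulr_ge0.
have hM x y : `|x| <= C -> `|y| <= C' -> `|x * y| <= C * C'.
  by move=> xC yC; rewrite normrM ler_pM.
have t0 : 0 <= t ^+ 2 by exact: sqr_ge0.
have t21 : t ^+ 2 <= 1 by rewrite -real_normK ?num_real// expr_le1.
split; first by rewrite (le_trans (hM _ _ _ _))//; lra.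
  rewrite (le_trans (ler_normD _ _))//.
  by have := hM _ _ aC bC'; have := hM _ _ bC aC'; lra.
pose ef := f - (a + b * t); pose eg := g - (a' + b' * t).
have gC3 : `|g| <= 3 * C'.
  rewrite (_ : g = eg + (a' + b' * t)); last by rewrite /eg; ring.
  have h1 : `|b' * t| <= C' by rewrite normrM -[C']mulr1 ler_pM.
  have h2 : C' * t ^+ 2 <= C' by rewrite ler_piMr.
  have := ler_normD eg (a' + b' * t); have := ler_normD a' (b' * t).
  by move: gC; rewrite -/eg; lra.
(* The four terms cost 1 + 1 + 1 + 3 = 6 times C C' t^2, the 3 coming from the bound on [g]. *)
rewrite (_ : _ - _ = b * b' * t ^+ 2 + a * eg + b * t * eg + ef * g); last first.
  by rewrite /ef /eg; ring.
have h1 : `|b * b' * t ^+ 2| <= C * C' * t ^+ 2.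
  by rewrite normrM (ger0_norm t0) ler_wpM2r// hM.
have h2 : `|a * eg| <= C * (C' * t ^+ 2) by rewrite normrM ler_pM.
have h3 : `|b * t * eg| <= C * (C' * t ^+ 2).
  by rewrite normrM ler_pM// normrM -[C]mulr1 ler_pM.
have h4 : `|ef * g| <= C * t ^+ 2 * (3 * C') by rewrite normrM ler_pM.
have := ler_normD (b * b' * t ^+ 2 + a * eg + b * t * eg) (ef * g).
have := ler_normD (b * b' * t ^+ 2 + a * eg) (b * t * eg).
have := ler_normD (b * b' * t ^+ 2) (a * eg).
by lra.
Qed.

Lemma jetMt C f a b : jet C t f a b -> jet (2 * C) t (t * f) 0 a.
Proof.
move=> [aC bC fC]; have C0 := le_trans (normr_ge0 a) aC.
split; [by rewrite normr0; lra|by lra|].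
rewrite (_ : _ - _ = t * (f - (a + b * t)) + b * t ^+ 2); last by ring.
have t0 : 0 <= t ^+ 2 by exact: sqr_ge0.
have h1 : `|t * (f - (a + b * t))| <= 1 * (C * t ^+ 2) by rewrite normrM ler_pM.
have h2 : `|b * t ^+ 2| <= C * t ^+ 2 by rewrite normrM (ger0_norm t0) ler_wpM2r.
by have := ler_normD (t * (f - (a + b * t))) (b * t ^+ 2); lra.
Qed.

Lemma jetMt2 C w : `|w| <= C -> jet C t (t ^+ 2 * w) 0 0.
Proof.
move=> wC; have C0 := le_trans (normr_ge0 w) wC.
split; rewrite ?normr0// mul0r addr0 subr0 normrM ger0_norm ?sqr_ge0//.
by rewrite mulrC ler_wpM2r ?sqr_ge0.
Qed.

Lemma jetN C f a b : jet C t f a b -> jet C t (- f) (- a) (- b).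
Proof.
move=> [aC bC fC]; split; rewrite ?normrN//.
rewrite (_ : _ - _ = - (f - (a + b * t))) ?normrN//; by ring.
Qed.

Lemma jet0_le C f a b : jet C t f a b -> a = 0 -> b = 0 -> `|f| <= C * t ^+ 2.
Proof. by move=> [_ _ h] a0 b0; move: h; rewrite a0 b0 mul0r addr0 subr0. Qed.

End jets.

Lemma le_normM (R : realDomainType) (x y a b : R) :
  `|x| <= a -> `|y| <= b -> `|x * y| <= a * b.
Proof. by move=> ? ?; rewrite normrM ler_pM. Qed.

(* The saddle-point equation 1 - rho = eps (al0 - be0 rho) q - ..., rescaled by x = 1/K:
   c, v, al0, ... below stand for K^2 c, K^2 v, K al0, ... *)
Lemma root_expansion (R : realType) : exists C : R,
  forall (x t c v be0 be1 al1 h rho q eps : R), 0 <= x <= 1 -> `|t| <= 100^-1 ->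
  0 <= c <= 2 -> `|v| <= 22 -> 0 <= be0 <= 1 -> 0 <= be1 <= 1 -> 0 <= al1 <= 1 ->
  v = c + c ^+ 2 * x ^+ 2 + 2 * be0 * c * x - 2 * c ^+ 2 * x + 2 * be0 * be1
      - 2 * (be0 + c * x) * al1 ->
  h = c + v * t / 2 -> rho = expR (- (x ^+ 2 * t * h)) ->
  q = expR (- (x * t * h)) -> eps = expR t - 1 ->
  `|1 - rho - eps * (x * (be0 + c * x) - x * be0 * rho) * q
    + eps ^+ 2 * (x ^+ 2 * (be0 + c * x) * al1 - x ^+ 2 * be0 * be1 * rho) * q ^+ 2|
    <= C * x ^+ 2 * `|t| ^+ 3.
Proof.
(* The constant stays open until the end, where the one computed by the jet calculus for [jP] fills
   it; every bound fed to that calculus must therefore be numerical. *)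
eexists => x t c v be0 be1 al1 h rho q eps /andP[x0 x1] t100 /andP[c0 c2] v22 /andP[b00 b01]
  /andP[b10 b11] /andP[a10 a11] vE hE rhoE0 qE0 epsE0.
have t1 : `|t| <= 1 by lra.
have xn : `|x| <= 1 by rewrite ger0_norm.
have cn : `|c| <= 2 by rewrite ger0_norm.
have b0n : `|be0| <= 1 by rewrite ger0_norm.
have b1n : `|be1| <= 1 by rewrite ger0_norm.
have a1n : `|al1| <= 1 by rewrite ger0_norm.
have x2n : `|x ^+ 2| <= 1 by rewrite normrX expr_le1.
have h3 : `|h| <= 3.
  rewrite hE (le_trans (ler_normD _ _))//.
  have : `|v * t / 2| <= 22 * 100^-1 / 2.
    rewrite normrM [`|2^-1|]ger0_norm ?invr_ge0//.
    by have := le_normM v22 t100; lra.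
  by lra.
have th : `|t * h| <= 100^-1 * 3 := le_normM t100 h3.
have [r1 r1n rhoE] : exists2 r : R, `|r| <= 1 &
    rho = 1 - x ^+ 2 * t * h + (x ^+ 2 * t * h) ^+ 2 / 2 + (x ^+ 2 * t * h) ^+ 3 * r.
  have [|r rn E] := @expR_taylor3 R (- (x ^+ 2 * t * h)).
    by rewrite normrN -mulrA (le_trans (le_normM x2n th))//; lra.
  by exists (- r); rewrite ?normrN// rhoE0 E; ring.
have [r2 r2n qE] : exists2 r : R, `|r| <= 1 & q = 1 - x * t * h + (x * t * h) ^+ 2 * r.
  have [|r rn E] := @expR_taylor2 R (- (x * t * h)).
    by rewrite normrN -mulrA (le_trans (le_normM xn th))//; lra.
  by exists r; rewrite // qE0 E; ring.
have [r3 r3n epsE] : exists2 r : R, `|r| <= 1 & eps = t * (1 + t * 2^-1 + t ^+ 2 * r).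
  have [|r rn E] := @expR_taylor3 R t; first by lra.
  by exists r; rewrite // epsE0 E; ring.
have jh : jet 13 t h c (v / 2).
  split; [lra| |].
    by rewrite normrM [`|2^-1|]ger0_norm ?invr_ge0//; lra.
  have -> : h - (c + v / 2 * t) = 0 by rewrite hE; ring.
  by rewrite normr0 mulr_ge0 ?sqr_ge0 ?ler0n.
pose w := (x ^+ 2) ^+ 2 * h ^+ 3 * r1.
(* [U] is (1 - rho) / (x^2 t) without the division. The whole expression equals x^2 t [F], so it
   remains to prove [F] = O(t^2); [jP] is the jet of [F], built term by term. *)
pose U := h - t * (x ^+ 2 * h ^+ 2 * 2^-1) - t ^+ 2 * w.
have hn n : `|h ^+ n| <= 3 ^+ n by rewrite normrX lerXn2r// nnegrE.
have wn : `|w| <= 1 * 3 ^+ 3 * 1.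
  apply: le_normM r1n; apply: le_normM (hn 3%N).
  by rewrite normrX expr_le1.
have rhoU : rho = 1 - x ^+ 2 * t * U by rewrite rhoE /U /w; ring.
have jx : jet 1 t x x 0 by exact: jet_cst.
have jx2 : jet 1 t (x ^+ 2) (x ^+ 2) 0 by exact: jet_cst.
have jhalf : jet 1 t (2^-1) (2^-1) 0 by apply: jet_cst; rewrite ger0_norm//; lra.
have jU := jetD (jetD jh (jetN (jetMt t1 (jetM t1 (jetM t1 jx2 (jetM t1 jh jh)) jhalf))))
  (jetN (jetMt2 t wn)).
have jE := jetD (jetD (jet_cst t (lexx `|1 : R|)) (jetMt t1 jhalf)) (jetMt2 t r3n).
have wq : `|x ^+ 2 * h ^+ 2 * r2| <= 1 * 3 ^+ 2 * 1.
  by apply: le_normM r2n; exact: le_normM x2n (hn 2%N).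
have jq := jetD (jetD (jet_cst t (lexx `|1 : R|)) (jetN (jetMt t1 (jetM t1 jx jh)))) (jetMt2 t wq).
have jb0 := jet_cst t b0n. have jb1 := jet_cst t b1n. have ja1 := jet_cst t a1n.
have jc := jet_cst t cn.
have jrho := jetD (jet_cst t (lexx `|1 : R|)) (jetN (jetMt t1 (jetM t1 jx2 jU))).
have ja0 := jetD jb0 (jetM t1 jc jx).
have jP := jetD
  (jetD jU (jetN (jetM t1 (jetM t1 jE (jetD jc (jetM t1 (jetM t1 jb0 jx) (jetMt t1 jU)))) jq)))
  (jetMt t1 (jetM t1 (jetM t1 (jetM t1 jE jE)
    (jetD (jetM t1 ja0 ja1) (jetN (jetM t1 (jetM t1 jb0 jb1) jrho)))) (jetM t1 jq jq))).
pose E := 1 + t * 2^-1 + t ^+ 2 * r3.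
pose q1 := 1 - t * (x * h) + t ^+ 2 * (x ^+ 2 * h ^+ 2 * r2).
pose F := U - E * (c + be0 * x * (t * U)) * q1 + t * (E * E *
  ((be0 + c * x) * al1 - be0 * be1 * (1 - t * (x ^+ 2 * U))) * (q1 * q1)).
have hF := jet0_le jP.
have -> : 1 - rho - eps * (x * (be0 + c * x) - x * be0 * rho) * q
    + eps ^+ 2 * (x ^+ 2 * (be0 + c * x) * al1 - x ^+ 2 * be0 * be1 * rho) * q ^+ 2
    = x ^+ 2 * (t * F).
  by rewrite rhoU qE epsE /F /E /q1; ring.
have final D : `|F| <= D * t ^+ 2 ->
    `|x ^+ 2 * (t * F)| <= D * x ^+ 2 * `|t| ^+ 3.
  move=> FD; rewrite normrM [`|t * F|]normrM (ger0_norm (sqr_ge0 x)).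
  rewrite (_ : D * _ * _ = x ^+ 2 * (`|t| * (D * `|t| ^+ 2))); last by ring.
  by rewrite ler_wpM2l ?sqr_ge0// ler_wpM2l// real_normK ?num_real.
(* The constant coefficient of the jet is c - c. The linear one vanishes by the formula for [v],
   which is exactly this equation solved for [v]. *)
apply: final; apply: hF; first by ring.
by rewrite vE; field.
Qed.

(** * Weights, partial sums and values of lacunary polynomials *)

Section lacunary_bounds.
Variable R : realFieldType.
Implicit Types (A B : nat -> R) (K M n : nat) (rho : R).

(** Reduces an l1 bound to monomials. It is applied to the tails of an evaluation and to the
    coefficients of the derivative. *)
Lemma lacunary_functional_le (L : nat -> {poly R} -> R) A B K M n :
  (forall i p q, L i (p - q) = L i p - L i q) ->
  \sum_(i < n) `|L i (lacunary A B K M)| <= \sum_(m < M.+1)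
    (\sum_(i < n) `|L i (A m *: 'X^(m * K))| +
     \sum_(i < n) `|L i (B m *: 'X^((m * K).+1))|).
Proof.
move=> LB; have L0 i : L i 0 = 0 by rewrite -(subrr 0) LB subrr.
have LD i p q : L i (p + q) = L i p + L i q.
  by rewrite -{1}[q]opprK -[- q]sub0r !LB L0 sub0r opprK.
under [leRHS]eq_bigr do rewrite -big_split.
rewrite exchange_big/= ler_sum// => i _.
rewrite /lacunary (big_morph _ (LD i) (L0 i)).
rewrite (le_trans (ler_norm_sum _ _ _))// ler_sum// => m _.
by rewrite LB (le_trans (ler_normB _ _)).
Qed.

Lemma sum_ord_ltn_le n d : (\sum_(i < n) (i.+2 <= d) <= d.-1)%N.
Proof.
suff : (\sum_(i < n) (i.+2 <= d) <= minn n d.-1)%N.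
  by move/leq_trans; apply; rewrite geq_minr.
elim: n => [|n IH]; rewrite ?big_ord0// big_ord_recr/=.
move: (\sum_(i < n) _)%N IH => S; case: (leqP n.+2 d) => h /=; lia.
Qed.

Definition lacunary_weight A B K M rho :=
  \sum_(m < M.+1) (m * K)%:R * (`|A m| * rho ^+ (m * K) + `|B m| * rho ^+ (m * K).+1).

(** A partial sum is the value at [rho] minus a tail. A monomial of degree d lies in the tail only
    for i + 2 <= d, that is at most d - 1 times, which is why degree m K + 1 also gets the weight m
    K. *)
Lemma lacunary_partial_sums_le A B K M n rho : 0 <= rho ->
  \sum_(i < n) `|\sum_(j < i.+2) (lacunary A B K M)`_j * rho ^+ j| <=
  n%:R * `|(lacunary A B K M).[rho]| + lacunary_weight A B K M rho.
Proof.
move=> rho0; set D := lacunary A B K M.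
pose L i (p : {poly R}) := p.[rho] - \sum_(j < i.+2) p`_j * rho ^+ j.
have LB i p q : L i (p - q) = L i p - L i q.
  rewrite /L hornerD hornerN; under eq_bigr do rewrite coefB mulrBl.
  by rewrite sumrB; ring.
have LX i a d : L i (a *: 'X^d) = (i.+2 <= d)%N%:R * (a * rho ^+ d).
  rewrite /L hornerZ hornerXn; under eq_bigr do rewrite coefZ coefXn -mulrA mulrCA.
  have [id|id] := leqP i.+2 d.
    rewrite big1 ?subr0 ?mul1r// => j _.
    by rewrite ltn_eqF ?mul0r// (leq_trans _ id).
  rewrite (bigD1 (Ordinal id))//= eqxx mul1r big1 ?addr0 ?subrr ?mul0r//.
  move=> j; rewrite -val_eqE/= => /negbTE ->; exact: mul0r.
have LXn a d : \sum_(i < n) `|L i (a *: 'X^d)| <= d.-1%:R * (`|a| * rho ^+ d).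
  under eq_bigr do rewrite LX normrM normrM normr_nat (ger0_norm (exprn_ge0 d rho0)).
  rewrite -mulr_suml ler_wpM2r ?mulr_ge0 ?exprn_ge0//.
  by rewrite -natr_sum ler_nat sum_ord_ltn_le.
apply: (@le_trans _ _ (\sum_(i < n) (`|D.[rho]| + `|L i D|))).
  apply: ler_sum => i _; rewrite (_ : \sum_(j < _) _ = D.[rho] - L i D).
    exact: ler_normB.
  by rewrite /L; ring.
rewrite big_split/= sumr_const card_ord -[_ *+ n]mulr_natl lerD2l.
apply: le_trans (lacunary_functional_le A B K M n LB) _.
apply: ler_sum => m _; rewrite mulrDr lerD// (le_trans (LXn _ _))//.
by rewrite ler_wpM2r ?mulr_ge0 ?exprn_ge0// ler_nat leq_pred.
Qed.

Lemma lacunary_deriv_le A B K M n rho : (0 < K)%N -> 2^-1 <= rho ->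
  \sum_(i < n) `|(- (lacunary A B K M)^`())`_i.+1 * rho ^+ i.+1| <=
  4 * lacunary_weight A B K M rho.
Proof.
move=> K0 rho2; have rho0 : 0 <= rho by lra.
pose L i (p : {poly R}) := (- p^`())`_i.+1 * rho ^+ i.+1.
have LB i p q : L i (p - q) = L i p - L i q.
  by rewrite /L derivB opprB coefB !coefN; ring.
have LXn a d : \sum_(i < n) `|L i (a *: 'X^d)| <= (if (d < 2)%N then 0 else d%:R * (`|a| * (2 * rho ^+ d))).
  have LX i : L i (a *: 'X^d) = - (i.+2 == d)%:R * (a * d%:R * rho ^+ i.+1).
    rewrite /L derivZ derivXn coefN coefZ coefMn coefXn -mulr_natr.
    case: d => [|d]/=; first by rewrite !mulr0 oppr0 !mul0r.
    by rewrite eqSS; ring.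
  case: ifPn => [d2|].
    rewrite big1// => i _; rewrite LX gtn_eqF ?oppr0 ?mul0r ?normr0//.
    by rewrite (leq_trans d2).
  case: d LX => [|[|d]]// LX _.
  have [dn|dn] := ltnP d n; last first.
    rewrite big1 => [|i _].
      by rewrite mulr_ge0// mulr_ge0// mulr_ge0// exprn_ge0.
    by rewrite LX !eqSS ltn_eqF ?oppr0 ?mul0r ?normr0// (leq_trans _ dn).
  rewrite (bigD1 (Ordinal dn))//= big1 ?addr0; last first.
    move=> j; rewrite -val_eqE/= => /negbTE jd.
    by rewrite LX !eqSS jd oppr0 mul0r normr0.
  rewrite LX eqxx mulN1r normrN !normrM normr_nat (ger0_norm (exprn_ge0 _ rho0)).
  rewrite -mulrA mulrCA ler_wpM2l// ler_wpM2l// [rho ^+ d.+2]exprS.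
  by have := exprn_ge0 d.+1 rho0; nra.
apply: le_trans (lacunary_functional_le A B K M n LB) _.
rewrite /lacunary_weight mulr_sumr; apply: ler_sum => m _.
apply: le_trans (lerD (LXn _ _) (LXn _ _)) _.
have p d : 0 <= rho ^+ d by exact: exprn_ge0.
case: m => -[|m] mM /=; first by rewrite mul0n mul0r mulr0 addr0.
have mK : (0 < m.+1 * K)%N by rewrite muln_gt0.
have -> : ((m.+1 * K).+1 < 2)%N = false by apply/negbTE; rewrite -leqNgt ltnS.
rewrite mulrDr mulrDr lerD//.
  case: ifP => _; rewrite ?mulr_ge0//.
  rewrite [leRHS]mulrCA ler_wpM2l// [leRHS]mulrCA ler_wpM2l//.
  by have := p (m.+1 * K)%N; lra.
have h : (m.+1 * K).+1%:R <= 2 * (m.+1 * K)%:R :> R.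
  by rewrite -natrM ler_nat; lia.
have := ler_wpM2r (mulr_ge0 (normr_ge0 (B m.+1)) (p (m.+1 * K).+1)) h.
by lra.
Qed.

Lemma sum_arith_geom_le M (t : R) : 0 <= t <= 4^-1 ->
  \sum_(m < M.+1) m%:R * t ^+ m <= 2 * t.
Proof.
move=> /andP[t0 t4].
(* The subtracted multiple of the next term is what lets the induction close. *)
suff : \sum_(m < M.+1) m%:R * t ^+ m <= 2 * t - 2 * (M.+1%:R * t ^+ M.+1).
  have : 0 <= M.+1%:R * t ^+ M.+1 by rewrite mulr_ge0// exprn_ge0.
  by lra.
have h m : 0 <= t ^+ m by exact: exprn_ge0.
elim: M => [|M IH]; first by rewrite big_ord1 mul0r expr1 mul1r subrr.
rewrite big_ord_recr/=; move: IH (h M.+1) (ler0n R M); rewrite ![t ^+ M.+2]exprS -[M.+2%:R]natr1 -[M.+1%:R]natr1.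
set x := t ^+ M.+1; set y := M%:R => IH x0 y0.
have : (y + 1 + 1) * (t * x) * 2 <= (y + 1) * x; last by lra.
rewrite mulrA -[_ * x * 2]mulrAC ler_wpM2r//; nra.
Qed.

Lemma sum_geom_le M (t : R) : 0 <= t <= 4^-1 -> \sum_(m < M) t ^+ m <= 2.
Proof.
move=> /andP[t0 t4].
suff : \sum_(m < M) t ^+ m <= 2 - 2 * t ^+ M by have := exprn_ge0 M t0; lra.
elim: M => [|M IH]; first by rewrite big_ord0 expr0; lra.
by rewrite big_ord_recr/= exprS; have := exprn_ge0 M t0; nra.
Qed.

(** Later x is |eps| / K, so the factor K cancels and the weight is O(|t|) uniformly in K. *)
Lemma lacunary_weight_le A B K M (x rho : R) : 0 <= rho ->
  (forall m, `|A m| <= x ^+ m) -> (forall m, `|B m| <= x ^+ m) ->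
  0 <= x * rho ^+ K <= 4^-1 ->
  lacunary_weight A B K M rho <= 2 * K%:R * (1 + rho) * (x * rho ^+ K).
Proof.
move=> rho0 Ax Bx t14; set t := x * rho ^+ K in t14 *.
have tE m : x ^+ m * rho ^+ (m * K) = t ^+ m.
  by rewrite /t exprMn -exprM mulnC.
apply: (@le_trans _ _ (\sum_(m < M.+1) (K%:R * (1 + rho)) * (m%:R * t ^+ m))).
  apply: ler_sum => m _; rewrite natrM -tE.
  have h1 : `|A m| * rho ^+ (m * K) <= x ^+ m * rho ^+ (m * K).
    by rewrite ler_wpM2r ?exprn_ge0.
  have h2 : `|B m| * rho ^+ (m * K).+1 <= x ^+ m * rho ^+ (m * K).+1.
    by rewrite ler_wpM2r ?exprn_ge0.
  rewrite [leRHS](_ : _ = m%:R * K%:R * (x ^+ m * rho ^+ (m * K) + x ^+ m * rho ^+ (m * K).+1)).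
    by rewrite ler_wpM2l ?mulr_ge0// lerD.
  by rewrite exprS; ring.
rewrite -mulr_sumr [leRHS](_ : _ = K%:R * (1 + rho) * (2 * t)); last by ring.
by rewrite ler_wpM2l ?mulr_ge0 ?addr_ge0// sum_arith_geom_le.
Qed.

Lemma lacunary_hornerE A B K M rho : (lacunary A B K M).[rho] =
  \sum_(m < M.+1) (A m - B m * rho) * (rho ^+ K) ^+ m.
Proof.
rewrite /lacunary horner_sum; apply: eq_bigr => m _.
by rewrite hornerD hornerN !hornerZ !hornerXn exprS -exprM [(K * m)%N]mulnC; ring.
Qed.

(** Three blocks suffice: the remainder is cubic in x rho^K, hence O(|t|^3 / K^3) later on, within
    the tolerated |t|^3 / K^2. *)
Lemma lacunary_horner_tail A B K M (x rho : R) : (2 <= M)%N -> 0 <= rho ->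
  (forall m, `|A m| <= x ^+ m) -> (forall m, `|B m| <= x ^+ m) ->
  0 <= x * rho ^+ K <= 4^-1 ->
  `|(lacunary A B K M).[rho] -
    \sum_(m < 3) (A m - B m * rho) * (rho ^+ K) ^+ m| <=
  2 * (1 + rho) * (x * rho ^+ K) ^+ 3.
Proof.
case: M => [|[|M]]// _ rho0 Ax Bx t14; rewrite lacunary_hornerE.
set t := x * rho ^+ K in t14 *; have /andP[t0 _] := t14.
rewrite -(big_mkord xpredT (fun m => (A m - B m * rho) * rho ^+ K ^+ m)).
rewrite (@big_cat_nat _ _ _ 3)//= big_mkord addrAC subrr add0r.
rewrite -[X in \sum_(X <= _ < _) _]add0n big_addn big_mkord (_ : _ - 3 = M)%N//.
apply: (@le_trans _ _ (\sum_(i < M) (1 + rho) * t ^+ 3 * t ^+ i)).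
  rewrite (le_trans (ler_norm_sum _ _ _))// ler_sum// => i _.
  rewrite normrM (ger0_norm (exprn_ge0 _ (exprn_ge0 _ rho0))).
  rewrite [leRHS](_ : _ = (x ^+ (i + 3) + x ^+ (i + 3) * rho) * (rho ^+ K) ^+ (i + 3)).
    rewrite ler_wpM2r ?exprn_ge0// (le_trans (ler_normB _ _))// lerD//.
    by rewrite normrM (ger0_norm rho0) ler_wpM2r.
  by rewrite /t !exprMn !exprD; ring.
rewrite -mulr_sumr [leRHS](_ : _ = (1 + rho) * t ^+ 3 * 2); last by ring.
by rewrite ler_wpM2l ?sum_geom_le// mulr_ge0 ?exprn_ge0// addr_ge0.
by rewrite !subSS subn0.
Qed.

End lacunary_bounds.

(** * Quasi-powers *)

(* [c] and [v] are chosen so that [expR (- eta)] is a root of the lacunary denominator up to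
   O(|t|^3 / K^2): see [root_expansion]. *)
Lemma quasi_power (R : realType) : exists C : R, 0 < C /\
  forall (K n : nat) (al be A B F N : nat -> R) (t eps c v eta : R),
  (0 < K)%N -> (2 <= n)%N -> A 0%N = 1 -> B 0%N = 1 ->
  (forall m, A m.+1 = - eps * al m * A m) ->
  (forall m, B m.+1 = - eps * be m * B m) ->
  (forall m, 0 <= al m <= K%:R^-1) -> (forall m, 0 <= be m <= K%:R^-1) ->
  0 <= c <= 2 * K%:R^-1 ^+ 2 -> c = al 0%N - be 0%N ->
  v = c + c ^+ 2 + 2 * be 0%N * c - 2 * K%:R * c ^+ 2 + 2 * be 0%N * be 1%N
      - 2 * al 0%N * al 1%N ->
  eps = expR t - 1 -> eta = c * t + v * t ^+ 2 / 2 ->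
  `|t| <= 100^-1 -> N 0%N = 1 ->
  (forall i, (i <= n)%N ->
    \sum_(j < i.+1) (lacunary A B K n)`_j * F (i - j)%N = N i) ->
  (2^-1 <= expR (- eta) -> \sum_(i < n) `|N i.+1 * expR (- eta) ^+ i.+1| <=
    4 * lacunary_weight A B K n (expR (- eta))) ->
  C * (`|t| + n%:R * `|t| ^+ 3 * K%:R^-1 ^+ 2) <= 1 ->
  `|F n * expR (- eta) ^+ n - 1| <= C * (`|t| + n%:R * `|t| ^+ 3 * K%:R^-1 ^+ 2).
Proof.
have [C1 hC1] := root_expansion R.
(* Below, th = (|C1| + 408) w and th' = 96 w, which add up to (|C1| + 504) w; the factor 2 comes
   from 1 - th >= 1/2. *)
exists (2 * (`|C1| + 504)); split; first by have := normr_ge0 C1; lra.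
move=> K n al be A B F N t eps c v eta K0 n2 A0 B0 AS BS al01 be01 c02 cE vE
  epsE etaE t100 N0 DFN Nle Cw.
set x : R := K%:R^-1 in al01 be01 c02 Cw *.
have K1 : (1 : R) <= K%:R by rewrite ler1n.
have Kn0 : K%:R != 0 :> R by rewrite pnatr_eq0 -lt0n.
have Kx : K%:R * x = 1 by rewrite /x divff.
have x0 : 0 <= x by rewrite /x invr_ge0.
have x1 : x <= 1 by rewrite /x invf_le1 ?(lt_le_trans _ K1).
pose c' := c * K%:R ^+ 2; pose v' := v * K%:R ^+ 2.
pose b0 := be 0%N * K%:R; pose b1 := be 1%N * K%:R; pose a1 := al 1%N * K%:R.
have scale (y : R) : 0 <= y <= x -> 0 <= y * K%:R <= 1.
  by move=> /andP[y0 yx]; rewrite mulr_ge0//= -[leRHS]Kx mulrC ler_wpM2l.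
have b0E : be 0%N = x * b0 by rewrite /b0 /x; field.
have b1E : be 1%N = x * b1 by rewrite /b1 /x; field.
have a1E : al 1%N = x * a1 by rewrite /a1 /x; field.
have c'E : c = x ^+ 2 * c' by rewrite /c' /x; field.
have a0E : al 0%N = x * (b0 + c' * x).
  by rewrite -[al 0%N](subrK (be 0%N)) -cE b0E c'E; ring.
have v'E : v = x ^+ 2 * v' by rewrite /v' /x; field.
have a0K : al 0%N * K%:R = b0 + c' * x by rewrite a0E mulrAC [x * _]mulrC Kx mul1r.
have c'02 : 0 <= c' <= 2.
  case/andP: c02 => c0 c2; rewrite /c' mulr_ge0 ?exprn_ge0//=.
  rewrite (_ : 2 = (2 * x ^+ 2) * K%:R ^+ 2); last by rewrite /x; field.
  by rewrite ler_wpM2r ?exprn_ge0.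
have v'2 : v' = c' + c' ^+ 2 * x ^+ 2 + 2 * b0 * c' * x - 2 * c' ^+ 2 * x + 2 * b0 * b1
    - 2 * (b0 + c' * x) * a1.
  by rewrite -a0K /v' vE /c' /b0 /b1 /a1 /x; field.
have b001 := scale _ (be01 0%N); have b101 := scale _ (be01 1%N).
have a101 := scale _ (al01 1%N); have a001 := scale _ (al01 0%N).
rewrite -/b0 in b001; rewrite -/b1 in b101; rewrite -/a1 in a101.
rewrite a0K in a001.
have prod01 (y z p q : R) : 0 <= y <= p -> 0 <= z <= q -> 0 <= y * z <= p * q.
  by move=> /andP[? ?] /andP[? ?]; rewrite mulr_ge0//= ler_pM.
have x01 : 0 <= x <= 1 by rewrite x0 x1.
have v'22 : `|v'| <= 22.
  have h1 := prod01 _ _ _ _ (prod01 _ _ _ _ c'02 c'02) (prod01 _ _ _ _ x01 x01).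
  have h2 := prod01 _ _ _ _ (prod01 _ _ _ _ b001 c'02) x01.
  have h3 := prod01 _ _ _ _ (prod01 _ _ _ _ c'02 c'02) x01.
  have h4 := prod01 _ _ _ _ b001 b101.
  have h5 := prod01 _ _ _ _ a001 a101.
  by rewrite v'2 ler_norml; clear -h1 h2 h3 h4 h5 c'02; lra.
pose h := c' + v' * t / 2.
have h3 : `|h| <= 3.
  have := le_normM v'22 t100; move: c'02.
  by rewrite /h -mulrA !ler_norml; clear; lra.
have th : `|t * h| <= 100^-1 * 3 := le_normM t100 h3.
have xn : `|x| <= 1 by rewrite ger0_norm.
have x2n : `|x ^+ 2| <= 1 by rewrite normrX expr_le1.
have etaE' : eta = x ^+ 2 * t * h by rewrite etaE c'E v'E /h; field.
set rho := expR (- eta) in Nle *.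
have eta2 : `|eta| <= 2^-1.
  by rewrite etaE' -mulrA; have := le_normM x2n th; clear; lra.
have rho2 : rho <= 2 by rewrite expR_half_le2// normrN.
have rho0 : 0 <= rho by exact: expR_ge0.
have /Nle {}Nle : 2^-1 <= rho.
  have e : rho * expR eta = 1 by rewrite -expRD addNr expR0.
  by move: rho0 e; have := expR_half_le2 eta2; clear; nra.
pose q := rho ^+ K.
have qE : q = expR (- (x * t * h)).
  rewrite /q /rho -expRM_natr etaE'; congr expR.
  rewrite mulNr; congr (- _); transitivity ((K%:R * x) * (x * t * h)); first by ring.
  by rewrite Kx mul1r.
have q0 : 0 <= q by rewrite qE expR_ge0.
have q2 : q <= 2.
  rewrite qE expR_half_le2// normrN -mulrA.
  by have := le_normM xn th; clear; lra.
have eps2 : `|eps| <= 2 * `|t|.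
  have [|r r1 rE] := @expR_taylor2 R t; first by clear -t100; lra.
  rewrite epsE rE (_ : _ - 1 = t * (1 + t * r)); last by ring.
  rewrite normrM mulrC ler_wpM2r//.
  have := le_normM t100 r1.
  have := ler_normD 1 (t * r); rewrite normr1; clear; lra.
have coef_le (a : nat -> R) (G : nat -> R) : (forall m, 0 <= a m <= x) ->
    (forall m, G m.+1 = - eps * a m * G m) -> G 0%N = 1 ->
    forall m, `|G m| <= (`|eps| * x) ^+ m.
  move=> a01 GS G0; elim=> [|m IH]; first by rewrite G0 normr1.
  rewrite GS exprS normrM normrM normrN.
  have /andP[am0 amx] := a01 m.
  by rewrite ler_pM ?mulr_ge0// ler_pM// ger0_norm.
have Ale := coef_le _ _ al01 AS A0; have Ble := coef_le _ _ be01 BS B0.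
have tn0 := normr_ge0 t.
have ee : 0 <= `|eps| * q <= 4 * `|t|.
  rewrite mulr_ge0//=.
  by have := ler_pM (normr_ge0 eps) q0 eps2 q2; clear; lra.
have epsq : 0 <= `|eps| * x * rho ^+ K <= 4^-1.
  have /andP[e0 e4] := ee; rewrite -/q mulrAC mulr_ge0//=.
  have : `|eps| * q * x <= `|eps| * q by rewrite ler_piMr.
  by move: t100 e4; clear; lra.
(* With 1 + rho <= 3 and |eps| q <= 4 |t|, the weight costs 2 * 3 * 4 = 24 and the horner tail below
   2 * 3 * 4^3 = 384. *)
have W24 : lacunary_weight A B K n rho <= 24 * `|t|.
  have hw := lacunary_weight_le n rho0 Ale Ble epsq; apply: (le_trans hw).
  rewrite -/q (_ : _ * _ = 2 * (1 + rho) * (`|eps| * q)); last first.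
    transitivity ((K%:R * x) * (2 * (1 + rho) * (`|eps| * q))); first by ring.
    by rewrite Kx mul1r.
  have /andP[e0 e4] := ee.
  have : (1 + rho) * (`|eps| * q) <= 3 * (4 * `|t|) by rewrite ler_pM ?addr_ge0//; clear -rho2; lra.
  by clear; lra.
have tail := lacunary_horner_tail n2 rho0 Ale Ble epsq.
have t3 : 0 <= x ^+ 2 * `|t| ^+ 3 by rewrite mulr_ge0// exprn_ge0.
have Drho : `|(lacunary A B K n).[rho]| <= (`|C1| + 384) * (x ^+ 2 * `|t| ^+ 3).
  set P := \sum_(m < 3) _ in tail.
  have hP : `|P| <= `|C1| * (x ^+ 2 * `|t| ^+ 3).
    have := hC1 x t c' v' b0 b1 a1 h rho q eps x01 t100 c'02 v'22 b001 b101 a101 v'2 erefl.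
    rewrite -etaE' => /(_ erefl qE epsE) hh.
    rewrite (_ : P = 1 - rho - eps * (x * (b0 + c' * x) - x * b0 * rho) * q +
      eps ^+ 2 * (x ^+ 2 * (b0 + c' * x) * a1 - x ^+ 2 * b0 * b1 * rho) * q ^+ 2).
      apply: (le_trans hh); rewrite -mulrA.
      by have := ler_wpM2r t3 (ler_norm C1); apply.
    rewrite /P !big_ord_recr big_ord0/= !AS !BS A0 B0 a0E a1E b0E b1E -/q.
    by ring.
  have ht : 2 * (1 + rho) * (`|eps| * x * rho ^+ K) ^+ 3 <= 384 * (x ^+ 2 * `|t| ^+ 3).
    have -> : (`|eps| * x * rho ^+ K) ^+ 3 = x ^+ 3 * (`|eps| * q) ^+ 3.
      by rewrite -/q; ring.
    have /andP[e0 e4] := ee.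
    have h1 : (`|eps| * q) ^+ 3 <= (4 * `|t|) ^+ 3 by rewrite lerXn2r// nnegrE mulr_ge0.
    have h2 : x ^+ 3 <= x ^+ 2 by rewrite exprS ler_piMl// exprn_ge0.
    have h4 : x ^+ 3 * (`|eps| * q) ^+ 3 <= x ^+ 2 * (4 * `|t|) ^+ 3.
      by rewrite ler_pM// ?exprn_ge0.
    rewrite exprMn in h4.
    have h5 : (1 + rho) * (x ^+ 3 * (`|eps| * q) ^+ 3) <= 3 * (x ^+ 2 * (4 ^+ 3 * `|t| ^+ 3)).
      by rewrite ler_pM ?mulr_ge0 ?exprn_ge0//; clear -rho2 rho0 e0 e4 h4; lra.
    by clear -h5; lra.
  set D := _.[rho] in tail *.
  have := ler_normD (D - P) P; rewrite subrK; clear -tail hP ht; lra.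
set w := `|t| + n%:R * `|t| ^+ 3 * x ^+ 2 in Cw *.
set w2 := n%:R * `|t| ^+ 3 * x ^+ 2 in w Cw *.
have w20 : 0 <= w2 by rewrite /w2 mulr_ge0 ?exprn_ge0// mulr_ge0 ?exprn_ge0.
have C10 := normr_ge0 C1.
have th_le : \sum_(i < n) `|\sum_(j < i.+2) (lacunary A B K n)`_j * rho ^+ j| <=
    (`|C1| + 408) * w.
  apply: le_trans (lacunary_partial_sums_le A B K n n rho0) _.
  have := ler_wpM2l (ler0n R n) Drho.
  rewrite (_ : n%:R * (_ * _) = (`|C1| + 384) * w2); last by rewrite /w2; ring.
  rewrite /w; move: W24 tn0 C10 w20; clear; nra.
have th'_le : \sum_(i < n) `|N i.+1 * rho ^+ i.+1| <= 96 * w.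
  by apply: le_trans Nle _; rewrite /w; move: W24 w20; clear; lra.
have w0 : 0 <= w by rewrite /w addr_ge0.
have th1 : (`|C1| + 408) * w <= 2^-1 by clear -Cw w0 C10; nra.
have := renewal_estimate rho0 _ _ N0 DFN th_le th'_le.
move=> /(_ _ _)/le_trans; apply.
- by clear -th1; lra.
- by rewrite coef0_lacunary.
- rewrite ler_pdivrMr; last by clear -th1; lra.
  have d0 : 0 <= 2^-1 - (`|C1| + 408) * w by clear -th1; lra.
  have := mulr_ge0 (addr_ge0 C10 (ler0n R 504)) (mulr_ge0 w0 d0).
  by clear; lra.
Qed.

Ltac nonzero := repeat (apply/andP; split); apply: lt0r_neq0; nra.

(** * Means, variances and quasi-powers of the two tree models *)

Section constants.
Variable R : realType.
Implicit Types k : nat.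

(* Per-node limits of the mean and the variance of the counts. *)
Definition rrt_mean k : R := (k%:R * (k%:R + 1))^-1.
Definition rrt_variance k : R :=
  (2 * k%:R ^+ 2 - 1) / (k%:R * (k%:R + 1) ^+ 2 * (2 * k%:R + 1)).
Definition bst_mean k : R := 2 / ((k%:R + 1) * (k%:R + 2)).
Definition bst_variance k : R := 2 * k%:R * (4 * k%:R ^+ 2 + 5 * k%:R - 3) /
  ((k%:R + 1) * (k%:R + 2) ^+ 2 * (2 * k%:R + 1) * (2 * k%:R + 3)).

(** The variance per node has order 1 / k^2. Recursive trees would allow 12; the common constant 40
    is chosen to exceed the 270 / 8 needed for search trees. *)
Lemma rrt_variance_ge k : (0 < k)%N -> (40 * k%:R ^+ 2)^-1 <= rrt_variance k.
Proof.
rewrite /rrt_variance -(ler1n R); set x : R := k%:R => x1.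
have hD : 0 < x * (x + 1) ^+ 2 * (2 * x + 1) by rewrite !mulr_gt0 ?exprn_gt0//; lra.
have D0 : 0 < 40 * x ^+ 2 by rewrite mulr_gt0 ?exprn_gt0//; lra.
rewrite ler_pdivlMr// ler_pdivrMl//.
have h1 : (x + 1) ^+ 2 <= 4 * x ^+ 2 by nra.
have h2 : x * (2 * x + 1) <= 3 * x ^+ 2 by nra.
have h : x * (x + 1) ^+ 2 * (2 * x + 1) <= (4 * x ^+ 2) * (3 * x ^+ 2).
  rewrite (_ : _ * _ = (x + 1) ^+ 2 * (x * (2 * x + 1))); last by ring.
  by rewrite ler_pM ?mulr_ge0 ?exprn_ge0//; lra.
have x2 : 1 <= x ^+ 2 by rewrite expr_ge1//; lra.
nra.
Qed.

Lemma bst_variance_ge k : (0 < k)%N -> (40 * k%:R ^+ 2)^-1 <= bst_variance k.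
Proof.
rewrite /bst_variance -(ler1n R); set x : R := k%:R => x1.
have hD : 0 < (x + 1) * (x + 2) ^+ 2 * (2 * x + 1) * (2 * x + 3).
  by rewrite !mulr_gt0 ?exprn_gt0//; lra.
have D0 : 0 < 40 * x ^+ 2 by rewrite mulr_gt0 ?exprn_gt0//; lra.
rewrite ler_pdivlMr// ler_pdivrMl//.
have h1 : (x + 2) ^+ 2 <= 9 * x ^+ 2 by nra.
have h2 : (2 * x + 1) * (2 * x + 3) <= 15 * x ^+ 2 by nra.
have h3 : (x + 1) * ((x + 2) ^+ 2 * ((2 * x + 1) * (2 * x + 3))) <=
    (2 * x) * ((9 * x ^+ 2) * (15 * x ^+ 2)).
  rewrite ler_pM ?mulr_ge0 ?exprn_ge0//; try lra.
  by rewrite ler_pM ?mulr_ge0 ?exprn_ge0//; lra.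
have h4 : (2 * x) * ((9 * x ^+ 2) * (15 * x ^+ 2)) <= 40 * x ^+ 2 * (2 * x * (4 * x ^+ 2)).
  rewrite (_ : _ * _ = 270 * x ^+ 5); last by ring.
  rewrite (_ : 40 * _ * _ = 320 * x ^+ 5); last by ring.
  by rewrite ler_wpM2r ?exprn_ge0//; lra.
rewrite (_ : _ * _ = (x + 1) * ((x + 2) ^+ 2 * ((2 * x + 1) * (2 * x + 3)))); last by ring.
apply: (le_trans h3); apply: (le_trans h4).
by rewrite ler_wpM2l ?mulr_ge0 ?exprn_ge0//; nra.
Qed.

Definition quasi_power_error (n k : nat) (t : R) : R :=
  `|t| + n%:R * `|t| ^+ 3 * k%:R^-1 ^+ 2.

Lemma quasi_power_error_ge0 n k t : 0 <= quasi_power_error n k t.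
Proof. by rewrite /quasi_power_error addr_ge0 ?mulr_ge0 ?exprn_ge0 ?invr_ge0. Qed.

Let cancel_step (p e x d a : R) : d != 0 -> a = x / d ->
  p * (- e * a) * d = - (x * e) * p.
Proof. by move=> d0 ->; field. Qed.

(** Here K = k and the numerator is the constant 1, so that its l1 sum over positive indices
    vanishes. *)
Lemma rrt_quasi_power : exists C : R, 0 < C /\ forall k n (F : nat -> R) t,
  (0 < k)%N -> (2 <= n)%N -> F 0%N = 1 ->
  (forall m, F m.+1 * m.+1%:R = \sum_(j < m.+1) F j * F (m - j)%N +
     (expR t - 1) * (if (m.+1 < k)%N then 0 else F (m.+1 - k)%N)) ->
  `|t| <= 100^-1 -> C * quasi_power_error n k t <= 1 ->
  `|F n * expR (- (rrt_mean k * t + rrt_variance k * t ^+ 2 / 2)) ^+ n - 1| <=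
    C * quasi_power_error n k t.
Proof.
have [C [C0 hC]] := quasi_power R; exists C; split=> // k n F t k0 n2 F0 FS t100 Cw.
pose al m : R := (m.+1 * k)%:R^-1; pose be m : R := (m.+1 * k).+1%:R^-1.
pose A m := \prod_(i < m) (- (expR t - 1) * al i).
pose B m := \prod_(i < m) (- (expR t - 1) * be i).
have k1 : (1 : R) <= k%:R by rewrite ler1n.
have kn0 : (k%:R : R) != 0 by rewrite pnatr_eq0 -lt0n.
have D0 m : ((m.+1 * k)%:R : R) != 0 by rewrite pnatr_eq0 -lt0n muln_gt0.
have inv_le m : (k <= m)%N -> 0 <= (m%:R : R)^-1 <= k%:R^-1.
  by move=> km; rewrite invr_ge0 ler0n lef_pV2 ?posrE ?ltr0n ?ler_nat// (leq_trans k0).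
have alE m : al m = ((m%:R + 1) * k%:R)^-1 by rewrite /al natrM -natr1.
have beE m : be m = ((m%:R + 1) * k%:R + 1)^-1 by rewrite /be -natr1 natrM -natr1.
apply: (hC k n al be A B F (fun i => (i == 0%N)%:R) t _ (rrt_mean k) (rrt_variance k)) => //.
- by rewrite /A big_ord0.
- by rewrite /B big_ord0.
- by move=> m; rewrite /A big_ord_recr/= mulrC.
- by move=> m; rewrite /B big_ord_recr/= mulrC.
- by move=> m; apply: inv_le; rewrite leq_pmull.
- by move=> m; apply: inv_le; rewrite leqW// leq_pmull.
- rewrite /rrt_mean invr_ge0 mulr_ge0 ?addr_ge0//= invfM.
  rewrite expr2 mulrCA ler_wpM2l ?invr_ge0//.
  have : ((k%:R + 1)^-1 : R) <= k%:R^-1 by rewrite lef_pV2 ?posrE//; lra.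
  have : 0 <= (k%:R^-1 : R) by rewrite invr_ge0.
  by lra.
- rewrite alE beE /rrt_mean; field; nonzero.
- rewrite !alE !beE /rrt_mean /rrt_variance; field; nonzero.
- move=> i le_in; apply: (rrt_denominator (e := expR t - 1)) => //.
  + by rewrite /A big_ord0.
  + by rewrite /B big_ord0.
  + by move=> m; rewrite /A big_ord_recr/= (@cancel_step _ _ 1) ?div1r// mul1r.
  + by move=> m; rewrite /B big_ord_recr/= (@cancel_step _ _ 1) ?div1r ?mul1r// pnatr_eq0.
- rewrite big1 => [|i _]; last by rewrite mul0r normr0.
  rewrite mulr_ge0// /lacunary_weight sumr_ge0// => m _.

Qed.

(** Here K = k + 1 and the numerator is - D'. The factor k of k (e^t - 1) is absorbed into [al] and
    [be]: one factor of their denominators is at least k and cancels it, the other is at least K.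
    The error in 1 / (k + 1) is then weakened to 1 / k. *)
Lemma bst_quasi_power : exists C : R, 0 < C /\ forall k n (F : nat -> R) t,
  (0 < k)%N -> (2 <= n)%N -> F 0%N = 1 ->
  (forall m, F m.+1 * m.+1%:R = \sum_(j < m.+1) F j * F (m - j)%N +
     k%:R * (expR t - 1) * (m.+1 == k)%:R) ->
  `|t| <= 100^-1 -> C * quasi_power_error n k t <= 1 ->
  `|F n * expR (- (bst_mean k * t + bst_variance k * t ^+ 2 / 2)) ^+ n - 1| <=
    C * quasi_power_error n k t.
Proof.
have [C [C0 hC]] := quasi_power R; exists C; split=> // k n F t k0 n2 F0 FS t100 Cw.
pose al m : R := k%:R / ((m.+1 * k.+1)%:R * (m.+1 * k.+1).-1%:R).
pose be m : R := k%:R / ((m.+1 * k.+1).+1%:R * (m.+1 * k.+1)%:R).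
pose A m := \prod_(i < m) (- (expR t - 1) * al i).
pose B m := \prod_(i < m) (- (expR t - 1) * be i).
have AS m : A m.+1 = A m * (- (expR t - 1) * al m) by rewrite /A big_ord_recr.
have BS m : B m.+1 = B m * (- (expR t - 1) * be m) by rewrite /B big_ord_recr.
have k1 : (1 : R) <= k%:R by rewrite ler1n.
have kn0 : (k%:R : R) != 0 by rewrite pnatr_eq0 -lt0n.
have mkE m : (m.+1 * k.+1).-1 = (m * k.+1 + k)%N by rewrite mulSn addSn addnC.
have D0 m : ((m.+1 * k.+1)%:R : R) != 0 by rewrite pnatr_eq0.
have D1 m : ((m.+1 * k.+1).-1%:R : R) != 0.
  by rewrite mkE pnatr_eq0 -lt0n addn_gt0 k0 orbT.
have Kk : (k.+1%:R^-1 : R) <= k%:R^-1 by rewrite lef_pV2 ?posrE ?ltr0n// ler_nat.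
have wle : `|t| + n%:R * `|t| ^+ 3 * k.+1%:R^-1 ^+ 2 <= quasi_power_error n k t.
  rewrite lerD2l ler_wpM2l ?mulr_ge0 ?exprn_ge0//.
  by rewrite lerXn2r// nnegrE invr_ge0.
have quot_le a b : (k.+1 <= a)%N -> (k <= b)%N -> 0 <= (k%:R / (a%:R * b%:R) : R) <= k.+1%:R^-1.
  move=> ka kb; have b0 := leq_trans k0 kb; have a0 : (0 < a)%N by exact: leq_trans ka.
  rewrite divr_ge0 ?mulr_ge0//= invfM mulrCA -[leRHS]mulr1.
  rewrite ler_pM ?invr_ge0 ?divr_ge0//.
    by rewrite lef_pV2 ?posrE ?ltr0n// ler_nat.
  by rewrite ler_pdivrMr ?ltr0n// mul1r ler_nat.
have alE m : al m = k%:R / (((m%:R + 1) * (k%:R + 1)) * ((m%:R + 1) * (k%:R + 1) - 1)).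
  by rewrite /al mkE natrD !natrM -!natr1; congr (_ / (_ * _)); ring.
have beE m : be m = k%:R / (((m%:R + 1) * (k%:R + 1) + 1) * ((m%:R + 1) * (k%:R + 1))).
  by rewrite /be -natr1 !natrM -!natr1.
apply: le_trans (hC k.+1 n al be A B F (fun i => (- (lacunary A B k.+1 n)^`())`_i)
  t (expR t - 1) (bst_mean k) (bst_variance k) _ _ _ _ _ _ _ _ _ _ _ _ _ _ _ _ _ _ _) _ => //.
- by rewrite /A big_ord0.
- by rewrite /B big_ord0.
- by move=> m; rewrite AS mulrC.
- by move=> m; rewrite BS mulrC.
- by move=> m; apply: quot_le; rewrite ?leq_pmull// mkE leq_addl.
- move=> m; apply: quot_le; first by rewrite leqW// leq_pmull.
  by rewrite ltnW// leq_pmull.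
- rewrite /bst_mean divr_ge0 ?mulr_ge0 ?addr_ge0//= ler_wpM2l//.
  rewrite -natr1 expr2 -invfM lef_pV2 ?posrE; nra.
- rewrite alE beE /bst_mean; field; nonzero.
- rewrite !alE !beE -natr1 /bst_mean /bst_variance; field; nonzero.
- by rewrite coefN coef_deriv coef1_lacunary// ?opprK// /B big_ord0.
- move=> i le_in; rewrite coefN; apply: (bst_denominator (w := k%:R * (expR t - 1))) => //.
  + by rewrite /A big_ord0.
  + by rewrite /B big_ord0.
  + by move=> m; rewrite AS (@cancel_step _ _ k%:R)// mulf_neq0.
  + by move=> m; rewrite BS (@cancel_step _ _ k%:R)// mulf_neq0// pnatr_eq0.
- by move=> rho2; exact: lacunary_deriv_le.
- by apply: le_trans Cw; rewrite ler_wpM2l// ltW.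
- by rewrite ler_wpM2l// ltW.
Qed.

End constants.

(** * Curtiss' theorem *)

Section exponential_growth.
Variable R : realType.
Local Notation TR := (measurableTypeR R).
Implicit Types (f g : R -> R) (mu : probability TR R).

(** Closed under sums and products and integrable for every law with all exponential moments, so
    that integrability follows from the shape of a function. *)
Definition exp_growth f := measurable_fun [set: TR] (f : TR -> R) /\
  exists C c : R, forall x, `|f x| <= C * expR (c * `|x|).

Definition exp_integrable mu :=
  forall s : R, mu.-integrable setT (fun x : TR => (expR (s * x))%:E).

Lemma expR_norm_le (c x : R) : expR (c * `|x|) <= expR (c * x) + expR (- c * x).
Proof.
case: (lerP 0 x) => x0; first by rewrite ger0_norm// lerDl expR_ge0.
by rewrite ltr0_norm// mulrN mulNr lerDr expR_ge0.
Qed.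

Lemma exp_growth_integrable mu f : exp_integrable mu -> exp_growth f ->
  mu.-integrable setT (EFin \o (f : TR -> R)).
Proof.
move=> muexp [mf [C [c fC]]].
have intg : mu.-integrable setT
    (fun x : TR => (`|C| * (expR (c * x) + expR (- c * x)))%:E).
  under eq_fun do rewrite EFinM EFinD.
  by apply: integrableZl => //; apply: integrableD => //; exact: muexp.
apply: le_integrable intg => //; first exact/measurable_EFinP.
move=> x _ /=; rewrite lee_fin [leRHS]ger0_norm ?mulr_ge0 ?addr_ge0 ?expR_ge0//.
apply: (le_trans (fC x)); apply: (@le_trans _ _ (`|C| * expR (c * `|x|))).
  by rewrite ler_wpM2r ?expR_ge0// ler_norm.
by rewrite ler_wpM2l// expR_norm_le.
Qed.

Lemma exp_growth_bounded f (C : R) : measurable_fun [set: TR] (f : TR -> R) ->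
  (forall x, `|f x| <= C) -> exp_growth f.
Proof.
by move=> mf fC; split => //; exists C, 0 => x; rewrite mul0r expR0 mulr1.
Qed.

Lemma exp_growth_cst (a : R) : exp_growth (fun=> a).
Proof. by apply: (@exp_growth_bounded _ `|a|). Qed.

Lemma exp_growthD f g : exp_growth f -> exp_growth g ->
  exp_growth (fun x => f x + g x).
Proof.
move=> [mf [C [c fC]]] [mg [D [d gD]]]; split; first exact: measurable_funD.
exists (`|C| + `|D|), (`|c| + `|d|) => x; rewrite mulrDl.
apply: le_trans (ler_normD _ _) _.
have step (a b e : R) : a * expR (b * `|x|) <= `|a| * expR ((`|b| + `|e|) * `|x|).
  apply: (@le_trans _ _ (`|a| * expR (b * `|x|))).
    by rewrite ler_wpM2r ?expR_ge0// ler_norm.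
  rewrite ler_wpM2l// ler_expR ler_wpM2r//.
  by rewrite (le_trans (ler_norm _))// lerDl.
apply: lerD; [exact: le_trans (fC x) (step _ _ _)|].
by rewrite [X in expR (X * _)]addrC; exact: le_trans (gD x) (step _ _ _).
Qed.

Lemma exp_growthM f g : exp_growth f -> exp_growth g ->
  exp_growth (fun x => f x * g x).
Proof.
move=> [mf [C [c fC]]] [mg [D [d gD]]]; split; first exact: measurable_funM.
exists (C * D), (c + d) => x.
by rewrite mulrDl expRD mulrACA normrM ler_pM.
Qed.

Lemma exp_growthZ (a : R) f : exp_growth f -> exp_growth (fun x => a * f x).
Proof. by move=> hf; apply: exp_growthM => //; exact: exp_growth_cst. Qed.

Lemma exp_growthB f g : exp_growth f -> exp_growth g ->
  exp_growth (fun x => f x - g x).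
Proof.
move=> hf hg; have := exp_growthD hf (exp_growthZ (-1) hg).
by under eq_fun do rewrite mulN1r.
Qed.

Lemma norm_le_expR (x : R) : `|x| <= expR `|x|.
Proof. by have := expR_ge1Dx `|x|; lra. Qed.

Lemma exp_growth_id : exp_growth id.
Proof.
split; first exact: measurable_id.
by exists 1, 1 => x; rewrite !mul1r norm_le_expR.
Qed.

Lemma exp_growth_expR (s : R) : exp_growth (fun x => expR (s * x)).
Proof.
split; first by apply: measurableT_comp => //; exact: measurable_funM.
exists 1, `|s| => x; rewrite mul1r ger0_norm ?expR_ge0// ler_expR -normrM.
exact: ler_norm.
Qed.

Lemma exp_growth_exp_norm (c : R) : exp_growth (fun x => expR (c * `|x|)).
Proof.
split; last by exists 1, c => x; rewrite mul1r ger0_norm ?expR_ge0.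
apply: measurableT_comp => //; exact: measurable_funM.
Qed.

Lemma exp_growthX f n : exp_growth f -> exp_growth (fun x => f x ^+ n).
Proof.
move=> hf; elim: n => [|n IH]; first exact: exp_growth_cst.
by under eq_fun do rewrite exprS; exact: exp_growthM.
Qed.

Lemma exp_growth_cos f : measurable_fun [set: TR] (f : TR -> R) ->
  exp_growth (fun x => cos (f x)).
Proof.
move=> mf; apply: (@exp_growth_bounded _ 1) => [|x]; last exact: cos_max.
apply: measurableT_comp mf; apply: continuous_measurable_fun.
exact: continuous_cos.
Qed.

End exponential_growth.

Section expectation_limits.
Variable R : realType.
Local Notation TR := (measurableTypeR R).
Implicit Types (f g : R -> R).

Definition Ex (mu : probability TR R) f : R := \int[mu]_x (f : TR -> R) x.

Section fixed_measure.
Variable mu : probability TR R.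
Hypothesis muexp : exp_integrable mu.

Lemma ExD f g : exp_growth f -> exp_growth g ->
  Ex mu (fun x => f x + g x) = Ex mu f + Ex mu g.
Proof. by move=> hf hg; apply: RintegralD => //; exact: exp_growth_integrable. Qed.

Lemma ExB f g : exp_growth f -> exp_growth g ->
  Ex mu (fun x => f x - g x) = Ex mu f - Ex mu g.
Proof. by move=> hf hg; apply: RintegralB => //; exact: exp_growth_integrable. Qed.

Lemma ExZ (a : R) f : exp_growth f -> Ex mu (fun x => a * f x) = a * Ex mu f.
Proof. by move=> hf; apply: RintegralZl => //; exact: exp_growth_integrable. Qed.

Lemma Ex_cst (a : R) : Ex mu (fun=> a) = a.
Proof.
rewrite /Ex Rintegral_cst//.
by rewrite -[RHS]mulr1; congr (_ * _); exact: (congr1 fine (probability_setT mu)).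
Qed.

Lemma Ex_le f g : exp_growth f -> exp_growth g -> (forall x, f x <= g x) ->
  Ex mu f <= Ex mu g.
Proof. by move=> hf hg fg; apply: le_Rintegral => //; exact: exp_growth_integrable. Qed.

Lemma Ex_dist_le f g h : exp_growth f -> exp_growth g -> exp_growth h ->
  (forall x, `|f x - g x| <= h x) -> `|Ex mu f - Ex mu g| <= Ex mu h.
Proof.
move=> hf hg hh fgh; rewrite ler_norml -ExB//; apply/andP; split.
  rewrite -mulN1r -ExZ//; apply: Ex_le; [exact: exp_growthZ|exact: exp_growthB|].
  by move=> x; rewrite mulN1r; have := fgh x; rewrite ler_norml => /andP[].
apply: Ex_le => //; first exact: exp_growthB.
by move=> x; have := fgh x; rewrite ler_norml => /andP[].
Qed.

Lemma Ex_indic (A : set TR) : measurable A -> Ex mu (\1_A) = fine (mu A).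
Proof. by move=> mA; rewrite /Ex /Rintegral integral_indic// setIT. Qed.

End fixed_measure.

Variables (mu_ : nat -> probability TR R) (mu : probability TR R).
Hypothesis muexp_ : forall n, exp_integrable (mu_ n).
Hypothesis muexp : exp_integrable mu.

Definition Ex_cvg f := exp_growth f /\ Ex (mu_ n) f @[n --> \oo] --> Ex mu f.

Lemma Ex_cvg_cst (a : R) : Ex_cvg (fun=> a).
Proof.
split; first exact: exp_growth_cst.
by rewrite Ex_cst; under eq_fun do rewrite Ex_cst; exact: cvg_cst.
Qed.

Lemma Ex_cvgD f g : Ex_cvg f -> Ex_cvg g -> Ex_cvg (fun x => f x + g x).
Proof.
move=> [hf cf] [hg cg]; split; first exact: exp_growthD.
by rewrite ExD//; under eq_fun do rewrite ExD//; exact: cvgD.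
Qed.

Lemma Ex_cvgZ (a : R) f : Ex_cvg f -> Ex_cvg (fun x => a * f x).
Proof.
move=> [hf cf]; split; first exact: exp_growthZ.
by rewrite ExZ//; under eq_fun do rewrite ExZ//; exact: cvgMr.
Qed.

Lemma Ex_cvg_ext f g : f =1 g -> Ex_cvg f -> Ex_cvg g.
Proof. by move=> /funext ->. Qed.

Hypothesis mgf_cvg : forall s, Ex_cvg (fun x => expR (s * x)).

(** The expectations of [M] converge and are therefore eventually at most [B]; an approximation
    within [d] times the weight then costs e / 3 under every late [mu_ n] and under [mu]. *)
Lemma Ex_cvg_approx f (c : R) : exp_growth f ->
  (forall e, 0 < e -> exists2 g, Ex_cvg g &
     forall x, `|f x - g x| <= e * expR (c * `|x|)) ->
  Ex_cvg f.
Proof.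
move=> hf appr; split=> //.
pose M x := expR (c * x) + expR (- c * x).
have [hM cM] : Ex_cvg M by apply: Ex_cvgD; exact: mgf_cvg.
have M0 nu : exp_integrable nu -> 0 <= Ex nu M.
  by move=> ?; apply: Rintegral_ge0 => x _; rewrite addr_ge0 ?expR_ge0.
pose B := Ex mu M + 1; have B0 : 0 < B by have := M0 _ muexp; rewrite /B; lra.
apply/cvgrPdist_le => e e0.
pose d := e / (3 * B); have d0 : 0 < d by rewrite divr_gt0// mulr_gt0.
have [g [hg cg] fg] := appr d d0.
have close nu : exp_integrable nu -> Ex nu M <= B -> `|Ex nu f - Ex nu g| <= e / 3.
  move=> hnu nuB; have hdM := exp_growthZ d hM.
  apply: le_trans (Ex_dist_le hnu hf hg hdM _) _.
    move=> x; apply: (le_trans (fg x)).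
    by apply: ler_wpM2l; [exact: ltW|exact: expR_norm_le].
  rewrite ExZ// (le_trans (ler_wpM2l (ltW d0) nuB))// /d.
  by rewrite invfM -!mulrA mulVf ?mulr1 ?gt_eqF.
near=> n.
have nB : Ex (mu_ n) M <= B.
  have : `|Ex mu M - Ex (mu_ n) M| <= 1 by near: n; move/cvgrPdist_le : cM; apply.
  by rewrite ler_norml /B; lra.
have h1 := close _ (muexp_ n) nB.
have h2 : `|Ex mu f - Ex mu g| <= e / 3 by apply: close; rewrite // /B; lra.
have h3 : `|Ex mu g - Ex (mu_ n) g| <= e / 3.
  by near: n; move/cvgrPdist_le : cg; apply; rewrite divr_gt0.
by move: h1 h2 h3; rewrite !ler_norml; lra.
Unshelve. all: by end_near. Qed.

(** x^(m+1) e^(s x) is the s-derivative of x^m e^(s x). The difference quotient with step [h] is off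
    by at most [h] times an exponential weight, so induction on m with [s] free applies. *)
Lemma Ex_cvg_exp_poly m s : Ex_cvg (fun x => x ^+ m * expR (s * x)).
Proof.
elim: m s => [|m IH] s.
  by apply: Ex_cvg_ext (mgf_cvg s) => x; rewrite expr0 mul1r.
have hpow k : exp_growth (fun x : R => x ^+ k) by exact: exp_growthX (@exp_growth_id R).
apply: (@Ex_cvg_approx _ (m.+2%:R + `|s| + 2)).
  by apply: exp_growthM => //; exact: exp_growth_expR.
move=> e e0; pose h := Num.min e 1.
have h0 : 0 < h by rewrite /h lt_min e0 ltr01.
have h1 : h <= 1 by rewrite /h ge_min lexx orbT.
have he : h <= e by rewrite /h ge_min lexx.
exists (fun x => h^-1 * (x ^+ m * expR ((s + h) * x)) + (- h^-1) * (x ^+ m * expR (s * x))).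
  by apply: Ex_cvgD; apply: Ex_cvgZ; exact: IH.
move=> x; have hn0 : h != 0 by rewrite gt_eqF.
have -> : x ^+ m.+1 * expR (s * x) - (h^-1 * (x ^+ m * expR ((s + h) * x)) +
      - h^-1 * (x ^+ m * expR (s * x))) =
    - (h^-1 * (x ^+ m * expR (s * x) * (expR (h * x) - (1 + h * x)))).
  by rewrite mulrDl expRD exprS; field.
have r2 : `|expR (h * x) - (1 + h * x)| <= h ^+ 2 * `|x| ^+ 2 * expR (2 * `|x|).
  have := expR_remainder_le 2 (h * x); rewrite !big_ord_recr big_ord0/=.
  rewrite (_ : 0 + _ + _ = 1 + h * x); last first.
    by rewrite expr0 expr1 fact0 invr1; ring.
  move/le_trans; apply; rewrite normrM (ger0_norm (ltW h0)) exprMn.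
  rewrite (_ : 2`! = 2%N)// -mulrA ler_wpM2l ?mulr_ge0 ?exprn_ge0 ?(ltW h0)//.
  rewrite -[leRHS]mul1r ler_pM ?expR_ge0//; first by lra.
  by rewrite ler_expR ler_wpM2r//; lra.
rewrite normrN normrM normfV (ger0_norm (ltW h0)) !normrM normrX.
rewrite (ger0_norm (expR_ge0 _)) ler_pdivrMl//.
apply: le_trans (ler_wpM2l _ r2) _; first by rewrite mulr_ge0 ?exprn_ge0 ?expR_ge0.
have -> : `|x| ^+ m * expR (s * x) * (h ^+ 2 * `|x| ^+ 2 * expR (2 * `|x|)) =
    h ^+ 2 * (`|x| ^+ m.+2 * (expR (s * x) * expR (2 * `|x|))).
  by rewrite !exprS; ring.
rewrite expr2 -[leLHS]mulrA ler_pM2l//.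
rewrite ler_pM ?(ltW h0)// ?mulr_ge0 ?exprn_ge0 ?expR_ge0//.
have -> : expR ((m.+2%:R + `|s| + 2) * `|x|) =
    expR `|x| ^+ m.+2 * (expR (`|s| * `|x|) * expR (2 * `|x|)).
  by rewrite -expRM_natl -!expRD; congr expR; ring.
apply: ler_pM; first exact: exprn_ge0.
- by rewrite mulr_ge0 ?expR_ge0.
- by rewrite lerXn2r ?nnegrE ?expR_ge0 ?norm_le_expR.
by rewrite ler_wpM2r ?expR_ge0// ler_expR -normrM ler_norm.
Qed.

Lemma Ex_cvg_power m : Ex_cvg (fun x => x ^+ m).
Proof.
apply: Ex_cvg_ext (Ex_cvg_exp_poly m 0) => x.
by rewrite mul0r expR0 mulr1.
Qed.

Lemma Ex_cvg_affine_power (a b : R) j : Ex_cvg (fun x => (a * x + b) ^+ j).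
Proof.
(* The extra power of x absorbs the factor x when one factor a x + b is expanded. *)
suff h m : Ex_cvg (fun x => (a * x + b) ^+ j * x ^+ m).
  by apply: Ex_cvg_ext (h 0%N) => x; rewrite expr0 mulr1.
elim: j m => [|j IH] m.
  by apply: Ex_cvg_ext (Ex_cvg_power m) => x; rewrite expr0 mul1r.
apply: Ex_cvg_ext (Ex_cvgD (Ex_cvgZ a (IH m.+1)) (Ex_cvgZ b (IH m))) => x.
by rewrite !exprS; ring.
Qed.

Lemma Ex_cvg_sum (F : nat -> R -> R) n : (forall i, Ex_cvg (F i)) ->
  Ex_cvg (fun x => \sum_(i < n) F i x).
Proof.
move=> hF; elim: n => [|n IH].
  by apply: Ex_cvg_ext (Ex_cvg_cst 0) => x; rewrite big_ord0.
by apply: Ex_cvg_ext (Ex_cvgD IH (hF n)) => x; rewrite big_ord_recr.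
Qed.

Lemma exp_growth_cos_affine (a b : R) : exp_growth (fun x => cos (a * x + b)).
Proof.
by apply: exp_growth_cos; apply: measurable_funD.
Qed.

(** By [exp_coeff_le_half] the Taylor remainder of cos at t is at most 2^-m e^(3 |t|) on the whole
    line: Taylor polynomials approximate in the exponentially weighted sense of [Ex_cvg_approx]. *)
Lemma Ex_cvg_cos (a b : R) : Ex_cvg (fun x => cos (a * x + b)).
Proof.
apply: (@Ex_cvg_approx _ (3 * `|a|)); first exact: exp_growth_cos_affine.
move=> e e0.
have [m hm] : exists m : nat, 2^-1 ^+ m * expR (3 * `|b|) <= e.
  have := @cvg_geometric R (expR (3 * `|b|)) 2^-1.
  rewrite ger0_norm// => /(_ _)/cvgrPdist_le => h.
  have [|m _ /(_ m (leqnn m))] := h _ e e0; first by lra.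
  rewrite sub0r normrN /geometric/= ger0_norm ?mulr_ge0 ?expR_ge0 ?exprn_ge0// => hm.
  by exists m; rewrite mulrC.
exists (fun x => \sum_(i < m) cos_coeff (a * x + b) i).
  apply: (@Ex_cvg_sum (fun i x => cos_coeff (a * x + b) i)) => i.
  apply: Ex_cvg_ext (Ex_cvgZ ((~~ odd i)%:R * (-1) ^+ i./2 / i`!%:R) (Ex_cvg_affine_power a b i)).
  by move=> x; rewrite /cos_coeff/= -exprnP; ring.
move=> x; apply: le_trans (cos_remainder_le _ _) _.
set t := a * x + b.
have tle : `|t| <= `|a| * `|x| + `|b| by rewrite -normrM ler_normD.
apply: (@le_trans _ _ (2^-1 ^+ m * expR (2 * `|t|) * expR `|t|)).
  by rewrite ler_wpM2r ?expR_ge0// exp_coeff_le_half.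
rewrite -mulrA -expRD.
apply: (@le_trans _ _ (2^-1 ^+ m * (expR (3 * `|b|) * expR (3 * `|a| * `|x|)))).
  by rewrite ler_wpM2l ?exprn_ge0// -expRD ler_expR; lra.
by rewrite mulrA ler_wpM2r ?expR_ge0.
Qed.

(* By the product-to-sum formula this class is closed under multiplication by cosines. *)
Definition trig_cvg f := forall a b : R, Ex_cvg (fun x => f x * cos (a * x + b)).

Lemma trig_cvg1 : trig_cvg (fun=> 1).
Proof. by move=> a b; apply: Ex_cvg_ext (Ex_cvg_cos a b) => x; rewrite mul1r. Qed.

Lemma trig_cvg_Ex f : trig_cvg f -> Ex_cvg f.
Proof.
move=> /(_ 0 0); apply: Ex_cvg_ext => x.
by rewrite mul0r addr0 cos0 mulr1.
Qed.

Lemma trig_cvgM f (p q a b : R) : trig_cvg f ->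
  trig_cvg (fun x => f x * (p + q * cos (a * x + b))).
Proof.
move=> hf c d.
apply: Ex_cvg_ext (Ex_cvgD (Ex_cvgZ p (hf c d))
  (Ex_cvgZ (q / 2) (Ex_cvgD (hf (a + c) (b + d)) (hf (a - c) (b - d))))) => x.
rewrite (_ : (a + c) * x + (b + d) = (a * x + b) + (c * x + d)); last by ring.
rewrite (_ : (a - c) * x + (b - d) = (a * x + b) - (c * x + d)); last by ring.
move: (a * x + b) (c * x + d) => u v.
by rewrite cosD cosB; field.
Qed.

Lemma trig_cvgB f g : trig_cvg f -> trig_cvg g -> trig_cvg (fun x => f x - g x).
Proof.
move=> hf hg a b; apply: Ex_cvg_ext (Ex_cvgD (hf a b) (Ex_cvgZ (-1) (hg a b))) => x.
ring.
Qed.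

Lemma Ex_cvg_step_poly (p q a b : R) n N :
  Ex_cvg (fun x => (1 - (p + q * cos (a * x + b)) ^+ n) ^+ N).
Proof.
apply: trig_cvg_Ex; pose u x := p + q * cos (a * x + b).
have hX f m : trig_cvg f -> trig_cvg (fun x => f x * u x ^+ m).
  move=> hf; elim: m => [|m IH].
    by move: hf; congr trig_cvg; apply/funext => x; rewrite expr0 mulr1.
  move: (trig_cvgM p q a b IH); congr trig_cvg; apply/funext => x.
  by rewrite exprSr mulrA.
elim: N => [|N IH].
  by move: trig_cvg1; congr trig_cvg; apply/funext => x; rewrite expr0.
move: (trig_cvgB IH (hX _ n IH)); congr trig_cvg; apply/funext => x.
by rewrite exprSr /u; ring.
Qed.

End expectation_limits.

(** * Steps made of powers of a cosine *)

Section step_polynomial.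
Variable R : realType.

Lemma bernoulli_ge (y : R) N : 0 <= y -> 1 + N%:R * y <= (1 + y) ^+ N.
Proof.
move=> y0; elim: N => [|N IH]; first by rewrite mul0r expr0 addr0.
have h : (1 + y) * (1 + N%:R * y) <= (1 + y) * (1 + y) ^+ N.
  by rewrite ler_wpM2l// addr_ge0.
rewrite exprS (le_trans _ h)// -natr1.
by have : 0 <= N%:R * y ^+ 2; [rewrite mulr_ge0 ?exprn_ge0|nra].
Qed.

Lemma bernoulli_1B (y : R) N : 0 <= y <= 1 -> 1 - N%:R * y <= (1 - y) ^+ N.
Proof.
move=> /andP[y0 y1]; elim: N => [|N IH]; first by rewrite mul0r expr0 subr0.
have h : (1 - y) * (1 - N%:R * y) <= (1 - y) * (1 - y) ^+ N.
  by rewrite ler_wpM2l// subr_ge0.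
rewrite exprS (le_trans _ h)// -natr1.
by have : 0 <= N%:R * y ^+ 2; [rewrite mulr_ge0 ?exprn_ge0|nra].
Qed.

Lemma small_power (r e : R) : 0 <= r < 1 -> 0 < e -> exists n, r ^+ n <= e.
Proof.
move=> /andP[r0 r1] e0; have := @cvg_expr R r.
rewrite ger0_norm// => /(_ r1)/cvgrPdist_le/(_ e e0)[n _ /(_ n (leqnn n))]/=.
by rewrite sub0r normrN ger0_norm ?exprn_ge0// => h; exists n.
Qed.

(* (1 - u^n)^(2^n) tends to 1 for u < 1/2 and to 0 for u > 1/2. *)
Lemma step_power (a b e : R) : 0 <= a < 2^-1 -> 2^-1 < b -> 0 < e ->
  exists n, forall u, 0 <= u <= 1 ->
    [/\ 0 <= (1 - u ^+ n) ^+ (2 ^ n) <= 1,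
        u <= a -> 1 - e <= (1 - u ^+ n) ^+ (2 ^ n)
      & b <= u -> (1 - u ^+ n) ^+ (2 ^ n) <= e].
Proof.
move=> /andP[a0 a2] b2 e0; pose r := Num.max (2 * a) (2 * b)^-1.
have r01 : 0 <= r < 1.
  rewrite le_max mulr_ge0//= gt_max; apply/andP; split; first by lra.
  by rewrite invf_lt1; lra.
have [n rn] := small_power r01 e0; exists n => u /andP[u0 u1].
have un : 0 <= u ^+ n <= 1 by rewrite exprn_ge0// exprn_ile1.
have /andP[un0 un1] := un.
have NuE : (2 ^ n)%N%:R * u ^+ n = (2 * u) ^+ n by rewrite natrX exprMn.
have pos : 0 <= (1 - u ^+ n) ^+ (2 ^ n) by rewrite exprn_ge0// subr_ge0.
have /andP[r0 _] := r01.
split.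
- by rewrite pos exprn_ile1 ?subr_ge0// lerBlDr lerDl.
- move=> ua; apply: le_trans (bernoulli_1B _ un); rewrite NuE lerB//.
  apply: le_trans rn; rewrite lerXn2r ?nnegrE ?mulr_ge0//.
  by rewrite le_max; apply/orP; left; lra.
- move=> bu; have u0' : 0 < u by lra.
  apply: le_trans rn; apply: (@le_trans _ _ ((2 * u)^-1 ^+ n)); last first.
    rewrite lerXn2r ?nnegrE ?invr_ge0 ?mulr_ge0// le_max; apply/orP; right.
    by rewrite lef_pV2 ?posrE ?mulr_gt0//; lra.
  rewrite exprVn -[leRHS]mul1r ler_pdivlMr ?exprn_gt0 ?mulr_gt0//.
  (* Bernoulli bounds (1 + u^n)^(2^n) below by (2 u)^n, while its product with (1 - u^n)^(2^n) is at
     most 1. *)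
  have h := bernoulli_ge (2 ^ n) un0; rewrite NuE in h.
  apply: (@le_trans _ _ ((1 - u ^+ n) ^+ (2 ^ n) * (1 + u ^+ n) ^+ (2 ^ n))).
    by rewrite ler_wpM2l// (le_trans _ h)// lerDr.
  rewrite -exprMn exprn_ile1// ?mulr_ge0 ?subr_ge0 ?addr_ge0//.
  by nra.
Qed.

(** [th] maps [-A, A] to [0, pi], where cos decreases strictly. The function u = 1/2 + (cos (th x) -
    cos (th x0)) / 4 stays in [0, 1] and crosses 1/2 at x0, so [step_power] separates the two
    sides. *)
Lemma cosine_step (x0 delta A e : R) : 0 < delta -> 0 < e ->
  - A <= x0 - delta -> x0 + delta <= A ->
  exists p q a b n N, let f x := (1 - (p + q * cos (a * x + b)) ^+ n) ^+ N in
  [/\ forall x, 0 <= f x <= 1, forall x, - A <= x <= x0 - delta -> f x <= e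
    & forall x, x0 + delta <= x <= A -> 1 - e <= f x].
Proof.
move=> d0 e0 A1 A2; have A0 : 0 < A by lra.
pose a := pi / (2 * A); pose b : R := pi / 2; pose th x := a * x + b.
have a0 : 0 < a by rewrite divr_gt0 ?pi_gt0// mulr_gt0.
have aA : a * A = pi / 2 by rewrite /a; field; rewrite gt_eqF.
have thin x : - A <= x <= A -> th x \in `[0, pi].
  move=> /andP[x1 x2]; rewrite in_itv/= /th /b -aA -mulrDr.
  rewrite mulr_ge0 ?(ltW a0)//=; last by lra.
  have -> : pi = a * (A + A) by rewrite mulrDr aA; field.
  by rewrite ler_wpM2l ?(ltW a0)//; lra.
have cos_le x y : - A <= x -> x <= y -> y <= A -> cos (th y) <= cos (th x).
  move=> x1 xy yA; rewrite leNgt ltr_cos ?thin ?x1 ?yA ?(le_trans xy) ?(le_trans x1)//.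
  by rewrite -leNgt lerD2r ler_wpM2l// ltW.
have cos_lt x y : - A <= x -> x < y -> y <= A -> cos (th y) < cos (th x).
  move=> x1 xy yA; have xy' := ltW xy.
  rewrite ltr_cos ?thin ?x1 ?yA ?(le_trans xy') ?(le_trans x1)//.
  by rewrite ltrD2r ltr_pM2l.
pose p := 2^-1 - cos (th x0) / 4.
pose u x := p + 4^-1 * cos (th x).
have u01 x : 0 <= u x <= 1.
  rewrite /u /p; have := cos_max (th x); have := cos_max (th x0).
  by rewrite !ler_norml => /andP[? ?] /andP[? ?]; apply/andP; split; lra.
have h1 : 0 <= u (x0 + delta) < 2^-1.
  have /andP[-> _] := u01 (x0 + delta); rewrite /u /p.
  by have := cos_lt x0 (x0 + delta); lra.
have h2 : 2^-1 < u (x0 - delta).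
  by rewrite /u /p; have := cos_lt (x0 - delta) x0; lra.
have [n hn] := step_power h1 h2 e0.
exists p, 4^-1, a, b, n, (2 ^ n)%N; split => x.
- by have [] := hn _ (u01 x).
- move=> /andP[x1 x2]; have [_ _] := hn _ (u01 x); apply.
  by rewrite /u; have := cos_le x (x0 - delta); lra.
- move=> /andP[x1 x2]; have [_ + _] := hn _ (u01 x); apply.
  by rewrite /u; have := cos_le (x0 + delta) x; lra.
Qed.

End step_polynomial.

Section curtiss.
Variable R : realType.
Local Notation TR := (measurableTypeR R).
Variables (mu_ : nat -> probability TR R) (mu : probability TR R).
Hypothesis muexp_ : forall n, exp_integrable (mu_ n).
Hypothesis muexp : exp_integrable mu.
Hypothesis mgf_cvg : forall s, Ex_cvg mu_ mu (fun x => expR (s * x)).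

Definition le_indic (y w : R) : R := (w <= y)%R%:R.

Lemma exp_growth_le_indic y : exp_growth (le_indic y).
Proof.
apply: (@exp_growth_bounded _ _ 1) => [|w]; last first.
  by rewrite /le_indic normr_nat; case: (w <= y)%R.
rewrite (_ : le_indic y = \1_(`]-oo, y]%classic)).
  exact: measurable_indic.
by apply/funext => w; rewrite indicE mem_setE in_itv.
Qed.

Lemma Ex_le_indic (nu : probability TR R) y :
  Ex nu (le_indic y) = fine (nu `]-oo, y]%classic).
Proof.
rewrite -Ex_indic//; congr (Ex nu _).
by apply/funext => w; rewrite indicE mem_setE in_itv.
Qed.

(** The cosine step is controlled on [-A, A] only. Outside, [A] is so large that e w^2 >= 1 covers
    any error of a function with values in [0, 1]; hence the weight 1 + w^2, whose expectations
    converge. *)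
Lemma smooth_le_indic (x0 delta e : R) : 0 < delta -> 0 < e ->
  exists2 g, Ex_cvg mu_ mu g & forall w,
    le_indic (x0 - delta) w - e * (1 + w ^+ 2) <= g w <=
    le_indic (x0 + delta) w + e * (1 + w ^+ 2).
Proof.
move=> d0 e0; pose A := Num.max (`|x0| + delta) (e^-1 + 1).
have A1 : `|x0| + delta <= A by rewrite le_max lexx.
have A2 : e^-1 + 1 <= A by rewrite le_max lexx orbT.
have einv : 0 < e^-1 by rewrite invr_gt0.
have big w : A < `|w| -> 1 <= e * w ^+ 2.
  move=> Aw; rewrite -ler_pdivrMl// mulr1 -real_normK ?num_real//.
  by nra.
have [p [q [a [b [n [N [f01 flow fhigh]]]]]]] :
    exists p q a b n N, let f x := (1 - (p + q * cos (a * x + b)) ^+ n) ^+ N in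
  [/\ forall x, 0 <= f x <= 1, forall x, - A <= x <= x0 - delta -> f x <= e
    & forall x, x0 + delta <= x <= A -> 1 - e <= f x].
  apply: cosine_step => //.
  - by have := ler_norm (- x0); rewrite normrN; lra.
  - by have := ler_norm x0; lra.
have hstep := Ex_cvg_step_poly muexp_ muexp mgf_cvg p q a b n N.
pose f (x : R) : R := (1 - (p + q * cos (a * x + b)) ^+ n) ^+ N.
rewrite -/f in hstep.
have {}flow : forall x : R, - A <= x <= x0 - delta -> f x <= e := flow.
have {}fhigh : forall x : R, x0 + delta <= x <= A -> 1 - e <= f x := fhigh.
have {}f01 : forall x : R, 0 <= f x <= 1 := f01.
clearbody f; exists (fun w => 1 + (-1) * f w).
  by apply: Ex_cvgD => //; [exact: Ex_cvg_cst|exact: Ex_cvgZ].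
move=> w; have /andP[f0 f1] : 0 <= f w <= 1 := f01 w.
have w2 : 0 <= e * w ^+ 2 by rewrite mulr_ge0 ?sqr_ge0 ?ltW.
have hb := big w; have wn := ler_norm w; have wn' := ler_norm (- w).
rewrite normrN in wn'.
have dec : `|w| <= A \/ 1 <= e * w ^+ 2.
  by case: (lerP `|w| A) => h; [left|right; exact: hb].
apply/andP; split; rewrite /le_indic.
- case: (lerP w (x0 - delta)) => hw; rewrite ?mulr1n ?mulr0n; last by lra.
  case: dec => [wA|]; last by lra.
  by have : f w <= e; [apply: flow; apply/andP; split|]; lra.
- case: (lerP w (x0 + delta)) => hw; rewrite ?mulr1n ?mulr0n; first by lra.
  case: dec => [wA|]; last by lra.
  by have : 1 - e <= f w; [apply: fhigh; apply/andP; split|]; lra.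
Qed.

Lemma no_atom_small_interval (x : R) : mu [set x] = 0%E ->
  forall e, 0 < e -> exists2 eta : R, 0 < eta &
    fine (mu `]-oo, x + eta]%classic) <= fine (mu `]-oo, x - eta]%classic) + e.
Proof.
move=> mux e e0.
pose E m : set R := `]x - m.+1%:R^-1, x + m.+1%:R^-1]%classic.
have mE m : measurable (E m : set TR) by exact: measurable_itv.
have capE : \bigcap_m E m = [set x].
  apply/seteqP; split=> [y|y ->] /=; last first.
    by move=> m _; rewrite /E/= in_itv/= ltrBlDr ltrDl lerDl invr_gt0 invr_ge0 ltr0n ler0n.
  move=> hy; apply/eqP; rewrite -subr_eq0 -normr_eq0; apply/negPn/negP => yx.
  have yx0 : 0 < `|y - x| by rewrite lt_neqAle eq_sym yx normr_ge0.
  have := @cvg_harmonic R; move/cvgrPdist_lt => /(_ _ yx0)[m _ /(_ m (leqnn m))]/=.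
  rewrite sub0r normrN ger0_norm ?invr_ge0// => hm.
  have := hy m I; rewrite /E/= in_itv/= => /andP[h1 h2].
  suff : `|y - x| <= m.+1%:R^-1 by rewrite leNgt hm.
  have h3 : y - x <= m.+1%:R^-1 by rewrite lerBlDl.
  have h4 : - m.+1%:R^-1 <= y - x by rewrite lerBrDl ltW.
  by rewrite ler_norml h3 h4.
have cE : mu (E m) @[m --> \oo] --> 0%E.
  rewrite -mux -capE; apply: nonincreasing_cvg_mu => //.
  - by rewrite (le_lt_trans (probability_le1 _ _))// ltry.
  - by rewrite capE; exact: measurable_set1.
  - apply/nonincreasing_seqP => m; apply/subsetPset => y; rewrite /E/= !in_itv/=.
    have : (m.+2%:R^-1 : R) <= m.+1%:R^-1 by rewrite lef_pV2 ?posrE// ler_nat.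
    move: (m.+2%:R^-1 : R) (m.+1%:R^-1 : R) => u v uv /andP[h1 h2].
    by apply/andP; split; lra.
have /fine_cvgP[_ /cvgrPdist_le/(_ e e0)[m _ /(_ m (leqnn m))]] := cE.
rewrite /= sub0r normrN ger0_norm ?fine_ge0// => hm.
exists m.+1%:R^-1; first by rewrite invr_gt0.
have -> : `]-oo, x + m.+1%:R^-1]%classic = `]-oo, x - m.+1%:R^-1]%classic `|` E m.
  rewrite -(itv_bndbnd_setU)//= bnd_simp.
  by rewrite lerD2l (@le_trans _ _ 0)// ?oppr_le0 invr_ge0.
rewrite measureU//; last first.
  apply/seteqP; split => // y; rewrite /E/= !in_itv/= => -[h1 /andP[h2 _]].
  by move: (le_lt_trans h1 h2); rewrite ltxx.
by rewrite fineD ?fin_num_measure// lerD2l.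
Qed.

(** The evaluation point moves with n because the exact mean and variance will enter through it. *)
Theorem curtiss (x : R) (y_ : nat -> R) : mu [set x] = 0%E ->
  y_ n @[n --> \oo] --> x ->
  fine (mu_ n `]-oo, y_ n]%classic) @[n --> \oo] --> fine (mu `]-oo, x]%classic).
Proof.
move=> mux cy; under eq_fun do rewrite -Ex_le_indic; rewrite -Ex_le_indic.
have e2g e : exp_growth (fun w : R => e * (1 + w ^+ 2)).
  apply: exp_growthZ; apply: exp_growthD; first exact: exp_growth_cst.
  by apply: exp_growthX; exact: exp_growth_id.
have cw2 e : Ex_cvg mu_ mu (fun w => e * (1 + w ^+ 2)).
  apply: Ex_cvgZ => //; apply: Ex_cvgD => //; first exact: Ex_cvg_cst.
  exact: Ex_cvg_power.
have mono (nu : probability TR R) (hnu : exp_integrable nu) y z : y <= z ->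
    Ex nu (le_indic y) <= Ex nu (le_indic z).
  move=> yz; apply: Ex_le => //; try exact: exp_growth_le_indic.
  by move=> w; rewrite /le_indic; case: (lerP w y) => // wy; rewrite (le_trans wy).
pose m2 := Ex mu (fun w : R => 1 + w ^+ 2).
have m20 : 0 <= m2 by apply: Rintegral_ge0 => w _; rewrite addr_ge0 ?sqr_ge0.
apply/cvgrPdist_le => e e0.
have [eta eta0 heta] := no_atom_small_interval mux (divr_gt0 e0 (ltr0Sn R 3)).
rewrite -!Ex_le_indic in heta.
(* Steps centred at x + 2 delta and x - 2 delta with half-width [delta] fit between [y_ n],
   eventually within [delta] of x, and x + eta or x - eta. *)
pose delta := eta / 3; have d0 : 0 < delta by rewrite divr_gt0.
pose e1 := e / (8 * (m2 + 1)).
have e10 : 0 < e1 by rewrite divr_gt0// mulr_gt0//; lra.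
have e1m : e1 * m2 <= e / 8.
  rewrite /e1 invfM mulrA -mulrA ler_piMr ?divr_ge0 ?(ltW e0)//.
  by rewrite ler_pdivrMl ?mulr1; lra.
have ExE : Ex mu (fun w : R => e1 * (1 + w ^+ 2)) = e1 * m2.
  by rewrite ExZ//; apply: exp_growthD; [exact: exp_growth_cst|apply: exp_growthX; exact: exp_growth_id].
have [g [gg cg] hg] := smooth_le_indic (x + 2 * delta) d0 e10.
have [h [gh ch] hh] := smooth_le_indic (x - 2 * delta) d0 e10.
have [_ cw] := cw2 e1.
have e16 : 0 < e / 16 by rewrite divr_gt0.
near=> n.
have yn : `|x - y_ n| <= delta by near: n; move/cvgrPdist_le : cy; apply.
have gn : `|Ex mu g - Ex (mu_ n) g| <= e / 16 by near: n; move/cvgrPdist_le : cg; apply.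
have hn : `|Ex mu h - Ex (mu_ n) h| <= e / 16 by near: n; move/cvgrPdist_le : ch; apply.
have wn : `|Ex mu (fun w : R => e1 * (1 + w ^+ 2)) - Ex (mu_ n) (fun w : R => e1 * (1 + w ^+ 2))| <= e / 16.
  by near: n; move/cvgrPdist_le : cw; apply.
rewrite ExE in wn.
have up : Ex (mu_ n) (le_indic (y_ n)) <= Ex (mu_ n) g + Ex (mu_ n) (fun w : R => e1 * (1 + w ^+ 2)).
  rewrite -ExD//; apply: (le_trans (mono _ (muexp_ n) _ (x + 2 * delta - delta) _)).
    by move: yn; rewrite ler_norml => /andP[? ?]; lra.
  apply: Ex_le => //; [exact: exp_growth_le_indic|exact: exp_growthD|].
  by move=> w; have /andP[+ _] := hg w; lra.
have up2 : Ex mu g <= Ex mu (le_indic (x + eta)) + e1 * m2.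
  rewrite -ExE -ExD//; last exact: exp_growth_le_indic.
  apply: Ex_le => //; first by apply: exp_growthD => //; exact: exp_growth_le_indic.
  move=> w; have /andP[_] := hg w.
  by rewrite (_ : _ + delta = x + eta)//; rewrite /delta; lra.
have lo : Ex (mu_ n) h <= Ex (mu_ n) (le_indic (y_ n)) + Ex (mu_ n) (fun w : R => e1 * (1 + w ^+ 2)).
  rewrite -ExD//; last exact: exp_growth_le_indic.
  apply: Ex_le => //; first by apply: exp_growthD => //; exact: exp_growth_le_indic.
  move=> w; have /andP[_ hw] := hh w; apply: (le_trans hw); rewrite lerD2r.
  rewrite /le_indic; case: (lerP w (x - 2 * delta + delta)) => // h1; rewrite (_ : w <= y_ n)//.
  by move: yn; rewrite ler_norml => /andP[? ?]; lra.
have lo2 : Ex mu (le_indic (x - eta)) <= Ex mu h + e1 * m2.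
  rewrite -ExE -ExD//; apply: Ex_le => //; [exact: exp_growth_le_indic|exact: exp_growthD|].
  move=> w; have /andP[+ _] := hh w.
  by rewrite (_ : x - 2 * delta - delta = x - eta); [lra|rewrite /delta; lra].
have m1 : Ex mu (le_indic (x - eta)) <= Ex mu (le_indic x) by apply: mono => //; lra.
have m3 : Ex mu (le_indic x) <= Ex mu (le_indic (x + eta)) by apply: mono => //; lra.
by move: gn hn wn; rewrite !ler_norml; lra.
Unshelve. all: by end_near. Qed.

End curtiss.

(** * The standard normal law *)

Section normal_mgf.
Variable R : realType.
Local Notation TR := (measurableTypeR R).
Local Notation mu := (@lebesgue_measure R).
Local Notation normal := (@normal_prob R 0 1).

(** The Radon-Nikodym derivative and [normal_pdf] have the same integral over every measurable set,
    hence agree almost everywhere. *)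
Lemma ge0_integral_normal_prob (f : TR -> \bar R) :
  measurable_fun [set: TR] f -> (forall x, 0 <= f x)%E ->
  (\int[normal]_x f x = \int[mu]_x (f x * (normal_pdf 0 1 x)%:E))%E.
Proof.
move=> mf f0; have dom := @normal_prob_dominates R 0 1.
rewrite -(Radon_Nikodym_SigmaFinite.change_of_variables dom f0)//.
have mRN : measurable_fun [set: TR] (Radon_Nikodym_SigmaFinite.f normal mu).
  exact: measurable_int (Radon_Nikodym_SigmaFinite.f_integrable dom).
apply: ae_eq_integral => //.
- exact: emeasurable_funM.
- by apply: emeasurable_funM => //; apply/measurable_EFinP; exact: measurable_normal_pdf.
- apply: ae_eqe_mul2l; apply: integral_ae_eq => //.
  + exact: Radon_Nikodym_SigmaFinite.f_integrable.
  + by apply/measurable_EFinP; exact: measurable_normal_pdf.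
  + by move=> E _ mE; rewrite -Radon_Nikodym_SigmaFinite.f_integral.
Qed.

(** Completing the square: e^(s x) times the standard density is e^(s^2/2) times the density with
    mean s. *)
Lemma normal_mgf (s : R) :
  (\int[normal]_x (expR (s * x))%:E = (expR (s ^+ 2 / 2))%:E)%E.
Proof.
rewrite ge0_integral_normal_prob; first last.
- by move=> x; rewrite lee_fin expR_ge0.
- apply/measurable_EFinP; apply: measurableT_comp => //.
have -> : (fun x : TR => (expR (s * x))%:E * (normal_pdf 0 1 x)%:E)%E =
    (fun x => (expR (s ^+ 2 / 2))%:E * (normal_pdf s 1 x)%:E)%E.
  apply/funext => x; rewrite -!EFinM; congr EFin.
  rewrite !normal_pdfE// mulrCA [RHS]mulrCA; congr (_ * _).
  rewrite /normal_fun -!expRD; congr expR.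
  by rewrite expr1n mulr2n; field.
rewrite ge0_integralZl//; first by rewrite integral_normal_pdf mule1.
- by apply/measurable_EFinP; exact: measurable_normal_pdf.
- by move=> x _; rewrite lee_fin normal_pdf_ge0.
Qed.

Lemma exp_integrable_normal : exp_integrable normal.
Proof.
move=> s; apply/integrableP; split.
  by apply/measurable_EFinP; apply: measurableT_comp.
under eq_integral do rewrite gee0_abs ?lee_fin ?expR_ge0//.
by rewrite normal_mgf ltry.
Qed.

Lemma Ex_normal_expR s : Ex normal (fun x => expR (s * x)) = expR (s ^+ 2 / 2).
Proof. by rewrite /Ex /Rintegral normal_mgf. Qed.

Lemma eq_of_small_dist (a b C : R) : 
  (forall h, 0 < h <= 2^-1 -> `|a - b| <= C * h) -> a = b.
Proof.
move=> H; apply/eqP; rewrite -subr_eq0 -normr_eq0; apply/negPn/negP => ab.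
have d0 : 0 < `|a - b| by rewrite lt_neqAle eq_sym ab normr_ge0.
have C0 : 0 < C by have := H 2^-1; rewrite invr_gt0 ltr0n lexx/= => /(_ isT); nra.
pose h := Num.min 2^-1 (`|a - b| / (2 * C)).
have h0 : 0 < h by rewrite lt_min invr_gt0 ltr0n/= divr_gt0// mulr_gt0.
have := H h; rewrite h0 ge_min lexx/= => /(_ isT).
have : C * h <= C * (`|a - b| / (2 * C)) by rewrite ler_wpM2l ?(ltW C0)// ge_min lexx orbT.
rewrite (_ : C * (_ / _) = `|a - b| / 2); last by field; rewrite gt_eqF.
by lra.
Qed.

(** The quotient (e^(h x) - 1) / h is within h |x|^2 e^|x| of x, and by [normal_mgf] its expectation
    is at most h in absolute value. *)
Lemma Ex_normal_id : Ex normal (fun x => x) = 0.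
Proof.
have nexp := exp_integrable_normal.
pose w (x : R) := `|x| ^+ 2 * expR (1 * `|x|).
have gn : exp_growth (fun x : R => `|x|).
  split; last by exists 1, 1 => x; rewrite normr_id !mul1r norm_le_expR.
  exact: measurableT_comp.
have gw : exp_growth w.
  apply: exp_growthM; last exact: exp_growth_exp_norm.
  exact: exp_growthX.
pose W := Ex normal w; have W0 : 0 <= W.
  by apply: Rintegral_ge0 => x _; rewrite mulr_ge0 ?exprn_ge0 ?expR_ge0.
apply: (@eq_of_small_dist _ _ (W + 1)) => h /andP[h0 h1].
have hn0 : h != 0 by rewrite gt_eqF.
pose q (x : R) := h^-1 * (expR (h * x) + (-1)).
have ge : exp_growth (fun x : R => expR (h * x)) by exact: exp_growth_expR.
have gc : exp_growth (fun=> -1 : R) by exact: exp_growth_cst.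
have gq : exp_growth q by apply: exp_growthZ; exact: exp_growthD.
have Eq : Ex normal q = h^-1 * (expR (h ^+ 2 / 2) - 1).
  by rewrite ExZ//; [rewrite ExD// Ex_normal_expR Ex_cst|exact: exp_growthD].
have gid := @exp_growth_id R.
have ghw := exp_growthZ h gw.
have d1 : `|Ex normal (fun x => x) - Ex normal q| <= h * W.
  rewrite -ExZ//; apply: Ex_dist_le => // x.
  have -> : x - q x = - (h^-1 * (expR (h * x) - (1 + h * x))) by rewrite /q; field.
  have := expR_remainder_le 2 (h * x); rewrite !big_ord_recr big_ord0/=.
  rewrite (_ : 0 + _ + _ = 1 + h * x); last first.
    by rewrite expr0 expr1 fact0 invr1; ring.
  move=> rem_le; rewrite normrN normrM normfV (ger0_norm (ltW h0)) ler_pdivrMl//.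
  apply: (le_trans rem_le).
  rewrite normrM (ger0_norm (ltW h0)) exprMn (_ : 2`! = 2%N)// /w mul1r.
  have h5 : expR (h * `|x|) <= expR `|x| by rewrite ler_expR ler_piMl//; lra.
  rewrite (_ : h * (h * _) = h ^+ 2 * `|x| ^+ 2 * expR `|x|); last by ring.
  rewrite -[leLHS]mulrA ler_wpM2l//.
    by apply: mulr_ge0; apply: exprn_ge0; rewrite ?(ltW h0).
  by have := expR_ge0 (h * `|x|); lra.
have d2 : `|Ex normal q| <= h.
  have [|r r1 rE] := @expR_taylor2 R (h ^+ 2 / 2).
    by rewrite ger0_norm ?mulr_ge0 ?exprn_ge0// ?(ltW h0)//; nra.
  have {}Eq : Ex normal q = h * (2^-1 + (h / 2) ^+ 2 * r) by rewrite Eq rE; field.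
  rewrite Eq.
  rewrite normrM (ger0_norm (ltW h0)) ler_piMr ?(ltW h0)//.
  move: r1; rewrite !ler_norml => /andP[r1 r2].
  have : 0 <= (h / 2) ^+ 2 <= 2^-1.
    by rewrite exprn_ge0 ?divr_ge0 ?(ltW h0)//=; nra.
  by move: (_ ^+ 2) => u /andP[u0 u1]; apply/andP; split; nra.
rewrite subr0 -[Ex _ _](subrK (Ex normal q)) mulrDl mul1r.
by rewrite (le_trans (ler_normD _ _))// lerD// mulrC.
Qed.

(** Same method with the symmetric second difference quotient, in which the linear terms cancel. *)
Lemma Ex_normal_sqr : Ex normal (fun x => x ^+ 2) = 1.
Proof.
have nexp := exp_integrable_normal.
pose w (x : R) := `|x| ^+ 3 * expR (1 * `|x|).
have gn : exp_growth (fun x : R => `|x|).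
  split; last by exists 1, 1 => x; rewrite normr_id !mul1r norm_le_expR.
  exact: measurableT_comp.
have gw : exp_growth w.
  apply: exp_growthM; last exact: exp_growth_exp_norm.
  exact: exp_growthX.
pose W := Ex normal w; have W0 : 0 <= W.
  by apply: Rintegral_ge0 => x _; rewrite mulr_ge0 ?exprn_ge0 ?expR_ge0.
apply: (@eq_of_small_dist _ _ (W + 1)) => h /andP[h0 h1].
have hn0 : h != 0 by rewrite gt_eqF.
pose q (x : R) := (h ^+ 2)^-1 * (expR (h * x) + expR (- h * x) + (-2)).
have ge1 : exp_growth (fun x : R => expR (h * x)) by exact: exp_growth_expR.
have ge2 : exp_growth (fun x : R => expR (- h * x)) by exact: exp_growth_expR.
have gc : exp_growth (fun=> -2 : R) by exact: exp_growth_cst.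
have ge : exp_growth (fun x : R => expR (h * x) + expR (- h * x)) by exact: exp_growthD.
have gq : exp_growth q by apply: exp_growthZ; exact: exp_growthD.
have Eq : Ex normal q = (h ^+ 2)^-1 * (2 * expR (h ^+ 2 / 2) - 2).
  rewrite ExZ//; last exact: exp_growthD.
  by rewrite ExD// ExD// !Ex_normal_expR Ex_cst sqrrN; ring.
have gid : exp_growth (fun x : R => x ^+ 2) by apply: exp_growthX; exact: exp_growth_id.
have ghw := exp_growthZ h gw.
have d1 : `|Ex normal (fun x => x ^+ 2) - Ex normal q| <= h * W.
  rewrite -ExZ//; apply: Ex_dist_le => // x.
  pose rem y := expR y - (1 + y + y ^+ 2 / 2) : R.
  have -> : x ^+ 2 - q x = - ((h ^+ 2)^-1 * (rem (h * x) + rem (- h * x))).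
    by rewrite /q /rem; field.
  have remle y : `|y| = h * `|x| -> `|rem y| <= h ^+ 3 / 6 * w x.
    move=> yE; have := expR_remainder_le 3 y; rewrite !big_ord_recr big_ord0/=.
    rewrite (_ : 0 + _ + _ + _ = 1 + y + y ^+ 2 / 2); last first.
      by rewrite expr0 expr1 fact0 invr1 (_ : 2`! = 2%N)//; ring.
    move/le_trans; apply; rewrite yE exprMn (_ : 3`! = 6%N)// /w mul1r.
    rewrite [leRHS]mulrA [h ^+ 3 / 6 * _]mulrAC ler_wpM2l//.
      by rewrite mulr_ge0// mulr_ge0 ?exprn_ge0// ltW.
    by rewrite ler_expR ler_piMl//; lra.
  have r1 := remle (h * x); rewrite normrM (ger0_norm (ltW h0)) in r1.
  have r2 := remle (- h * x); rewrite normrM normrN (ger0_norm (ltW h0)) in r2.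
  have {}r1 := r1 erefl; have {}r2 := r2 erefl.
  rewrite normrN normrM normfV (ger0_norm (exprn_ge0 2 (ltW h0))).
  rewrite ler_pdivrMl ?exprn_gt0//.
  apply: (le_trans (ler_normD _ _)); apply: (le_trans (lerD r1 r2)).
  rewrite (_ : h ^+ 2 * (h * w x) = h ^+ 3 * w x); last by ring.
  have : 0 <= h ^+ 3 * w x by rewrite mulr_ge0 ?exprn_ge0 ?(ltW h0)// mulr_ge0 ?exprn_ge0 ?expR_ge0.
  by lra.
have d2 : `|Ex normal q - 1| <= h.
  have [|r r1 rE] := @expR_taylor2 R (h ^+ 2 / 2).
    by rewrite ger0_norm ?mulr_ge0 ?exprn_ge0// ?(ltW h0)//; nra.
  have {}Eq : Ex normal q - 1 = h * (h / 2 * r) by rewrite Eq rE; field.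
  rewrite Eq.
  rewrite normrM (ger0_norm (ltW h0)) ler_piMr ?(ltW h0)// normrM.
  rewrite (ger0_norm (divr_ge0 (ltW h0) (ler0n R 2))).
  by have := normr_ge0 r; nra.
rewrite -[Ex _ _](subrK (Ex normal q)) -addrA mulrDl mul1r.
by rewrite (le_trans (ler_normD _ _))// lerD// mulrC.
Qed.

End normal_mgf.

(** * Normal limits from quasi-powers *)

Section affine_image.
Context (R : realType) d (Om : measurableType d) (P : probability Om R).
Variables (X : {RV P >-> R}) (a b : R).

(* Valued in [measurableTypeR R], like [normal_prob], rather than in [R]. *)
Definition affine_image (w : Om) : measurableTypeR R := (X w - a) / b.

Let measurable_affine_image : measurable_fun setT affine_image.
Proof. by apply: measurable_funM => //; exact: measurable_funB. Qed.

HB.instance Definition _ :=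
  isMeasurableFun.Build _ _ _ _ affine_image measurable_affine_image.

Definition affine_law : probability (measurableTypeR R) R :=
  distribution P affine_image.

Hypothesis X_bounded : exists M : R, forall w, `|X w| <= M.

Lemma affine_image_bounded : exists M : R, forall w, `|affine_image w| <= M.
Proof.
have [M XM] := X_bounded; exists ((M + `|a|) * `|b^-1|) => w.
by rewrite normrM ler_wpM2r// (le_trans (ler_normB _ _))// lerD2r.
Qed.

Lemma integrable_exp_growth_affine (f : R -> R) : exp_growth f ->
  P.-integrable setT (EFin \o (f \o affine_image)).
Proof.
move=> [mf [C [c fC]]]; have [M YM] := affine_image_bounded.
have intc : P.-integrable setT (fun=> (`|C| * expR (`|c| * M))%:E).
  by apply: finite_measure_integrable_cst.
apply: le_integrable intc => //.
  by apply/measurable_EFinP; apply: measurableT_comp.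
move=> w _ /=; rewrite lee_fin [leRHS]ger0_norm ?mulr_ge0 ?expR_ge0//.
apply: (le_trans (fC _)); apply: (@le_trans _ _ (`|C| * expR (c * `|affine_image w|))).
  by rewrite ler_wpM2r ?expR_ge0// ler_norm.
rewrite ler_wpM2l// ler_expR (le_trans (ler_norm _))// normrM normr_id.
by rewrite ler_wpM2l.
Qed.

Lemma exp_integrable_affine_law : exp_integrable affine_law.
Proof.
move=> s; have gs := exp_growth_expR s.
have mE : measurable_fun [set: measurableTypeR R] (fun x : measurableTypeR R => (expR (s * x))%:E).
  by apply/measurable_EFinP; case: gs.
apply/integrableP; split=> //.
rewrite /affine_law ge0_integral_distribution//; last exact: measurableT_comp.
by have := integrable_exp_growth_affine gs => /integrableP[_].
Qed.

Lemma Ex_affine_law (f : R -> R) : exp_growth f ->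
  Ex affine_law f = fine 'E_P[f \o affine_image].
Proof.
move=> gf; rewrite unlock /Ex /Rintegral; congr fine.
rewrite integral_distribution//; last exact: integrable_exp_growth_affine.
by apply/measurable_EFinP; case: gf.
Qed.

Hypothesis b0 : b != 0.

Lemma affine_imageK w : X w = b * affine_image w + a.
Proof. by rewrite /affine_image; field. Qed.

Lemma expectation_affine : fine 'E_P[X] = b * Ex affine_law id + a.
Proof.
have gid := @exp_growth_id R.
have e := exp_integrable_affine_law.
have gb : exp_growth (fun x : R => b * x) by exact: exp_growthZ.
have gc : exp_growth (fun _ : R => a) by exact: exp_growth_cst.
have -> : b * Ex affine_law id + a = Ex affine_law (fun x => b * x + a).
  by rewrite ExD// ExZ// Ex_cst.
rewrite Ex_affine_law; last exact: exp_growthD.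
by congr (fine 'E_P[_]); apply/funext => w; rewrite /= affine_imageK.
Qed.

Lemma variance_affine : fine 'V_P[X] =
  b ^+ 2 * (Ex affine_law (fun x => x ^+ 2) - Ex affine_law id ^+ 2).
Proof.
have gid := @exp_growth_id R.
have e := exp_integrable_affine_law.
set m := Ex affine_law id.
have g2 : exp_growth (fun x : R => x ^+ 2) by exact: exp_growthX.
have gm : exp_growth (fun x : R => (- 2 * m) * x) by exact: exp_growthZ.
have gc : exp_growth (fun _ : R => m ^+ 2) by exact: exp_growth_cst.
have gs : exp_growth (fun x : R => x ^+ 2 + (- 2 * m) * x) by exact: exp_growthD.
have -> : Ex affine_law (fun x => x ^+ 2) - m ^+ 2 =
    Ex affine_law (fun x => x ^+ 2 + (- 2 * m) * x + m ^+ 2).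
  by rewrite ExD// ExD// ExZ// Ex_cst -/m; ring.
rewrite -ExZ//; last exact: exp_growthD.
rewrite Ex_affine_law; last by apply: exp_growthZ; exact: exp_growthD.
rewrite /variance covariance.unlock expectation_affine -/m.
congr (fine 'E_P[_]); apply/funext => w /=.
by rewrite !fctE/= affine_imageK; ring.
Qed.

(** The mean and variance of X are b m + a and b^2 v, with m and v those of the affine image; so [a]
    and [b] drop out and only the evaluation point changes. *)
Lemma cdf_standardized (x : R) : 0 < b ->
  0 < Ex affine_law (fun x => x ^+ 2) - Ex affine_law id ^+ 2 ->
  cdf (standardized_RV X) x = affine_law `]-oo,
    x * Num.sqrt (Ex affine_law (fun x => x ^+ 2) - Ex affine_law id ^+ 2) +
    Ex affine_law id]%classic.
Proof.
move=> bp vp; rewrite /cdf /affine_law /distribution /pushforward.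
congr (P _); apply/funext => w; rewrite /preimage/=; apply/propext.
rewrite /standardized !in_itv/= variance_affine expectation_affine.
set m := Ex _ id; set v := _ - m ^+ 2 in vp *.
rewrite sqrtrM ?exprn_ge0 ?(ltW bp)// sqrtr_sqr (ger0_norm (ltW bp)).
have sv : 0 < Num.sqrt v by rewrite sqrtr_gt0.
rewrite [X in X - _]affine_imageK ler_pdivrMr ?mulr_gt0//.
rewrite (_ : _ - _ = b * (affine_image w - m)); last by ring.
by rewrite mulrCA ler_pM2l// lerBlDr.
Qed.

End affine_image.

(** The first two moments of (X - a) / b tend to 0 and 1, so the moved point of [cdf_standardized]
    tends to x and [curtiss] applies. *)
Theorem standardized_normal_limit (R : realType) (d : nat -> measure_display)
  (Om : forall n, measurableType (d n)) (P : forall n, probability (Om n) R)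
  (X : forall n, {RV (P n) >-> R}) (a b : nat -> R) :
  (forall n, exists M : R, forall w, `|X n w| <= M) ->
  (\forall n \near \oo, 0 < b n) ->
  (forall s : R, fine 'E_(P n)[(fun w => expR (s * ((X n w - a n) / b n)))] @[n --> \oo] -->
     expR (s ^+ 2 / 2)) ->
  cvg_in_distribution (fun n => standardized_RV (X n)) (normal_prob 0 1).
Proof.
move=> Xb bpos mgf x atom.
pose mu_ n := affine_law (X n) (a n) (b n).
have mexp_ n : exp_integrable (mu_ n) by exact: exp_integrable_affine_law.
have nexp := @exp_integrable_normal R.
have mgfc s : Ex_cvg mu_ (normal_prob 0 1) (fun x => expR (s * x)).
  split; first exact: exp_growth_expR.
  have E n : Ex (mu_ n) (fun x => expR (s * x)) =
      fine 'E_(P n)[(fun w => expR (s * ((X n w - a n) / b n)))].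
    by rewrite Ex_affine_law//; exact: exp_growth_expR.
  by rewrite Ex_normal_expR (eq_cvg _ _ E); exact: mgf.
have gid := @exp_growth_id R.
have [_ c1] : Ex_cvg mu_ (normal_prob 0 1) (fun x => x).
  by apply: Ex_cvg_ext (Ex_cvg_power mexp_ nexp mgfc 1) => y; rewrite expr1.
have [_ c2] := Ex_cvg_power mexp_ nexp mgfc 2.
rewrite Ex_normal_id in c1; rewrite Ex_normal_sqr in c2.
pose v n := Ex (mu_ n) (fun x => x ^+ 2) - Ex (mu_ n) id ^+ 2.
have cv : v n @[n --> \oo] --> (1 : R).
  have -> : v = (fun n => Ex (mu_ n) (fun x => x ^+ 2)) \-
      ((fun n => Ex (mu_ n) id) \* (fun n => Ex (mu_ n) id)).
    by apply/funext => n; rewrite /v expr2.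
  have h := cvgB c2 (cvgM c1 c1); rewrite mulr0 subr0 in h; exact: h.
pose y n := x * Num.sqrt (v n) + Ex (mu_ n) id.
have cy : y n @[n --> \oo] --> x.
  rewrite -[X in _ --> X]addr0; apply: cvgD c1.
  rewrite -[X in _ --> X]mulr1; apply: cvgMr; rewrite -sqrtr1.
  by apply: continuous_cvg cv; exact: sqrt_continuous.
have cF := curtiss mexp_ nexp mgfc atom cy.
rewrite -[X in _ --> X]fineK ?fin_num_measure//; apply: cvg_EFin.
  by apply: nearW => n; rewrite fin_num_measure.
move: cF; apply: cvg_trans; apply: near_eq_cvg; near=> n => /=.
have bn : 0 < b n by near: n.
rewrite (@cdf_standardized _ _ _ _ _ (a n) (b n))// ?gt_eqF//.
have : `|1 - v n| <= 2^-1.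
  by near: n; move/cvgrPdist_le : cv; apply; rewrite invr_gt0.
by rewrite ler_norml -/(mu_ n) -/(v n); lra.
Unshelve. all: by end_near. Qed.

(** * Scaling of t and passage to the limit *)

Section normalization.
Variables (R : realType) (k : nat -> nat).
Hypothesis k_gt0 : forall n, (0 < k n)%N.
Hypothesis k_small : (fun n => (k n)%:R / Num.sqrt n%:R : R) @ \oo --> (0 : R).

(** As 40 <= 7^2, the variance bound gives |t| <= 7 |s| j / sqrt n. Then n |t|^3 / j^2 is at most (7
    |s|)^3 j / sqrt n, of the same order as |t|. *)
Lemma quasi_power_error_le (n j : nat) (s v t : R) : (0 < n)%N -> (0 < j)%N ->
  (40 * j%:R ^+ 2)^-1 <= v -> t = s / Num.sqrt (n%:R * v) ->
  quasi_power_error n j t <=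
    (7 * `|s| + (7 * `|s|) ^+ 3) * (j%:R / Num.sqrt n%:R).
Proof.
move=> n0 j0 vj tE; set q : R := Num.sqrt n%:R.
have q0 : 0 < q by rewrite sqrtr_gt0 ltr0n.
have j0' : (0 : R) < j%:R by rewrite ltr0n.
have v0 : 0 < v by apply: lt_le_trans vj; rewrite invr_gt0 mulr_gt0 ?exprn_gt0.
have sv : (7 * j%:R)^-1 <= Num.sqrt v.
  rewrite -(@ler_pXn2r _ 2)// ?nnegrE ?sqrtr_ge0 ?invr_ge0 ?mulr_ge0 ?(ltW j0')//.
  rewrite sqr_sqrtr ?(ltW v0)// exprVn (le_trans _ vj)//.
  rewrite lef_pV2 ?posrE ?exprn_gt0 ?mulr_gt0 ?exprn_gt0// exprMn ler_wpM2r ?exprn_ge0 ?(ltW j0')//.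
  by lra.
have tle : `|t| <= 7 * `|s| * (j%:R / q).
  rewrite tE normrM normfV (ger0_norm (sqrtr_ge0 _)) sqrtrM ?ler0n// -/q invfM.
  rewrite (_ : 7 * _ * _ = `|s| * (q^-1 * (7 * j%:R))); last by ring.
  rewrite ler_wpM2l// ler_wpM2l ?invr_ge0 ?(ltW q0)//.
  by rewrite -[leRHS]invrK lef_pV2 ?posrE ?sqrtr_gt0 ?invr_gt0 ?mulr_gt0.
rewrite /quasi_power_error mulrDl lerD//.
have t3 : `|t| ^+ 3 <= (7 * `|s| * (j%:R / q)) ^+ 3.
  by rewrite lerXn2r ?nnegrE// (le_trans _ tle).
have nq : n%:R = q ^+ 2 :> R by rewrite sqr_sqrtr.
apply: (@le_trans _ _ (n%:R * (7 * `|s| * (j%:R / q)) ^+ 3 * j%:R^-1 ^+ 2)).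
  by rewrite ler_wpM2r ?exprn_ge0 ?invr_ge0 ?(ltW j0')// ler_wpM2l.
rewrite nq le_eqVlt; apply/orP; left; apply/eqP; field.
by rewrite !gt_eqF.
Qed.

Lemma quasi_power_error_cvg (s : R) (v t : nat -> R) :
  (forall n, (40 * (k n)%:R ^+ 2)^-1 <= v n) ->
  (forall n, t n = s / Num.sqrt (n%:R * v n)) ->
  quasi_power_error n (k n) (t n) @[n --> \oo] --> (0 : R).
Proof.
move=> hv ht; pose C := 7 * `|s| + (7 * `|s|) ^+ 3.
have cC : C * ((k n)%:R / Num.sqrt n%:R) @[n --> \oo] --> (0 : R).
  by rewrite -[X in _ --> X](mulr0 C); exact: cvgMr.
apply: (squeeze_cvgr _ (cvg_cst 0) cC); near=> n.
rewrite quasi_power_error_ge0/=.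
apply: quasi_power_error_le (hv n) (ht n) => //.
by near: n; exact: nbhs_infty_gt.
Unshelve. all: by end_near. Qed.

Lemma near_quasi_power_small (C : R) (s : R) (v t : nat -> R) : 0 < C ->
  (forall n, (40 * (k n)%:R ^+ 2)^-1 <= v n) ->
  (forall n, t n = s / Num.sqrt (n%:R * v n)) ->
  \forall n \near \oo, `|t n| <= 100^-1 /\ C * quasi_power_error n (k n) (t n) <= 1.
Proof.
move=> C0 hv ht; have /cvgrPdist_le cE := quasi_power_error_cvg hv ht.
have d0 : 0 < Num.min (100^-1 : R) C^-1 by rewrite lt_min !invr_gt0 C0 ltr0n.
near=> n.
have : `|0 - quasi_power_error n (k n) (t n)| <= Num.min (100^-1 : R) C^-1.
  by near: n; exact: cE.
rewrite sub0r normrN ger0_norm ?quasi_power_error_ge0// le_min => /andP[h1 h2].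
split; last by rewrite -ler_pdivlMl// mulr1.
apply: le_trans h1; rewrite lerDl mulr_ge0 ?exprn_ge0 ?invr_ge0// mulr_ge0//.
Unshelve. all: by end_near. Qed.

(** The choice of t makes n v t^2 = s^2, so the normalized moment generating function is the
    quasi-power ratio times e^(s^2/2). *)
Lemma normal_limit_of_quasi_power (d : nat -> measure_display)
  (Om : forall n, measurableType (d n)) (P : forall n, probability (Om n) R)
  (X : forall n, {RV (P n) >-> R}) (G : nat -> R -> R) (m v : nat -> R) :
  (forall n, exists M : R, forall w, `|X n w| <= M) ->
  (forall n, (40 * (k n)%:R ^+ 2)^-1 <= v n) ->
  (forall n t, 'E_(P n)[(fun w => expR (t * X n w))] = (G n t)%:E)%E ->
  (forall s (t : nat -> R), (forall n, t n = s / Num.sqrt (n%:R * v n)) ->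
     G n (t n) * expR (- (n%:R * (m n * t n + v n * t n ^+ 2 / 2))) @[n --> \oo]
       --> (1 : R)) ->
  cvg_in_distribution (fun n => standardized_RV (X n)) (normal_prob 0 1).
Proof.
move=> Xb hv EG hG.
have v0 n : 0 < v n.
  by apply: lt_le_trans (hv n); rewrite invr_gt0 mulr_gt0 ?exprn_gt0 ?ltr0n.
apply: (@standardized_normal_limit _ _ _ _ X (fun n => n%:R * m n)
  (fun n => Num.sqrt (n%:R * v n))) => // [|s].
  near=> n; rewrite sqrtr_gt0 mulr_gt0// ltr0n.
  by near: n; exact: nbhs_infty_gt.
pose t n := s / Num.sqrt (n%:R * v n).
have lim := cvgM (hG s t (fun=> erefl)) (cvg_cst (expR (s ^+ 2 / 2))).
rewrite mul1r in lim.
have {}lim : G n (t n) * expR (- (n%:R * (m n * t n + v n * t n ^+ 2 / 2))) *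
  expR (s ^+ 2 / 2) @[n --> \oo] --> expR (s ^+ 2 / 2) by exact: lim.
move: lim; apply: cvg_trans; apply: near_eq_cvg; near=> n.
have n0 : (0 : R) < n%:R by rewrite ltr0n; near: n; exact: nbhs_infty_gt.
have -> : (fun w => expR (s * ((X n w - n%:R * m n) / Num.sqrt (n%:R * v n)))) =
    (fun w => expR (- t n * (n%:R * m n)) * expR (t n * X n w)).
  by apply/funext => w; rewrite -expRD; congr expR; rewrite /t; ring.
have -> : fine 'E_(P n)[(fun w => expR (- t n * (n%:R * m n)) * expR (t n * X n w))]
    = expR (- t n * (n%:R * m n)) * G n (t n).
  have -> : ('E_(P n)[(fun w => (expR (- t n * (n%:R * m n)) * expR (t n * X n w))%R)] =
      (expR (- t n * (n%:R * m n)))%:E * 'E_(P n)[(fun w => expR (t n * X n w))])%E.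
    rewrite unlock; under eq_integral do rewrite EFinM.
    rewrite ge0_integralZl ?lee_fin ?expR_ge0//.
      by apply/measurable_EFinP; apply: measurableT_comp => //; exact: measurable_funM.
  by rewrite EG.
have tE : n%:R * (v n * t n ^+ 2) = s ^+ 2.
  rewrite /t exprMn exprVn sqr_sqrtr; last by rewrite mulr_ge0 ?(ltW n0) ?(ltW (v0 n)).
  by field; rewrite !gt_eqF ?v0.
rewrite -mulrA -expRD mulrC; congr (expR _ * _).
by rewrite -tE; ring.
Unshelve. all: by end_near. Qed.

Lemma bst_quasi_power_cvg (F : nat -> R -> nat -> R) (s : R) (t : nat -> R) :
  (forall n u, F n u 0%N = 1) ->
  (forall n u j, F n u j.+1 * j.+1%:R = \sum_(i < j.+1) F n u i * F n u (j - i)%N +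
     (k n)%:R * (expR u - 1) * (j.+1 == k n)%:R) ->
  (forall n, t n = s / Num.sqrt (n%:R * bst_variance R (k n))) ->
  F n (t n) n * expR (- (n%:R * (bst_mean R (k n) * t n +
    bst_variance R (k n) * t n ^+ 2 / 2))) @[n --> \oo] --> (1 : R).
Proof.
move=> F0 FS ht; have [C [C0 hC]] := bst_quasi_power R.
have hv n := bst_variance_ge R (k_gt0 n).
have small := near_quasi_power_small C0 hv ht.
have cE : C * quasi_power_error n (k n) (t n) @[n --> \oo] --> (0 : R).
  by rewrite -[X in _ --> X](mulr0 C); apply: cvgMr; exact: quasi_power_error_cvg hv ht.
apply/cvgrPdist_le => e e0; near=> n.
have [t1 Cw] : `|t n| <= 100^-1 /\ C * quasi_power_error n (k n) (t n) <= 1 by near: n.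
have n2 : (2 <= n)%N by near: n; exact: nbhs_infty_ge.
have := hC (k n) n _ (t n) (k_gt0 n) n2 (F0 n (t n)) (FS n (t n)) t1 Cw.
rewrite -expRM_natl mulrN distrC => /le_trans; apply.
have : `|0 - C * quasi_power_error n (k n) (t n)| <= e.
  by near: n; move/cvgrPdist_le : cE; apply.
by rewrite sub0r normrN; apply: le_trans; exact: ler_norm.
Unshelve. all: by end_near. Qed.

(** The index is n - 1 but the centring uses n; the missing factor [expR (- eta n)] tends to 1. *)
Lemma rrt_quasi_power_cvg (F : nat -> R -> nat -> R) (s : R) (t : nat -> R) :
  (forall n u, F n u 0%N = 1) ->
  (forall n u j, F n u j.+1 * j.+1%:R = \sum_(i < j.+1) F n u i * F n u (j - i)%N +
     (expR u - 1) * (if (j.+1 < k n)%N then 0 else F n u (j.+1 - k n)%N)) ->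
  (forall n, t n = s / Num.sqrt (n%:R * rrt_variance R (k n))) ->
  F n (t n) n.-1 * expR (- (n%:R * (rrt_mean R (k n) * t n +
    rrt_variance R (k n) * t n ^+ 2 / 2))) @[n --> \oo] --> (1 : R).
Proof.
move=> F0 FS ht; have [C [C0 hC]] := rrt_quasi_power R.
have hv n := rrt_variance_ge R (k_gt0 n).
have small := near_quasi_power_small C0 hv ht.
have cE := quasi_power_error_cvg hv ht.
pose eta n := rrt_mean R (k n) * t n + rrt_variance R (k n) * t n ^+ 2 / 2.
have eta_le n : `|t n| <= 100^-1 -> `|eta n| <= 2 * quasi_power_error n (k n) (t n).
  move=> t1; have k1 : (1 : R) <= (k n)%:R by rewrite ler1n.
  have m1 : 0 <= rrt_mean R (k n) <= 1.
    rewrite /rrt_mean invr_ge0 mulr_ge0 ?addr_ge0//= invf_le1; last by nra.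
    by nra.
  have v1 : 0 <= rrt_variance R (k n) <= 1.
    have D0 : 0 < (k n)%:R * ((k n)%:R + 1) ^+ 2 * (2 * (k n)%:R + 1) :> R.
      by rewrite !mulr_gt0 ?exprn_gt0//; lra.
    rewrite /rrt_variance divr_ge0 ?(ltW D0)//=; last by nra.
    rewrite ler_pdivrMr// mul1r.
    have h1 : 1 <= ((k n)%:R + 1) ^+ 2 :> R by rewrite expr_ge1//; lra.
    have h2 : (k n)%:R * (2 * (k n)%:R + 1) <= ((k n)%:R + 1) ^+ 2 * ((k n)%:R * (2 * (k n)%:R + 1)) :> R.
      by rewrite ler_peMl//; nra.
    by nra.
  have h1 : `|rrt_mean R (k n) * t n| <= 1 * `|t n|.
    by case/andP: m1 => m0 m1; rewrite normrM (ger0_norm m0) ler_wpM2r.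
  have h2 : `|rrt_variance R (k n) * t n ^+ 2 / 2| <= `|t n|.
    case/andP: v1 => v0 v1; rewrite -mulrA normrM (ger0_norm v0).
    rewrite [`|_ / 2|]ger0_norm ?divr_ge0 ?sqr_ge0// -real_normK ?num_real//.
    have := normr_ge0 (t n); move: (`|t n|) t1 => a t1 a0.
    have : rrt_variance R (k n) * (a ^+ 2 / 2) <= 1 * (a ^+ 2 / 2).
      by rewrite ler_wpM2r// divr_ge0 ?sqr_ge0.
    by nra.
  apply: (le_trans (ler_normD _ _)).
  have : 0 <= n%:R * `|t n| ^+ 3 * (k n)%:R^-1 ^+ 2.
    by rewrite mulr_ge0 ?exprn_ge0 ?invr_ge0// mulr_ge0// exprn_ge0.
  by rewrite /quasi_power_error; lra.
have c0 : eta n @[n --> \oo] --> (0 : R).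
  apply/cvgr0Pnorm_le => e e0; near=> n.
  have t1 : `|t n| <= 100^-1.
    have [] : `|t n| <= 100^-1 /\ C * quasi_power_error n (k n) (t n) <= 1 by near: n.
    by [].
  apply: (le_trans (eta_le n t1)).
  have : `|quasi_power_error n (k n) (t n)| <= e / 2.
    by near: n; move/cvgr0Pnorm_le : cE; apply; rewrite divr_gt0.
  by rewrite ger0_norm ?quasi_power_error_ge0//; lra.
have c1 : F n (t n) n.-1 * expR (- eta n) ^+ n.-1 @[n --> \oo] --> (1 : R).
  apply/cvgrPdist_le => e e0; near=> n.
  have [t1 Cw] : `|t n| <= 100^-1 /\ C * quasi_power_error n (k n) (t n) <= 1 by near: n.
  have n3 : (3 <= n)%N by near: n; exact: nbhs_infty_ge.
  have mono : C * quasi_power_error n.-1 (k n) (t n) <= C * quasi_power_error n (k n) (t n).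
    rewrite ler_wpM2l ?(ltW C0)// lerD2l ler_wpM2r ?exprn_ge0 ?invr_ge0//.
    by rewrite ler_wpM2r ?exprn_ge0// ler_nat leq_pred.
  have n2 : (2 <= n.-1)%N by case: (n) n3.
  have := hC (k n) n.-1 _ (t n) (k_gt0 n) n2 (F0 n (t n)) (FS n (t n)) t1 (le_trans mono Cw).
  rewrite distrC => /le_trans; apply; apply: (le_trans mono).
  have : `|quasi_power_error n (k n) (t n)| <= e / C.
    by near: n; move/cvgr0Pnorm_le : cE; apply; rewrite divr_gt0.
  by rewrite ger0_norm ?quasi_power_error_ge0// ler_pdivlMr// mulrC.
have c2 : expR (- eta n) @[n --> \oo] --> (1 : R).
  rewrite -expR0 -oppr0; apply: continuous_cvg; first exact: continuous_expR.
  exact: cvgN.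
have lim := cvgM c1 c2; rewrite mulr1 in lim.
have {}lim : F n (t n) n.-1 * expR (- eta n) ^+ n.-1 * expR (- eta n) @[n --> \oo] --> (1 : R).
  exact: lim.
move: lim; apply: cvg_trans; apply: near_eq_cvg; near=> n.
have n0 : (0 < n)%N by near: n; exact: nbhs_infty_gt.
rewrite -mulrA -exprSr prednK// -expRM_natl mulrN.
by rewrite /eta.
Unshelve. all: by end_near. Qed.

End normalization.

(** * Binary search trees *)

Section permutation_sums.
Variable R : comPzRingType.
Implicit Types (A s : seq nat) (f g : seq nat -> R) (p : pred nat).

Definition perm_sum A f : R := \sum_(s <- permutations A) f s.

Lemma perm_sum_nil f : perm_sum [::] f = f [::].
Proof. by rewrite /perm_sum big_seq1. Qed.

Lemma perm_sum_rec A f : uniq A -> (0 < size A)%N ->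
  perm_sum A f = \sum_(x <- A) perm_sum (rem x A) (fun s => f (x :: s)).
Proof.
move=> uA A0; rewrite /perm_sum (perm_big _ (permutationsE A0)) undup_id//.
by rewrite big_allpairs_dep.
Qed.

Lemma eq_perm_sum A f g : (forall s, perm_eq s A -> f s = g s) ->
  perm_sum A f = perm_sum A g.
Proof.
move=> fg; rewrite /perm_sum [LHS]big_seq_cond [RHS]big_seq_cond.
by apply: eq_bigr => s /andP[]; rewrite mem_permutations => /fg.
Qed.

Lemma perm_sumZ A (a : R) f : perm_sum A (fun s => a * f s) = a * perm_sum A f.
Proof. by rewrite /perm_sum mulr_sumr. Qed.

Lemma filter_rem p x A : uniq A ->
  [seq y <- rem x A | p y] =
  if p x then rem x [seq y <- A | p y] else [seq y <- A | p y].
Proof.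
move=> uA; rewrite rem_filter// -filter_predI; case: ifPn => px.
  by rewrite rem_filter ?filter_uniq// -filter_predI; apply: eq_filter => y /=; rewrite andbC.
apply: eq_filter => y /=; case: eqP => [->|_]; last by rewrite andbT.
by rewrite (negbTE px).
Qed.

(** A permutation of A interleaves a permutation of its p-part with one of the rest, and the
    binomial counts interleavings. Splitting off the first element gives Pascal's rule, with
    indicators guarding the case of an empty part. *)
Lemma perm_sum_shuffle A p f g : uniq A ->
  perm_sum A (fun s => f [seq x <- s | p x] * g [seq x <- s | ~~ p x]) =
  'C(size A, count p A)%:R * perm_sum [seq x <- A | p x] f *
    perm_sum [seq x <- A | ~~ p x] g.
Proof.
move: {2}(size A) (erefl (size A)) => n nA; elim: n A nA f g => [|n IH] A nA f g uA.
  by rewrite (size0nil nA) !perm_sum_nil /= mul1r.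
rewrite perm_sum_rec// ?nA//.
have sr x : x \in A -> size (rem x A) = n by move=> xA; rewrite size_rem// nA.
have cA : (count p A + count (predC p) A = n.+1)%N by rewrite count_predC nA.
have crem x : x \in A -> count p (rem x A) = (count p A - p x)%N.
  by move=> xA; rewrite count_rem xA.
set a := count p A in cA crem *; set b := count (predC p) A in cA *.
have inP x : x \in A -> p x -> perm_sum (rem x A)
    (fun s => f [seq y <- x :: s | p y] * g [seq y <- x :: s | ~~ p y]) =
    'C(n, a.-1)%:R * perm_sum [seq y <- A | ~~ p y] g *
    perm_sum (rem x [seq y <- A | p y]) (fun s => f (x :: s)).
  move=> xA px; have := IH _ (sr x xA) (fun s => f (x :: s)) g (rem_uniq _ uA).
  rewrite sr// crem// !filter_rem// px/= subn1 => hx.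
  by rewrite px -[RHS]mulrA [X in _ * X]mulrC mulrA -hx.
have outP x : x \in A -> ~~ p x -> perm_sum (rem x A)
    (fun s => f [seq y <- x :: s | p y] * g [seq y <- x :: s | ~~ p y]) =
    'C(n, a)%:R * perm_sum [seq y <- A | p y] f *
    perm_sum (rem x [seq y <- A | ~~ p y]) (fun s => g (x :: s)).
  move=> xA px; have := IH _ (sr x xA) f (fun s => g (x :: s)) (rem_uniq _ uA).
  by rewrite sr// crem// !filter_rem// (negbTE px)/= subn0 => <-; rewrite (negbTE px).
rewrite big_seq (bigID p)/=.
under eq_bigr => x /andP[xA px] do rewrite (inP x xA px).
under [X in _ + X]eq_bigr => x /andP[xA px] do rewrite (outP x xA px).
rewrite -!mulr_sumr -!big_seq_cond.
rewrite -[\sum_(i <- A | p i) _]big_filter -[\sum_(i <- A | ~~ p i) _]big_filter.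
have step q h : uniq A -> \sum_(i <- [seq x <- A | q x]) perm_sum (rem i [seq y <- A | q y]) (fun s => h (i :: s)) =
    (0 < count q A)%N%:R * perm_sum [seq y <- A | q y] h.
  move=> _; have [q0|q0] := posnP (count q A).
    by rewrite mul0r (size0nil (s := [seq x <- A | q x])) ?big_nil// size_filter.
  by rewrite mul1r [RHS]perm_sum_rec ?filter_uniq ?size_filter.
rewrite !step// -/a -/b.
rewrite (_ : 'C(n.+1, a)%:R = 'C(n, a.-1)%:R * (0 < a)%N%:R + 'C(n, a)%:R * (0 < b)%N%:R :> R).
  by ring.
rewrite -!natrM -natrD; congr (_%:R).
case: (a) cA => [|a'] cA; first by rewrite muln0 !bin0 -(add0n b) cA.
rewrite binS muln1 addnC; congr (_ + _)%N.
by have [b0|b0] := posnP b; [rewrite bin_small ?mul0n//; lia|rewrite muln1].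
Qed.

(* The ranks of the elements of [A] are 0, ..., size A - 1, each taken once. *)
Lemma sum_ranks A (phi : nat -> R) : uniq A ->
  \sum_(x <- A) phi (count (fun y => (y < x)%N) A) = \sum_(j < size A) phi j.
Proof.
move=> uA; rewrite -(big_map (fun x => count (fun y => (y < x)%N) A) xpredT phi).
rewrite -(big_mkord xpredT phi) /index_iota subn0; apply: perm_big.
set r := map _ A.
have count_lt x y : x \in A -> (x < y)%N ->
    (count (fun z => (z < x)%N) A < count (fun z => (z < y)%N) A)%N.
  move=> xA xy; have := count_predUI (fun z => (z < x)%N) (pred1 x) A.
  rewrite (_ : count (predI _ _) A = 0%N); last first.
    apply/eqP; rewrite -leqn0 leqNgt -has_count; apply/hasPn => z _ /=.
    by apply/negP => /andP[zx /eqP zE]; rewrite zE ltnn in zx.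
  rewrite addn0 (count_uniq_mem _ uA) xA addn1 => <-.
  by apply: sub_count => z /= /orP[zx|/eqP ->//]; exact: ltn_trans xy.
have ur : uniq r.
  rewrite map_inj_in_uniq// => x y xA yA rxy.
  have [xy|yx|//] := ltngtP x y.
    by have := count_lt _ _ xA xy; rewrite rxy ltnn.
  by have := count_lt _ _ yA yx; rewrite rxy ltnn.
have sub : {subset r <= iota 0 (size A)}.
  move=> _ /mapP[x xA ->]; rewrite mem_iota/= add0n.
  have := count_lt _ (\max_(y <- x :: A) y).+1 xA.
  rewrite ltnS leq_bigmax_seq ?mem_head// => /(_ isT)/leq_trans; apply.
  exact: count_size.
have sz : (size (iota 0 (size A)) <= size r)%N by rewrite size_iota size_map.
by apply: uniq_perm (uniq_min_size ur sub sz).2 => //; exact: iota_uniq.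
Qed.

End permutation_sums.

Section bst_recursion.
Variable R : realFieldType.
Variables (k : nat) (z : R).

Lemma bst_of_seq_cons x s : bst_of_seq (x :: s) =
  Node (bst_of_seq [seq y <- s | (y < x)%N]) x
       (bst_of_seq [seq y <- s | ~~ (y < x)%N]).
Proof.
rewrite /bst_of_seq/=.
suff : forall l r, foldl bst_insert (Node l x r) s =
    Node (foldl bst_insert l [seq y <- s | (y < x)%N]) x
         (foldl bst_insert r [seq y <- s | ~~ (y < x)%N]) by apply.
by elim: s => //= y s IH l r; case: ifP => _ /=; rewrite IH.
Qed.

Lemma bt_size_bst s : bt_size (bst_of_seq s) = size s.
Proof.
move: {2}(size s) (leqnn (size s)) => n; elim: n s => [|n IH] [|x s]//=.
rewrite ltnS => sn; rewrite bst_of_seq_cons/= !IH ?size_filter.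
- by rewrite count_predC.
- by rewrite (leq_trans (count_size _ _)).
- by rewrite (leq_trans (count_size _ _)).
Qed.

Definition bst_weight (s : seq nat) : R := z ^+ bt_subtrees k (bst_of_seq s).

Lemma bst_weight_cons x s : bst_weight (x :: s) = z ^+ ((size s).+1 == k) *
  (bst_weight [seq y <- s | (y < x)%N] * bst_weight [seq y <- s | ~~ (y < x)%N]).
Proof.
rewrite /bst_weight bst_of_seq_cons/= -!exprD !bt_size_bst !size_filter.
by rewrite count_predC addnA.
Qed.

Definition bst_gf n : R := perm_sum (iota 0 n) bst_weight / n`!%:R.

Let perm_sum_bst_step n A : size A = n -> uniq A -> (0 < n)%N ->
  (forall B, (size B < n)%N -> uniq B ->
    perm_sum B bst_weight = (size B)`!%:R * bst_gf (size B)) ->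
  perm_sum A bst_weight = \sum_(j < n) z ^+ (n == k) *
    ('C(n.-1, j)%:R * (j`!%:R * bst_gf j) *
      ((n.-1 - j)`!%:R * bst_gf (n.-1 - j)%N)).
Proof.
move=> nA uA n0 IH; rewrite perm_sum_rec ?nA//.
rewrite -[in RHS]nA -(sum_ranks (fun j => z ^+ (size A == k) * ('C((size A).-1, j)%:R *
  (j`!%:R * bst_gf j) * (((size A).-1 - j)`!%:R * bst_gf ((size A).-1 - j)%N))) uA) nA.
apply: eq_big_seq => x xA; have sr : size (rem x A) = n.-1 by rewrite size_rem// nA.
have uR := rem_uniq x uA.
transitivity (perm_sum (rem x A) (fun s => z ^+ (n == k) *
    (bst_weight [seq y <- s | (y < x)%N] * bst_weight [seq y <- s | ~~ (y < x)%N]))).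
  apply: eq_perm_sum => s /perm_size ss.
  by rewrite bst_weight_cons ss sr prednK.
rewrite perm_sumZ perm_sum_shuffle// sr.
set p := fun y => (y < x)%N.
have cE : count p (rem x A) = count p A by rewrite count_rem xA /p ltnn subn0.
have cle : (count p A <= n.-1)%N by rewrite -cE -sr count_size.
have cC : count (predC p) (rem x A) = (n.-1 - count p A)%N.
  by rewrite -cE -sr -(count_predC p (rem x A)) addKn.
rewrite !IH ?filter_uniq// ?size_filter ?cE ?cC//.
- by rewrite (leq_ltn_trans (leq_subr _ _))// ltn_predL.
- by rewrite (leq_ltn_trans cle)// ltn_predL.
Qed.

(** Only the relative order of the keys matters. Arbitrary duplicate-free lists are needed because
    the keys sent to a right subtree are not an initial segment. *)
Lemma perm_sum_bst A : uniq A ->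
  perm_sum A bst_weight = (size A)`!%:R * bst_gf (size A).
Proof.
move: {2}(size A) (erefl (size A)) => n; elim/ltn_ind: n A => n IH A nA uA.
have fact0 m : (m`!%:R : R) != 0 by rewrite pnatr_eq0 -lt0n fact_gt0.
have IH' B : (size B < n)%N -> uniq B ->
    perm_sum B bst_weight = (size B)`!%:R * bst_gf (size B).
  by move=> sB uB; exact: (IH (size B)).
rewrite nA /bst_gf [RHS]mulrC divfK//.
have [n0|n0] := posnP n.
  by rewrite n0 in nA *; rewrite (size0nil nA).
by rewrite !(@perm_sum_bst_step n)// ?size_iota ?iota_uniq.
Qed.

Lemma bst_gf0 : bst_gf 0 = 1.
Proof. by rewrite /bst_gf perm_sum_nil /bst_weight/= expr0 divr1. Qed.

Lemma bst_gf_rec_product m : bst_gf m.+1 * m.+1%:R =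
  z ^+ (m.+1 == k) * \sum_(j < m.+1) bst_gf j * bst_gf (m - j)%N.
Proof.
have fact0 i : (i`!%:R : R) != 0 by rewrite pnatr_eq0 -lt0n fact_gt0.
apply: (mulIf (fact0 m)); rewrite -mulrA -natrM -factS mulrC.
have := perm_sum_bst (iota_uniq 0 m.+1); rewrite size_iota => <-.
rewrite (@perm_sum_bst_step m.+1) ?size_iota ?iota_uniq//; last first.
  by move=> B _ uB; exact: perm_sum_bst.
rewrite -mulr_sumr -mulrA; congr (_ * _); rewrite mulr_suml.
apply: eq_bigr => j _ /=; have jm : (j <= m)%N by rewrite -ltnS.
by rewrite -(bin_fact jm) !natrM; ring.
Qed.

Hypothesis k_gt0 : (0 < k)%N.

Lemma bst_gf1 m : (m < k)%N -> bst_gf m = 1.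
Proof.
elim/ltn_ind: m => -[|m] IH mk; first exact: bst_gf0.
have m0 : (m.+1%:R : R) != 0 by rewrite pnatr_eq0.
apply: (mulIf m0); rewrite bst_gf_rec_product ltn_eqF// expr0 !mul1r.
rewrite (eq_bigr (fun=> 1)) => [|j _].
  by rewrite sumr_const card_ord.
by have jm := ltn_ord j; rewrite !IH ?mulr1//; lia.
Qed.

(** The product form differs only at m + 1 = k, where all smaller values are 1 and the sum is k;
    there z k = k + k (z - 1), so the multiplicative factor becomes an additive term. *)
Lemma bst_gf_rec m : bst_gf m.+1 * m.+1%:R =
  \sum_(j < m.+1) bst_gf j * bst_gf (m - j)%N + k%:R * (z - 1) * (m.+1 == k)%:R.
Proof.
rewrite bst_gf_rec_product; case: eqP => mk; last by rewrite expr0 mul1r mulr0 addr0.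
rewrite expr1 mulr1.
have -> : \sum_(j < m.+1) bst_gf j * bst_gf (m - j)%N = k%:R.
  rewrite (eq_bigr (fun=> 1)) => [|j _]; first by rewrite sumr_const card_ord mk.
  by have jm := ltn_ord j; rewrite !bst_gf1 ?mulr1//; lia.
by ring.
Qed.

Lemma sum_perm_bst n :
  \sum_(s : {perm 'I_n}) z ^+ bt_subtrees k (bst_of_perm s) = n`!%:R * bst_gf n.
Proof.
pose phi (s : {perm 'I_n}) := [seq (s i).+1 | i <- enum 'I_n].
have phi_inj : injective phi.
  move=> s t /eq_in_map st; apply/permP => i; apply/val_inj.
  by have := st i (mem_enum _ i) => -[].
have phi_perm s : perm_eq (phi s) (iota 1 n).
  rewrite -[1%N]addn0 iotaDl -val_enum_ord -map_comp.
  have -> : phi s = map (addn 1 \o val) (map s (enum 'I_n)).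
    by rewrite -(map_comp (addn 1 \o val) s).
  apply: perm_map; apply: uniq_perm; rewrite ?enum_uniq//.
    by rewrite map_inj_uniq ?enum_uniq//; exact: perm_inj.
  move=> i; rewrite mem_enum; apply/mapP; exists (s^-1%g i).
    by rewrite mem_enum.
  by rewrite permKV.
have := perm_sum_bst (iota_uniq 1 n); rewrite size_iota => <-.
rewrite -[LHS]big_enum -(big_map phi xpredT bst_weight)/=.
apply: perm_big.
have u : uniq (map phi (enum {perm 'I_n})) by rewrite map_inj_uniq ?enum_uniq.
have sub : {subset map phi (enum {perm 'I_n}) <= permutations (iota 1 n)}.
  by move=> _ /mapP[s _ ->]; rewrite mem_permutations phi_perm.
have sz : (size (permutations (iota 1 n)) <= size (map phi (enum {perm 'I_n})))%N.
  rewrite size_permutations ?iota_uniq// size_iota size_map -cardE.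
  by rewrite card_Sn.
apply: uniq_perm (uniq_min_size u sub sz).2 => //; exact: permutations_uniq.
Qed.

End bst_recursion.

(** * Recursive trees *)

Lemma sum_triangle (R : nmodType) n (F : nat -> nat -> R) :
  \sum_(s < n.+1) \sum_(t < (n - s).+1) F s t =
  \sum_(u < n.+1) \sum_(s < u.+1) F s (u - s)%N.
Proof.
rewrite (exchange_triangle _ (fun u s => F s (u - s)%N)).
apply: eq_bigr => s _; have sn : (s <= n)%N by rewrite -ltnS.
by rewrite (sum_ord_shift (F s)) ?subSn// ltnW.
Qed.

Lemma sum_triangle_exchange (R : nmodType) n (F : nat -> nat -> R) :
  \sum_(s < n.+1) \sum_(t < (n - s).+1) F s t =
  \sum_(t < n.+1) \sum_(s < (n - t).+1) F s t.
Proof.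
rewrite !sum_triangle (sum_triangle n (fun t s => F s t)).
apply: eq_bigr => u _; rewrite (reindex_inj rev_ord_inj)/=.
by apply: eq_bigr => s _; rewrite subSS subKn// -ltnS.
Qed.

Section coalescent.
Variables (R : realFieldType) (psi H : nat -> R).
Implicit Types (w : nat -> nat) (f : (nat -> nat) -> R).

Definition upd w i s : nat -> nat := fun x => if x == i then s else w x.
Definition add_at w j s : nat -> nat := fun x => (w x + (x == j) * s)%N.

(* [comp_sum i n f] sums f over all i-part compositions w of n, with weight
   prod_j H (w j). *)
Fixpoint comp_sum i n f : R :=
  if i is i'.+1 then
    \sum_(s < n.+1) H s * comp_sum i' (n - s)%N (fun w => f (upd w i' s))
  else (n == 0%N)%:R * f (fun=> 0%N).

(* Nodes are processed from the last one down: node n passes the size of its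
   completed subtree on to a parent chosen among 0, ..., n-1. *)
Fixpoint tree_sum n w : R :=
  if n is n'.+1 then
    psi (w n') * (if n' is 0 then 1 else \sum_(j < n') tree_sum n' (add_at w j (w n')))
  else 1.

Lemma eq_tree_sum n w w' : (forall x, (x < n)%N -> w x = w' x) ->
  tree_sum n w = tree_sum n w'.
Proof.
elim: n w w' => [|n IH] w w' ww' //=; rewrite ww'//; congr (_ * _).
case: n IH ww' => // n IH ww'; apply: eq_bigr => j _; apply: IH => x xn.
by rewrite /add_at !ww'// ltnW.
Qed.

Lemma eq_comp_sum i n f g : f =1 g -> comp_sum i n f = comp_sum i n g.
Proof. by move=> /funext ->. Qed.

Lemma comp_sumD i n f g :
  comp_sum i n (fun w => f w + g w) = comp_sum i n f + comp_sum i n g.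
Proof.
elim: i n f g => [|i IH] n f g /=; first by rewrite mulrDr.
by rewrite -big_split; apply: eq_bigr => s _; rewrite IH mulrDr.
Qed.

Lemma comp_sumZ i n (a : R) f : comp_sum i n (fun w => a * f w) = a * comp_sum i n f.
Proof.
elim: i n f => [|i IH] n f /=; first by rewrite mulrCA.
by rewrite mulr_sumr; apply: eq_bigr => s _; rewrite IH mulrCA.
Qed.

Hypothesis H0 : H 0%N = 0.
Hypothesis H1 : H 1%N = 1.
Hypothesis H_rec : forall u,
  \sum_(s < u.+1) (psi s * H s) * H (u - s)%N = (u%:R - 1) * H u.

(** By [H_rec], splitting a piece off a part of size u in all ways multiplies its weight by u - 1,
    and over the i parts of n these factors add up to n - i. In the induction the last part gives u
    - 1 and the others n - u - i. *)
Lemma comp_sum_merge i n f :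
  \sum_(s < n.+1) (psi s * H s) *
    comp_sum i (n - s)%N (fun w => \sum_(j < i) f (add_at w j s)) =
  (n%:R - i%:R) * comp_sum i n f.
Proof.
elim: i n f => [|i IH] n f.
  rewrite big1 => [|s _]; last by rewrite /= big_ord0 !mulr0.
  by rewrite subr0 /=; case: eqP => [->|_]; rewrite !mul0r// mulr0.
have split_last s t w : \sum_(j < i.+1) f (add_at (upd w i t) j s) =
    f (upd w i (t + s)%N) + \sum_(j < i) f (upd (add_at w j s) i t).
  rewrite big_ord_recr/= addrC; congr (f _ + _).
    apply/funext => x; rewrite /add_at /upd; case: eqP => _; first by rewrite mul1n.
    by rewrite mul0n addn0.
  apply: eq_bigr => j _; congr f; apply/funext => x; rewrite /add_at /upd.
  by case: eqP => // ->; rewrite gtn_eqF// mul0n addn0.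
have -> : \sum_(s < n.+1) (psi s * H s) *
    comp_sum i.+1 (n - s)%N (fun w => \sum_(j < i.+1) f (add_at w j s)) =
  \sum_(s < n.+1) \sum_(t < (n - s).+1) psi s * H s * H t *
     comp_sum i (n - (t + s))%N (fun w => f (upd w i (t + s)%N)) +
  \sum_(s < n.+1) \sum_(t < (n - s).+1) psi s * H s * H t *
     comp_sum i (n - t - s)%N (fun w => \sum_(j < i) f (upd (add_at w j s) i t)).
  rewrite -big_split; apply: eq_bigr => s _ /=; rewrite -big_split mulr_sumr.
  apply: eq_bigr => t _ /=; rewrite mulrA -mulrDr; congr (_ * _).
  rewrite [(n - s - t)%N]subnAC subnDA -comp_sumD; apply: eq_comp_sum => w.
  exact: split_last.
rewrite (sum_triangle n (fun s t => psi s * H s * H t *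
     comp_sum i (n - (t + s))%N (fun w => f (upd w i (t + s)%N)))).
rewrite (sum_triangle_exchange n (fun s t => psi s * H s * H t *
     comp_sum i (n - t - s)%N (fun w => \sum_(j < i) f (upd (add_at w j s) i t)))).
rewrite -big_split /= mulr_sumr; apply: eq_bigr => u _ /=.
have un : (u <= n)%N by rewrite -ltnS.
have -> : \sum_(s < u.+1) psi s * H s * H (u - s)%N *
    comp_sum i (n - (u - s + s))%N (fun w => f (upd w i (u - s + s)%N)) =
    (u%:R - 1) * H u * comp_sum i (n - u)%N (fun w => f (upd w i u)).
  rewrite -H_rec mulr_suml; apply: eq_bigr => s _.
  by rewrite subnK// -ltnS.
have -> : \sum_(s < (n - u).+1) psi s * H s * H u *
    comp_sum i (n - u - s)%N (fun w => \sum_(j < i) f (upd (add_at w j s) i u)) =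
    H u * (((n - u)%:R - i%:R) * comp_sum i (n - u)%N (fun w => f (upd w i u))).
  rewrite -(IH (n - u)%N (fun w => f (upd w i u))) mulr_sumr.
  by apply: eq_bigr => s _; ring.
by rewrite natrB// -[i.+1%:R]natr1; ring.
Qed.

Lemma comp_sum_step i n : (0 < i)%N ->
  comp_sum i.+1 n (tree_sum i.+1) = (n%:R - i%:R) * comp_sum i n (tree_sum i).
Proof.
move=> i0; rewrite -comp_sum_merge /=; apply: eq_bigr => s _.
rewrite [psi s * H s]mulrC -mulrA -(comp_sumZ _ _ (psi s)).
congr (_ * _); apply: eq_comp_sum => w.
have -> : upd w i s i = s by rewrite /upd eqxx.
congr (_ * _); case: (i) i0 => // j _.
apply: eq_bigr => x _; apply: eq_tree_sum => y yj.
by rewrite /add_at /upd ltn_eqF.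
Qed.

Lemma comp_sum_lt i n f : (n < i)%N -> comp_sum i n f = 0.
Proof.
elim: i n f => // i IH n f ni /=; apply: big1 => -[[|s] sn] _ /=.
  by rewrite H0 mul0r.
by rewrite IH ?mulr0//; lia.
Qed.

Lemma comp_sum_diag n f : comp_sum n n f = f (fun x => (x < n)%N : nat).
Proof.
elim: n f => [|n IH] f; first by rewrite /= mul1r.
rewrite /= big_ord_recl/= H0 mul0r add0r big_ord_recl/= H1 mul1r.
rewrite big1 ?addr0 => [|s _]; last first.
  by rewrite comp_sum_lt ?mulr0//= /bump/= !add1n; have := ltn_ord s; lia.
rewrite subSS subn0 IH; congr f; apply/funext => x; rewrite /upd [in RHS]ltnS [in RHS]leq_eqVlt.
by case: eqP.
Qed.

(** [comp_sum_step] telescopes from n parts, where all ones is the only composition of nonzero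
    weight, down to a single part, collecting (n - 1)!. *)
Theorem tree_sum_ones n : (0 < n)%N ->
  tree_sum n (fun=> 1%N) = (n.-1)`!%:R * (psi n * H n).
Proof.
case: n => // n _.
have : forall i, (0 < i <= n.+1)%N ->
    comp_sum i n.+1 (tree_sum i) * (n.+1 - i)`!%:R = n`!%:R * (psi n.+1 * H n.+1).
  elim=> // i IH; rewrite ltnS => i_n.
  case: i IH i_n => [_ _|i IH i_n].
    rewrite subSS subn0 [LHS]mulrC; congr (_ * _); rewrite /= (bigD1 ord_max)//= big1.
      by rewrite subnn eqxx /upd eqxx mulr1n; ring.
    move=> [s /= sn]; rewrite -val_eqE/= => s_n.
    by rewrite (_ : (n.+1 - s == 0)%N = false) ?mul0r ?mulr0//; lia.
  rewrite comp_sum_step// -IH; last by lia.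
  rewrite (_ : (n.+1 - i.+1)%N = (n.+1 - i.+2).+1); last by lia.
  rewrite factS natrM -natrB; last by lia.
  by rewrite (_ : (n.+1 - i.+1)%N = (n.+1 - i.+2).+1); [ring|lia].
move=> /(_ n.+1); rewrite leqnn subnn mulr1 comp_sum_diag => /(_ isT) <-.
by apply: eq_tree_sum => x ->.
Qed.

End coalescent.

Section rrt_series.
Variables (R : realFieldType) (k : nat) (z : R).
Hypothesis k_gt0 : (0 < k)%N.

Definition rrt_next (l : seq R) : R :=
  let m := (size l).-1 in
  (\sum_(j < m.+1) l`_j * l`_(m - j) +
   (z - 1) * (if (m.+1 < k)%N then 0 else l`_(m.+1 - k))) / m.+1%:R.

Fixpoint rrt_prefix m : seq R :=
  if m is m'.+1 then rcons (rrt_prefix m') (rrt_next (rrt_prefix m')) else [:: 1].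

(** Defined by the recurrence alone; the link with trees is made by [tree_sum_ones]. *)
Definition rrt_gf m : R := (rrt_prefix m)`_m.

Lemma size_rrt_prefix m : size (rrt_prefix m) = m.+1.
Proof. by elim: m => //= m IH; rewrite size_rcons IH. Qed.

Lemma nth_rrt_prefix m j : (j <= m)%N -> (rrt_prefix m)`_j = rrt_gf j.
Proof.
elim: m => [|m IH]; first by case: j.
rewrite leq_eqVlt => /predU1P[->//|jm].
by rewrite /= nth_rcons size_rrt_prefix jm IH.
Qed.

Lemma rrt_gf0 : rrt_gf 0 = 1. Proof. by []. Qed.

Lemma rrt_gf_rec m : rrt_gf m.+1 * m.+1%:R =
  \sum_(j < m.+1) rrt_gf j * rrt_gf (m - j)%N +
  (z - 1) * (if (m.+1 < k)%N then 0 else rrt_gf (m.+1 - k)%N).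
Proof.
rewrite {1}/rrt_gf /= nth_rcons size_rrt_prefix ltnn eqxx /rrt_next size_rrt_prefix /=.
rewrite divfK ?pnatr_eq0//; congr (_ + _ * _).
  by apply: eq_bigr => j _; rewrite !nth_rrt_prefix ?leq_subr// -ltnS.
by case: ltnP => // km; rewrite nth_rrt_prefix//; lia.
Qed.

Lemma rrt_gf1 m : (m < k)%N -> rrt_gf m = 1.
Proof.
elim/ltn_ind: m => -[|m] IH mk; first exact: rrt_gf0.
have m0 : (m.+1%:R : R) != 0 by rewrite pnatr_eq0.
apply: (mulIf m0); rewrite rrt_gf_rec mk mulr0 addr0 mul1r.
rewrite (eq_bigr (fun=> 1)) => [|j _]; first by rewrite sumr_const card_ord.
by have jm := ltn_ord j; rewrite !IH ?mulr1//; lia.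
Qed.

Definition rrt_coef n : R := if n is n'.+1 then rrt_gf n' else 0.

(** Writing z^(s == k) as 1 + (z - 1) [s = k] leaves one extra product, with the factor [rrt_coef k]
    = 1. The extra term is therefore linear, as in a Bernoulli equation. *)
Lemma rrt_coef_rec u :
  \sum_(s < u.+1) (z ^+ (s == k :> nat) * rrt_coef s) * rrt_coef (u - s)%N =
  (u%:R - 1) * rrt_coef u.
Proof.
case: u => [|[|m]]; first by rewrite big_ord1 /= !mulr0.
  by rewrite !big_ord_recr big_ord0/= !(mulr0, mul0r) subrr mul0r !addr0.
rewrite big_ord_recl/= mulr0 mul0r add0r big_ord_recr/= subnn mulr0 addr0.
rewrite -[m.+2%:R]natr1 addrK mulrC rrt_gf_rec.
have zE s : z ^+ (s == k) = 1 + (z - 1) * (s == k)%:R.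
  by case: eqP => _; rewrite ?expr1 ?expr0 ?mulr1n ?mulr0n; ring.
transitivity (\sum_(i < m.+1) (rrt_gf i * rrt_gf (m - i)%N +
   (z - 1) * ((i.+1 == k)%:R * (rrt_gf i * rrt_gf (m - i)%N)))).
  apply: eq_bigr => i _; rewrite /bump/= add1n add0n zE subSS subSn; last by rewrite -ltnS.
  by rewrite /=; ring.
rewrite big_split/= -mulr_sumr; congr (_ + _ * _).
case: ltnP => mk.
  by rewrite big1// => i _; rewrite ltn_eqF ?mul0r// (leq_ltn_trans _ mk).
have km : (k.-1 < m.+1)%N by rewrite prednK.
rewrite (bigD1 (Ordinal km))//= big1 ?addr0 => [|i]; last first.
  rewrite -val_eqE/= => ik; rewrite (_ : (i.+1 == k) = false) ?mul0r//.
  by apply/negbTE; apply: contra ik => /eqP <-.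
rewrite prednK// eqxx mul1r rrt_gf1 ?prednK// mul1r; congr rrt_gf.
by case: (k) k_gt0 mk => // k' _; rewrite subSS.
Qed.

End rrt_series.

(* A code lists the parents of the nodes 0, ..., n-1; the root gets the dummy parent 0. *)
Fixpoint codes n : seq (seq nat) :=
  if n is n'.+1 then [seq rcons c j | c <- codes n', j <- iota 0 (maxn n' 1)]
  else [:: [::]].

Lemma codesP n c : c \in codes n -> size c = n /\ forall i, (0 < i)%N -> (nth 0%N c i < i)%N.
Proof.
elim: n c => [|n IH] c; first by rewrite inE => /eqP ->; split=> // i i0; rewrite nth_nil.
case/allpairsP => -[c' j] /= [/IH[sc hc] + ->]; rewrite mem_iota add0n => /= jn.
split=> [|i i0]; first by rewrite size_rcons sc.
rewrite nth_rcons sc; case: (ltngtP i n) => [_|_|ni]; [exact: hc|by []|].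
by move: jn; rewrite ni; case: (n) ni i0 => [->|m _ _]//; lia.
Qed.

Lemma codes_uniq n : uniq (codes n).
Proof.
elim: n => // n IH; apply: allpairs_uniq => //; first exact: iota_uniq.
by move=> [c j] [c' j'] _ _ /= /rcons_inj[-> ->].
Qed.

Lemma size_codes n : size (codes n.+1) = n`!.
Proof.
elim: n => // n IH; rewrite size_allpairs size_iota IH factS mulnC.
by congr (_ * _)%N; lia.
Qed.

Section reach.
Implicit Types (p : nat -> nat) (c : seq nat).

Fixpoint reach_fuel p m u v : bool :=
  (u == v) || (if m is m'.+1 then (0 < u)%N && reach_fuel p m' (p u) v else false).

(** Fuel [u] is enough when parents carry smaller labels. *)
Definition reach p u v := reach_fuel p u u v.

Lemma reach_fuel_enough p m m' u v : (forall i, (0 < i)%N -> (p i < i)%N) ->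
  (u <= m)%N -> (u <= m')%N -> reach_fuel p m u v = reach_fuel p m' u v.
Proof.
move=> hp; elim: m m' u => [|m IH] [|m'] u //=.
- by rewrite leqn0 => /eqP -> _.
- by move=> _; rewrite leqn0 => /eqP ->.
- move=> um um'; congr (_ || _); have [//|u0] := posnP u.
  by have := hp u u0 => pu /=; apply: IH; lia.
Qed.

Lemma reachE p u v : (forall i, (0 < i)%N -> (p i < i)%N) ->
  reach p u v = (u == v) || ((0 < u)%N && reach p (p u) v).
Proof.
move=> hp; rewrite /reach; case: u => [|u] //=; congr (_ || _).
by have := hp u.+1 isT => pu; apply: reach_fuel_enough.
Qed.

Lemma reach_le p u v : (forall i, (0 < i)%N -> (p i < i)%N) ->
  reach p u v -> (v <= u)%N.
Proof.
move=> hp; elim/ltn_ind: u => u IH; rewrite reachE// => /orP[/eqP ->//|/andP[u0]].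
by move/(IH _ (hp u u0)) => /leq_trans; apply; exact: ltnW (hp u u0).
Qed.

Lemma eq_reach p p' u v : (forall i, (0 < i)%N -> (p i < i)%N) ->
  (forall i, (0 < i)%N -> (p' i < i)%N) ->
  (forall i, (i <= u)%N -> p i = p' i) -> reach p u v = reach p' u v.
Proof.
move=> hp hp'; elim/ltn_ind: u => u IH pp'; rewrite reachE// [RHS]reachE//.
congr (_ || _); have [//|u0] := posnP u; rewrite /= -pp'//.
apply: IH => [|i iu]; first exact: hp.
by apply: pp'; rewrite (leq_trans iu)// ltnW// hp.
Qed.

Lemma connect_reach n p (u v : 'I_n) : (forall i, (0 < i)%N -> (p i < i)%N) ->
  connect (rt_edge (fun i : 'I_n => p i)) u v = reach p u v.
Proof.
move=> hp; apply/idP/idP.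
  case/connectP => s; elim: s u => [|x s IH] u /=.
    by move=> _ ->; rewrite reachE// eqxx.
  case/andP => /andP[u0 /eqP pux] hs vE; rewrite reachE// u0 pux.
  by rewrite IH ?orbT.
move: {2}(val u) (erefl (val u)) => m; elim/ltn_ind: m u => m IH u um.
rewrite reachE// => /orP[/eqP/val_inj ->|/andP[u0 h]]; first exact: connect0.
have pn : (p u < n)%N by rewrite (leq_trans (hp _ u0))// ltnW.
apply: (@connect_trans _ _ (Ordinal pn)).
  by apply: connect1; rewrite /rt_edge/= u0 eqxx.
by apply: (IH (p u)) => //; rewrite -um; exact: hp.
Qed.

End reach.

Section codes_sum.
Variables (R : realFieldType) (psi : nat -> R).
Implicit Types (w : nat -> nat) (c : seq nat).

Definition subtree_weight n c w v := (\sum_(u < n) w u * reach (nth 0%N c) u v)%N.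

Lemma big_codesS n (F : seq nat -> R) :
  \sum_(c <- codes n.+1) F c =
  \sum_(c <- codes n) \sum_(j < maxn n 1) F (rcons c j).
Proof.
rewrite [LHS]big_allpairs_dep; apply: eq_bigr => c _.
by rewrite -(big_mkord xpredT (fun j => F (rcons c j))) /index_iota subn0.
Qed.

(** The last node is its own only descendant, and it reaches any other node exactly when its parent
    does; it can be deleted once its weight is added to the parent's. *)
Lemma sum_codes n w : (0 < n)%N ->
  \sum_(c <- codes n) \prod_(v < n) psi (subtree_weight n c w v) = tree_sum psi n w.
Proof.
elim: n w => // n IH w _; rewrite big_codesS.
case: n IH => [_|n IH].
  rewrite [codes 0]/(codes _) big_seq1 (_ : maxn 0 1 = 1%N)// !big_ord1.
  by rewrite /subtree_weight big_ord1 /= muln1 mulr1.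
have -> : tree_sum psi n.+2 w =
    psi (w n.+1) * \sum_(j < n.+1) tree_sum psi n.+1 (add_at w j (w n.+1)) by [].
rewrite (_ : maxn n.+1 1 = n.+1); last by lia.
under [in RHS]eq_bigr do rewrite -IH//.
rewrite [in RHS]exchange_big mulr_sumr [LHS]big_seq [RHS]big_seq.
apply: eq_bigr => c cn; have [sc hc] := codesP cn.
rewrite mulr_sumr; apply: eq_bigr => j _.
have hcj i : (0 < i)%N -> (nth 0%N (rcons c j) i < i)%N.
  move=> i0; rewrite nth_rcons sc; case: (ltngtP i n.+1) => [_|//|->//].
  exact: hc.
have same i : (i <= n)%N -> nth 0%N (rcons c j) i = nth 0%N c i.
  by move=> i_n; rewrite nth_rcons sc ltnS i_n.
have old u v : (u <= n)%N -> reach (nth 0%N (rcons c j)) u v = reach (nth 0%N c) u v.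
  by move=> un; apply: eq_reach => // i iu; apply: same; exact: leq_trans un.
have jn : (j <= n)%N by rewrite -ltnS.
rewrite big_ord_recr [LHS]mulrC; congr (psi _ * _).
  rewrite /subtree_weight big_ord_recr/= big1 => [|u _].
    by rewrite add0n reachE// eqxx muln1.
  case: (boolP (reach _ u n.+1)) => [/(reach_le hcj)|_]; last by rewrite muln0.
  by rewrite leqNgt ltn_ord.
apply: eq_bigr => v _; congr psi; rewrite /subtree_weight big_ord_recr/=.
have -> : reach (nth 0%N (rcons c j)) n.+1 v = reach (nth 0%N c) j v.
  rewrite reachE// gtn_eqF//= nth_rcons sc ltnn eqxx old//.
transitivity (\sum_(u < n.+1) (w u * reach (nth 0%N c) u v +
    (u == j) * w n.+1 * reach (nth 0%N c) u v))%N; last first.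
  by apply: eq_bigr => u _; rewrite /add_at mulnDl.
rewrite big_split/=; congr (_ + _)%N.
  by apply: eq_bigr => u _; rewrite old// -ltnS.
rewrite (bigD1 j)//= eqxx mul1n big1 ?addn0// => u.
by move=> /negbTE ->.
Qed.

End codes_sum.

Lemma expr_rt_subtrees (R : realFieldType) n (p : nat -> nat) k (z : R) :
  (forall i, (0 < i)%N -> (p i < i)%N) ->
  z ^+ rt_subtrees k (fun i : 'I_n => p i) =
  \prod_(v < n) z ^+ ((\sum_(u < n) 1 * reach p u v)%N == k).
Proof.
move=> hp; rewrite prodrXr; congr (z ^+ _).
rewrite /rt_subtrees -sum1_card big_mkcond; apply: eq_bigr => v _.
rewrite inE; have -> : #|rt_subtree (fun i : 'I_n => p i) v| = (\sum_(u < n) 1 * reach p u v)%N.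
  rewrite -sum1_card big_mkcond; apply: eq_bigr => u _.
  by rewrite inE connect_reach// mul1n; case: reach.
by case: (_ == k).
Qed.

Lemma sum_codes_rrt (R : realFieldType) n k (z : R) : (0 < k)%N -> (0 < n)%N ->
  \sum_(c <- codes n) z ^+ rt_subtrees k (fun i : 'I_n => nth 0%N c i) =
  (n.-1)`!%:R * (z ^+ (n == k) * rrt_gf k z n.-1).
Proof.
move=> k0 n0; have := @tree_sum_ones R (fun s => z ^+ (s == k)) (rrt_coef k z) erefl erefl
  (rrt_coef_rec z k0) n n0.
have -> : rrt_coef k z n = rrt_gf k z n.-1 by case: (n) n0.
move=> <-; rewrite -sum_codes//; rewrite [LHS]big_seq [RHS]big_seq.
apply: eq_bigr => c cn; have [sc hc] := codesP cn.
exact: expr_rt_subtrees.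
Qed.

(** * Expectations over the random trees *)

(* By [q_total], [h] lies in [L] almost surely. *)
Section finite_expectation.
Context (R : realType) d (Om : measurableType d) (P : probability Om R).
Variables (T : eqType) (h : Om -> T) (L : seq T) (q : R).
Hypothesis L_uniq : uniq L.
Hypothesis h_meas : forall c, measurable [set w | h w = c].
Hypothesis h_law : forall c, c \in L -> P [set w | h w = c] = q%:E.
Hypothesis q_total : q *+ size L = 1.

Lemma expectation_finite (X : Om -> R) (g : T -> R) : measurable_fun setT X ->
  (forall w, h w \in L -> X w = g (h w)) -> (forall w, 0 <= X w) ->
  ('E_P[X] = (\sum_(c <- L) g c * q)%:E)%E.
Proof.
move=> mX Xg X0; rewrite unlock.
pose F c := [set w | h w = c].
have tF : trivIset [set` L] F by move=> c c' _ _ [w [/= <- <-]].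
pose D := \big[setU/set0]_(c <- L) F c.
have mD : measurable D by apply: bigsetU_measurable => c _; exact: h_meas.
have split_int (Y : Om -> R) : measurable_fun setT Y -> (forall w, 0 <= Y w) ->
    (\int[P]_(w in D) (Y w)%:E = \sum_(c <- L) \int[P]_(w in F c) (Y w)%:E)%E.
  move=> mY Y0; apply: ge0_integral_bigsetU => //.
  - by apply/measurable_EFinP; exact: measurable_funTS.
  - by move=> w _; rewrite lee_fin.
have PD : P D = 1%E.
  have i1 A : measurable A -> (\int[P]_(w in A) (cst (1 : R) w)%:E = P A)%E.
    by move=> mA; rewrite -[RHS]mul1e -integral_cst.
  rewrite -(i1 D)// split_int//.
  rewrite big_seq (eq_bigr (fun=> q%:E)) => [|c cL].
    by rewrite -big_seq sumEFin big_const_seq count_predT iter_addr_0 q_total.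
  by rewrite i1 ?h_law//; exact: h_meas.
have PDC : P (~` D) = 0%E by rewrite probability_setC// PD subee.
have -> : (\int[P]_w (X w)%:E = \int[P]_(w in D) (X w)%:E)%E.
  rewrite -(setUv D) ge0_integral_setU//.
  - rewrite [X in (_ + X)%E]null_set_integral ?adde0//.
      exact: measurableC.
    by apply/measurable_EFinP; exact: measurable_funTS.
  - exact: measurableC.
  - by rewrite setUv; exact/measurable_EFinP.
  - by move=> w _; rewrite lee_fin.
  - by apply/disj_setPCl.
rewrite split_int// -sumEFin big_seq [RHS]big_seq; apply: eq_bigr => c cL.
rewrite (eq_integral (fun=> (g c)%:E)) => [|w]; last first.
  by rewrite inE /F/= => hw; rewrite Xg ?hw.
rewrite integral_cst; last exact: h_meas.
rewrite EFinM; congr (_ * _)%E; exact: h_law.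
Qed.

End finite_expectation.

Lemma bst_count_mgf (R : realType) d (Om : measurableType d) (P : probability Om R)
    n (s : {RV P >-> {perm 'I_n}}) k (t : R) : is_uniform_perm s ->
  ('E_P[(fun w => expR (t * bst_count_RV s k w))] = (bst_gf k (expR t) n)%:E)%E.
Proof.
move=> s_unif.
have total : (n`!%:R^-1 : R) *+ size (enum {perm 'I_n}) = 1.
  by rewrite -cardE card_Sn -[LHS]mulr_natr mulVf// pnatr_eq0 -lt0n fact_gt0.
rewrite (@expectation_finite _ _ _ P _ s (enum {perm 'I_n}) n`!%:R^-1 _ _ _ _ _
  (fun a => expR t ^+ bt_subtrees k (bst_of_perm a))) ?enum_uniq//.
- congr EFin; rewrite -mulr_suml big_enum/= sum_perm_bst mulrAC divff ?mul1r//.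
- by move=> c; rewrite -[X in measurable X]/(s @^-1` [set c]); exact: measurable_funPTI.
- by move=> c _; exact: s_unif.
- by apply: measurableT_comp => //; exact: measurable_funM.
- by move=> w _; rewrite /= /bst_count -expRM_natr.
Qed.

Lemma eq_rt_subtrees n k (p p' : 'I_n -> nat) :
  (forall i : 'I_n, (0 < i)%N -> p i = p' i) -> rt_subtrees k p = rt_subtrees k p'.
Proof.
move=> pp'; apply: eq_card => v; rewrite !inE; congr (_ == k).
apply: eq_card => u; rewrite !inE; apply: eq_connect => x y /=.
rewrite /rt_edge/=; by case: posnP => //= x0; rewrite pp'.
Qed.

Lemma codes_root n c : c \in codes n -> nth 0%N c 0 = 0%N.
Proof.
elim: n c => [|n IH] c; first by rewrite inE => /eqP ->.
case/allpairsP => -[c' j] [cn jn ->]; have [sc _] := codesP cn.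
rewrite nth_rcons sc; case: n IH cn jn sc => [_ _|n IH cn _ _]; last exact: IH cn.
by rewrite /= inE => /eqP.
Qed.

Section attachment_law.
Context (R : realType) d (Om : measurableType d) (P : probability Om R).
Variables (n : nat) (p : 'I_n -> {RV P >-> nat}).
Hypothesis p_unif : is_uniform_attachment p.

(** The root gets the dummy parent 0 so that the code can be matched with the elements of
    [codes n]. *)
Definition attachment_code (w : Om) : seq nat :=
  [seq if val i == 0%N then 0%N else p i w | i <- enum 'I_n].

Lemma nth_attachment_code w (i : 'I_n) :
  nth 0%N (attachment_code w) i = if val i == 0%N then 0%N else p i w.
Proof.
rewrite /attachment_code (nth_map i) ?size_enum_ord ?ltn_ord//.
by rewrite nth_ord_enum.
Qed.

Lemma attachment_code_eq c : size c = n ->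
  [set w | attachment_code w = c] =
  \bigcap_(i in [set: 'I_n])
    [set w | (if val i == 0%N then 0%N else p i w) = nth 0%N c i].
Proof.
move=> sc; apply/seteqP; split=> w /=.
  by move=> <- i _ /=; rewrite nth_attachment_code.
move=> H; apply: (@eq_from_nth _ 0%N) => [|i]; rewrite size_map size_enum_ord ?sc// => i_n.
by have := H (Ordinal i_n) I; rewrite /= -(nth_attachment_code w (Ordinal i_n)).
Qed.

Lemma measurable_attachment_code c : measurable [set w | attachment_code w = c].
Proof.
have [sc|sc] := eqVneq (size c) n; last first.
  rewrite (_ : [set w | _] = set0) ?measurable0//; apply/seteqP; split => // w /= E.
  by move: sc; rewrite -E size_map size_enum_ord eqxx.
rewrite attachment_code_eq//; apply: fin_bigcap_measurable => // i _.
have [i0|i0] := eqVneq (val i) 0%N.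
  have [c0|c0] := eqVneq 0%N (nth 0%N c i).
    by rewrite (_ : [set w | _] = setT)//; apply/seteqP; split => // w _ /=.
  rewrite (_ : [set w | _] = set0)//; apply/seteqP; split => // w /= /eqP.
  by rewrite (negbTE c0).
rewrite -[X in measurable X]/(p i @^-1` [set nth 0%N c i]).
exact: measurable_funPTI.
Qed.

Lemma prod_attachment : \prod_(i < n | (0 < i)%N) (i%:R^-1 : R) = (n.-1)`!%:R^-1.
Proof.
rewrite prodfV -natr_prod; congr (_%:R^-1).
case: (n) => [|m]; first by rewrite big_ord0.
rewrite fact_prod -(big_mkord (fun i => (0 < i)%N) id) big_mkcond big_ltn//= mul1n.
by rewrite big_nat_cond [RHS]big_nat_cond; apply: eq_big => // i /andP[/andP[-> _] _].
Qed.

Lemma attachment_code_law c : c \in codes n ->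
  P [set w | attachment_code w = c] = ((n.-1)`!%:R^-1)%:E.
Proof.
move=> cn; have [sc hc] := codesP cn; have c0 := codes_root cn.
have [p1 p2] := p_unif.
pose J : {set 'I_n} := [set i : 'I_n | (0 < i)%N]%SET.
have -> : [set w | attachment_code w = c] =
    \bigcap_(i in [set` J]) p i @^-1` [set nth 0%N c i].
  rewrite attachment_code_eq//; apply/seteqP; split => w H i /=.
    rewrite inE => i0; have := H i I; rewrite /= gtn_eqF//.
  move=> _; case: eqP => [i0|/eqP i0]; first by rewrite i0 c0.
  by have := H i; rewrite /= inE lt0n i0; apply.
rewrite (p2 J (fun i => [set nth 0%N c i])) ?subxx//.
rewrite (eq_bigr (fun i : 'I_n => (i%:R^-1 : R)%:E)) => [|i]; last first.
  by rewrite inE => i0; rewrite p1// hc.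
rewrite prodEFin -prod_attachment; congr EFin.
by apply: eq_bigl => i; rewrite inE.
Qed.

End attachment_law.

Lemma rrt_count_mgf (R : realType) d (Om : measurableType d) (P : probability Om R)
    n (p : 'I_n -> {RV P >-> nat}) k (t : R) : (0 < k)%N -> is_uniform_attachment p ->
  ('E_P[(fun w => expR (t * rrt_count_RV p k w))] =
    (expR t ^+ (n == k) * rrt_gf k (expR t) n.-1)%:E)%E.
Proof.
move=> k0 p_unif.
have f0 : ((n.-1)`!%:R : R) != 0 by rewrite pnatr_eq0 -lt0n fact_gt0.
have total : ((n.-1)`!%:R^-1 : R) *+ size (codes n) = 1.
  by case: (n) f0 => [_|m f0]; rewrite ?size_codes -[LHS]mulr_natr ?mulVf// fact0 invr1 mulr1.
rewrite (@expectation_finite _ _ _ P _ (attachment_code p) (codes n) (n.-1)`!%:R^-1 _ _ _ _ _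
  (fun c => expR t ^+ rt_subtrees k (fun i : 'I_n => nth 0%N c i))) ?codes_uniq//.
- congr EFin; rewrite -mulr_suml; have [n0|n0] := posnP n; last first.
    by rewrite sum_codes_rrt// mulrAC divff ?mul1r.
  (* On zero nodes the empty code is the only one, and both sides are 1 because k > 0. *)
  subst n; rewrite big_seq1 fact0 invr1 mulr1 (_ : (0 == k)%N = false).
    rewrite expr0 mul1r rrt_gf0 (_ : rt_subtrees _ _ = 0%N) ?expr0//.
    by apply: eq_card0 => -[].
  by case: (k) k0.
- exact: measurable_attachment_code.
- exact: attachment_code_law.
- by apply: measurableT_comp => //; exact: measurable_funM.
- move=> w _; rewrite /= /rrt_count expRM_natr; congr (_ ^+ _).
  by apply: eq_rt_subtrees => i i0; rewrite nth_attachment_code gtn_eqF.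
Qed.

Lemma bt_subtrees_le k t : (bt_subtrees k t <= bt_size t)%N.
Proof. by elim: t => //= l IHl x r IHr; case: eqP => _; lia. Qed.

Theorem theorem1p5 (R : realType)
  (d d' : nat -> measure_display)
  (Om : forall n : nat, measurableType (d n))
  (Om' : forall n : nat, measurableType (d' n))
  (P : forall n : nat, probability (Om n) R)
  (P' : forall n : nat, probability (Om' n) R)
  (s : forall n : nat, {RV (P n) >-> {perm 'I_n}})
  (p : forall n : nat, 'I_n -> {RV (P' n) >-> nat})
  (k : nat -> nat)
  (s_uniform : forall n : nat, is_uniform_perm (s n))
  (p_uniform : forall n : nat, is_uniform_attachment (p n))
  (k_gt0 : forall n : nat, (0 < k n)%N)
  (k_small : (fun n : nat => (k n)%:R : R^o) =o_\oo
             (fun n : nat => Num.sqrt n%:R : R^o)) :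
  cvg_in_distribution (fun n : nat => standardized_RV (bst_count_RV (s n) (k n)))
    (normal_prob 0 1) /\
  cvg_in_distribution (fun n : nat => standardized_RV (rrt_count_RV (p n) (k n)))
    (normal_prob 0 1).
Proof.
(* Used with q = sqrt n to exclude k = n, since k <= sqrt n / 2 for large n. *)
have half_sqr (q : R) : 1 <= q -> ~ q ^+ 2 <= 2^-1 * q.
  by clear => q1 h; nra.
have k_cvg : (fun n => (k n)%:R / Num.sqrt n%:R : R) @ \oo --> (0 : R).
  apply/cvgr0Pnorm_le => e e0; near=> n.
  have n0 : (0 < n)%N by near: n; exact: nbhs_infty_gt.
  have q0 : 0 < Num.sqrt n%:R :> R by rewrite sqrtr_gt0 ltr0n.
  have : `|(k n)%:R : R^o| <= e * `|Num.sqrt n%:R : R^o|.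
    by near: n; move/eqoP : k_small; apply.
  by rewrite normrM normfV ler_pdivrMr// normr_gt0 gt_eqF.
split.
- apply: (@normal_limit_of_quasi_power R k k_gt0 d Om P _
    (fun n t => bst_gf (k n) (expR t) n) (fun n => bst_mean R (k n))
    (fun n => bst_variance R (k n))).
  + move=> n; exists n%:R => w; rewrite /= /bst_count normr_nat ler_nat.
    rewrite (leq_trans (bt_subtrees_le _ _))// bt_size_bst size_map size_enum_ord//.
  + by move=> n; exact: bst_variance_ge.
  + by move=> n t; exact: bst_count_mgf.
  + move=> x t ht; apply: (bst_quasi_power_cvg k_gt0 k_cvg
      (F := fun n u => bst_gf (k n) (expR u)) _ _ ht) => n u.
      exact: bst_gf0.
    by move=> j; exact: bst_gf_rec.
- apply: (@normal_limit_of_quasi_power R k k_gt0 d' Om' P' _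
    (fun n t => expR t ^+ (n == k n) * rrt_gf (k n) (expR t) n.-1) (fun n => rrt_mean R (k n))
    (fun n => rrt_variance R (k n))).
  + move=> n; exists n%:R => w; rewrite /= /rrt_count normr_nat ler_nat.
    by rewrite -[X in (_ <= X)%N](card_ord n) max_card.
  + by move=> n; exact: rrt_variance_ge.
  + by move=> n t; exact: rrt_count_mgf.
  + move=> x t ht.
    have lim : rrt_gf (k n) (expR (t n)) n.-1 * expR (- (n%:R * (rrt_mean R (k n) * t n +
        rrt_variance R (k n) * t n ^+ 2 / 2))) @[n --> \oo] --> (1 : R).
      apply: (rrt_quasi_power_cvg k_gt0 k_cvg
        (F := fun n u => rrt_gf (k n) (expR u)) _ _ ht) => n u; first exact: rrt_gf0.
      by move=> j; exact: rrt_gf_rec.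
    (* For large n the size n of the whole tree differs from [k n], so its factor is 1. *)
    move: lim; apply: cvg_trans; apply: near_eq_cvg; near=> n.
    rewrite (_ : (n == k n) = false) ?expr0 ?mul1r//.
    have n0 : (0 < n)%N by near: n; exact: nbhs_infty_gt.
    have q1 : 1 <= Num.sqrt n%:R :> R by rewrite -{1}sqrtr1 ler_wsqrtr ?ler1n.
    have : `|(k n)%:R / Num.sqrt n%:R : R| <= 2^-1.
      by near: n; move/cvgr0Pnorm_le : k_cvg; apply; rewrite invr_gt0.
    rewrite ger0_norm ?divr_ge0 ?sqrtr_ge0// ler_pdivrMr; last by lra.
    have nq : n%:R = Num.sqrt n%:R ^+ 2 :> R by rewrite sqr_sqrtr.
    by case: eqP => // <-; rewrite {1}nq => /(half_sqr _ q1).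
Unshelve. all: by end_near. Qed.
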